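(* There exist infinitely many Engel manifolds $(M,\mathcal{D})$, with the underlying $4$-manifolds $M$ closed and pairwise non-diffeomorphic, such that $M$ admits no open book decomposition supporting $\mathcal{D}$.
   Context: All manifolds are smooth and connected, except that pages and bindings of open books are not required to be connected. A manifold is closed if it is compact without boundary. Engel structures. An Engel structure on a $4$-manifold $M$ is a smooth rank-$2$ distribution $\mathcal{D}\subset TM$ such that $\mathcal{E}:=[\mathcal{D},\mathcal{D}]$ is a distribution of constant rank $3$ and $[\mathcal{E},\mathcal{E}]=TM$. Here $[\mathcal{F},\mathcal{F}]$ denotes the span, at each point, of the values of sections of $\mathcal{F}$ and of Lie brackets of pairs of sections of $\mathcal{F}$. An Engel manifold is a $4$-manifold together with an Engel structure on it. An Engel structure determines a unique line field $\mathcal{W}\subset\mathcal{D}$ with $[\mathcal{W},\mathcal{E}]\subset\mathcal{E}$; the foliation of $M$ tangent to $\mathcal{W}$ is called the isotropic (or characteristic) foliation of $\mathcal{D}$. Open books. An open book decomposition of a closed manifold $M$ of dimension $m$ is a pair $(V,h)$, where $V$ is a compact $(m-1)$-manifold with boundary and $h: V \to V$ is a diffeomorphism that restricts to the identity near $\partial V$ (the monodromy), together with a diffeomorphism of $M$ with the quotient space $\mathcal{MT}(V,h) \cup_{\mathrm{id}} (\partial V \times D^2)$. Here $\mathcal{MT}(V,h)$ is the mapping torus of $h$, i.e. $V\times[0,1]$ with $(x,1)$ identified with $(h(x),0)$; since $h$ is the identity near $\partial V$, its boundary is canonically $\partial V\times S^1$, and it is glued by the identity to $\partial(\partial V\times D^2)=\partial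 V\times S^1$. The binding is the submanifold of $M$ corresponding to $\partial V\times\{0\}$. For $\theta\in S^1=[0,1]/(0\sim 1)$, the page at angle $\theta$ is the submanifold of $M$ corresponding to the union of $V\times\{\theta\}$ with $\partial V\times R_\theta$, where $R_\theta\subset D^2$ is the closed radial segment from $0$ to the boundary point $\theta$; its boundary is the binding. Supporting open books (in the sense of Colin, Presas and Vogel). An open book decomposition of a closed $4$-manifold $M$ supports (or carries) an Engel structure $\mathcal{D}$ on $M$ if its binding is a disjoint union of $2$-tori and the isotropic foliation $\mathcal{W}$ of $\mathcal{D}$ is transverse to the interiors of all pages and tangent to the binding. *)

(* Defs.v *)
From HB Require Import structures.
From Stdlib Require Import Relation_Operators.
From mathcomp Require Import all_boot all_order all_algebra.
From mathcomp Require Import all_classical all_reals all_analysis.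

Set Implicit Arguments.
Unset Strict Implicit.
Unset Printing Implicit Defensive.

Import Order.TTheory GRing.Theory Num.Theory.
Import numFieldNormedType.Exports.

Local Open Scope classical_set_scope.
Local Open Scope ring_scope.

(** * Smooth maps between subsets of Euclidean spaces *)

Definition partials (R : realType) (n m : nat) (s : seq 'I_n)
    (f : 'rV[R]_n -> 'rV[R]_m) : 'rV[R]_n -> 'rV[R]_m :=
  foldr (fun i (g : 'rV[R]_n -> 'rV[R]_m) x => 'D_(delta_mx 0 i) g x) f s.

(* C^oo on an open set. *)
Definition smooth_open (R : realType) (n m : nat) (U : set 'rV[R]_n)
    (f : 'rV[R]_n -> 'rV[R]_m) : Prop :=
  forall (s : seq 'I_n) (x : 'rV[R]_n), U x ->
    {for x, continuous (partials s f)} /\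
    forall i : 'I_n, derivable (partials s f) x (delta_mx 0 i).

(* On an arbitrary subset, smooth means: locally the restriction of a map that
   is smooth on an open set. *)
Definition smooth_on (R : realType) (n m : nat) (A : set 'rV[R]_n)
    (f : 'rV[R]_n -> 'rV[R]_m) : Prop :=
  forall x, A x -> exists (U : set 'rV[R]_n) (g : 'rV[R]_n -> 'rV[R]_m),
    [/\ open U, U x, smooth_open U g & forall y, A y -> U y -> f y = g y].

(** * Manifolds with (possibly empty) boundary *)

(* [coord] is relevant on [dom] only, and [param] on [coord @` dom] only. *)
Record chart (R : realType) (T : Type) (n : nat) := Chart {
  dom : set T;
  coord : T -> 'rV[R]_n;
  param : 'rV[R]_n -> T }.

Definition image_of (R : realType) (T : Type) (n : nat) (c : chart R T n) :
  set 'rV[R]_n := coord c @` dom c.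

(* Change of coordinates; relevant on [coord c @` (dom c `&` dom d)]. *)
Definition transition (R : realType) (T : Type) (n : nat)
  (c d : chart R T n) : 'rV[R]_n -> 'rV[R]_n := coord d \o param c.

(* The half-space {x_0 >= 0}, the model for manifolds with boundary. *)
Definition halfspace (R : realType) (n : nat) : set 'rV[R]_n :=
  [set x | forall i : 'I_n, i = 0%N :> nat -> 0 <= x 0 i].

Definition is_chart (R : realType) (T : topologicalType) (n : nat)
    (c : chart R T n) : Prop :=
  [/\ open (dom c),
      exists2 O : set 'rV[R]_n, open O & image_of c = O `&` @halfspace R n,
      forall p, dom c p -> param c (coord c p) = p,
      {within dom c, continuous (coord c)} &
      {within image_of c, continuous (param c)}].

Record manifold (R : realType) (n : nat) := Manifold {
  carrier :> topologicalType;
  atlas : set (chart R carrier n);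
  manifold_hausdorff : hausdorff_space carrier;
  manifold_second_countable : @second_countable carrier;
  manifold_chart : forall c, atlas c -> is_chart c;
  manifold_cover : forall p, exists2 c, atlas c & dom c p;
  manifold_compat : forall c d, atlas c -> atlas d ->
    smooth_on (coord c @` (dom c `&` dom d)) (transition c d) }.
Arguments atlas {R n} m.

Definition boundary (R : realType) (n : nat) (M : manifold R n) : set M :=
  [set p | exists2 c, atlas M c &
     dom c p /\ exists2 i : 'I_n, i = 0%N :> nat & coord c p 0 i = 0].
Arguments boundary {R n} M _.

Definition closed_manifold (R : realType) (n : nat) (M : manifold R n) : Prop :=
  compact [set: M] /\ boundary M = set0.

Definition connected_manifold (R : realType) (n : nat) (M : manifold R n) :
  Prop := [set: M] !=set0 /\ connected [set: M].

(** * Smooth maps *)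

Definition euclid_atlas (R : realType) (n : nat) : set (chart R 'rV[R]_n n) :=
  [set Chart setT id id].

Definition line_atlas (R : realType) : set (chart R R 1) :=
  [set Chart setT (fun t : R => const_mx t) (fun v : 'rV[R]_1 => v 0 0)].

Definition prod_chart (R : realType) (X Y : Type) (n m : nat)
    (c : chart R X n) (d : chart R Y m) : chart R (X * Y) (n + m) :=
  Chart (dom c `*` dom d)
        (fun p => row_mx (coord c p.1) (coord d p.2))
        (fun v => (param c (lsubmx v), param d (rsubmx v))).

Definition prod_atlas (R : realType) (X Y : Type) (n m : nat)
    (A : set (chart R X n)) (B : set (chart R Y m)) :
    set (chart R (X * Y) (n + m)) :=
  [set e | exists2 c, A c & exists2 d, B d & e = prod_chart c d].

(* Smoothness of [f] on an arbitrary subset [S]; [A] and [B] are atlases of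
   [X] and [Y]. *)
Definition smooth_map (R : realType) (X Y : topologicalType) (n m : nat)
    (A : set (chart R X n)) (B : set (chart R Y m)) (S : set X) (f : X -> Y) :
    Prop :=
  {within S, continuous f} /\
  forall c d, A c -> B d ->
    smooth_on (coord c @` (dom c `&` S `&` f @^-1` dom d))
              (coord d \o f \o param c).

(* [f] restricts to a diffeomorphism from the subset [S] onto the subset [T]. *)
Definition diffeo_on (R : realType) (X Y : topologicalType) (n m : nat)
    (A : set (chart R X n)) (B : set (chart R Y m)) (S : set X) (T : set Y)
    (f : X -> Y) : Prop :=
  [/\ smooth_map A B S f, f @` S = T &
      exists2 g : Y -> X, smooth_map B A T g & forall x, S x -> g (f x) = x].

Definition embedding_on (R : realType) (X Y : topologicalType) (n m : nat)
    (A : set (chart R X n)) (B : set (chart R Y m)) (S : set X) (f : X -> Y) :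
    Prop :=
  diffeo_on A B S (f @` S) f.

Definition diffeomorphic (R : realType) (n : nat) (M N : manifold R n) : Prop :=
  exists f : M -> N, diffeo_on (atlas M) (atlas N) setT setT f.

(** * Distributions on manifolds without boundary *)

(* Tangent vectors at [p] are represented by their coordinates in the charts
   around [p]: [D c (coord c p)] is the fibre at [p] read in the chart [c]. *)
Definition tangent_distribution (R : realType) (n : nat) (M : manifold R n) :
    Type :=
  chart R M n -> 'rV[R]_n -> set 'rV[R]_n.

(* Compatible with changes of charts, and locally spanned by a smooth frame
   (the rows of [X]). *)
Definition is_distribution (R : realType) (n k : nat) (M : manifold R n)
    (D : tangent_distribution M) : Prop :=
  (forall c d, atlas M c -> atlas M d -> forall x v,
     (coord c @` (dom c `&` dom d)) x ->
     (D c x v <-> D d (transition c d x) ('D_v (transition c d) x))) /\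
  (forall c p, atlas M c -> dom c p ->
     exists (U : set 'rV[R]_n) (X : 'rV[R]_n -> 'M[R]_(k, n)),
       [/\ open U /\ U `<=` image_of c, U (coord c p),
           forall i, smooth_open U (fun x => row i (X x)) &
           forall x, U x ->
             row_free (X x) /\ forall v, D c x v <-> (v <= X x)%MS]).

Definition local_section (R : realType) (n : nat) (M : manifold R n)
    (D : tangent_distribution M) (c : chart R M n) (U : set 'rV[R]_n)
    (X : 'rV[R]_n -> 'rV[R]_n) : Prop :=
  [/\ open U, U `<=` image_of c, smooth_open U X &
      forall x, U x -> D c x (X x)].

Definition lie_bracket (R : realType) (n : nat) (X Y : 'rV[R]_n -> 'rV[R]_n)
  (x : 'rV[R]_n) : 'rV[R]_n := 'D_(X x) Y x - 'D_(Y x) X x.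

Definition linear_span (R : realType) (n : nat) (S : set 'rV[R]_n) :
    set 'rV[R]_n :=
  [set v | exists k (A : 'M[R]_(k, n)),
     (forall i, S (row i A)) /\ (v <= A)%MS].

(* [D, D]. Local sections give the same span as global ones. *)
Definition derived (R : realType) (n : nat) (M : manifold R n)
    (D : tangent_distribution M) : tangent_distribution M :=
  fun c x => linear_span
    [set v | exists (U : set 'rV[R]_n) (X Y : 'rV[R]_n -> 'rV[R]_n),
       [/\ local_section D c U X, local_section D c U Y, U x &
           v = X x \/ v = lie_bracket X Y x]].

Definition engel_structure (R : realType) (M : manifold R 4)
    (D : tangent_distribution M) : Prop :=
  [/\ is_distribution 2 D,
      is_distribution 3 (derived D) &
      forall c p, atlas M c -> dom c p ->
        derived (derived D) c (coord c p) = setT].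

(* [W] is the line field tangent to the isotropic foliation of [D]. *)
Definition isotropic_line_field (R : realType) (M : manifold R 4)
    (D W : tangent_distribution M) : Prop :=
  [/\ is_distribution 1 W,
      forall c p, atlas M c -> dom c p ->
        W c (coord c p) `<=` D c (coord c p) &
      forall c U X Y, atlas M c ->
        local_section W c U X -> local_section (derived D) c U Y ->
        forall x, U x -> derived D c x (lie_bracket X Y x)].

(* The vectors, read in the chart [c], tangent at [p] to a submanifold [S] whose
   boundary does not contain [p]: the velocities of smooth curves in [S]. *)
Definition tangent_to (R : realType) (n : nat) (M : manifold R n) (S : set M)
    (c : chart R M n) (p : M) : set 'rV[R]_n :=
  [set v | exists (e : R) (gamma : R -> M),
     [/\ 0 < e,
         smooth_map (@line_atlas R) (atlas M) [set t | - e < t < e] gamma,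
         forall t, - e < t < e -> S (gamma t),
         gamma 0 = p &
         'D_1 (coord c \o gamma) 0 = v]].
Arguments tangent_to {R n M} S c p _.

(** * Open books *)

Definition sqnorm2 (R : realType) (z : 'rV[R]_2) : R :=
  z 0 0 ^+ 2 + z 0 1 ^+ 2.

(* The point of angle [t] of the unit circle, for t in R/Z. *)
Definition circle_point (R : realType) (t : R) : 'rV[R]_2 :=
  \row_i (if i == 0 then cos (2 * pi * t) else sin (2 * pi * t)).

(* The relation generating the identifications of V x [0,1] + dV x D^2 whose
   quotient is MT(V,h) \cup_id (dV x D^2). *)
Inductive book_glue (R : realType) (n : nat) (V : manifold R n) (h : V -> V) :
    V * R + V * 'rV[R]_2 -> V * R + V * 'rV[R]_2 -> Prop :=
| glue_mapping_torus (x : V) :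
    book_glue h (inl (x, 1)) (inl (h x, 0))
| glue_boundary (x : V) (t : R) : boundary V x -> 0 <= t <= 1 ->
    book_glue h (inl (x, t)) (inr (x, circle_point t)).

Definition book_pieces (R : realType) (n : nat) (V : manifold R n) :
    set (V * R + V * 'rV[R]_2) :=
  [set u | match u with
           | inl (x, t) => 0 <= t <= 1
           | inr (x, z) => boundary V x /\ sqnorm2 z <= 1
           end].

(* [ob_a] on V x [0,1] and [ob_b] on dV x D^2 induce the bijection from the
   quotient onto [M].  The smooth structure of the quotient is the one for which
   this bijection is a diffeomorphism as expressed by the last two fields:
   - [ob_a] is extended to V x R by the rule of the mapping torus, seen as
     V x R modulo (x, t + 1) ~ (h x, t);
   - the gluing along dV x S^1 is smoothed by a collar [ob_collar] of dV in V,
     with which dV x D^2 is enlarged to dV x {|z| < 2}.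
   int V x R and dV x {|z| < 2} then cover the quotient by open sets. *)
Record open_book (R : realType) (n : nat) (M : manifold R n.+1) := OpenBook {
  ob_page : manifold R n;
  ob_monodromy : ob_page -> ob_page;
  ob_a : ob_page * R -> M;
  ob_b : ob_page * 'rV[R]_2 -> M;
  ob_collar : ob_page * R -> ob_page;
  ob_compact : compact [set: ob_page];
  ob_monodromy_diffeo :
    diffeo_on (atlas ob_page) (atlas ob_page) setT setT ob_monodromy;
  ob_monodromy_id : exists2 U : set ob_page, open U /\ boundary ob_page `<=` U &
    forall x, U x -> ob_monodromy x = x;
  ob_surj : forall p : M,
    exists2 u, book_pieces u & sum_rect (fun=> M) ob_a ob_b u = p;
  ob_inj : forall u v, book_pieces u -> book_pieces v ->
    (sum_rect (fun=> M) ob_a ob_b u = sum_rect (fun=> M) ob_a ob_b v <->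
     clos_refl_sym_trans _ (book_glue ob_monodromy) u v);
  ob_a_period : forall x t, ob_a (x, t + 1) = ob_a (ob_monodromy x, t);
  ob_collar_embedding :
    embedding_on (prod_atlas (atlas ob_page) (@line_atlas R)) (atlas ob_page)
      (boundary ob_page `*` [set s | 0 <= s < 1]) ob_collar;
  ob_collar0 : forall x, boundary ob_page x -> ob_collar (x, 0) = x;
  ob_b_collar : forall x s t, boundary ob_page x -> 0 <= s < 1 ->
    ob_b (x, (1 + s) *: circle_point t) = ob_a (ob_collar (x, s), t);
  ob_a_embedding : forall s : R,
    embedding_on (prod_atlas (atlas ob_page) (@line_atlas R)) (atlas M)
      (~` boundary ob_page `*` [set t | s < t < s + 1]) ob_a;
  ob_b_embedding :
    embedding_on (prod_atlas (atlas ob_page) (@euclid_atlas R 2)) (atlas M)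
      (boundary ob_page `*` [set z | sqnorm2 z < 4]) ob_b }.

Arguments ob_monodromy {R n M} _ _.
Arguments ob_a {R n M} _ _.
Arguments ob_b {R n M} _ _.
Arguments ob_collar {R n M} _ _.

Definition binding (R : realType) (n : nat) (M : manifold R n.+1)
    (ob : open_book M) : set M :=
  [set ob_b ob (x, 0) | x in boundary (ob_page ob)].
Arguments binding {R n M} ob _.

Definition page (R : realType) (n : nat) (M : manifold R n.+1)
    (ob : open_book M) (theta : R) : set M :=
  [set ob_a ob (x, theta) | x in [set: ob_page ob]] `|`
  [set p | exists x r, [/\ boundary (ob_page ob) x, 0 <= r <= 1 &
                           p = ob_b ob (x, r *: circle_point theta)]].
Arguments page {R n M} ob theta _.

(* The boundary of each page is the binding. *)
Definition page_interior (R : realType) (n : nat) (M : manifold R n.+1)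
  (ob : open_book M) (theta : R) : set M := page ob theta `\` binding ob.
Arguments page_interior {R n M} ob theta _.

Definition circle (R : realType) : set 'rV[R]_2 := [set z | sqnorm2 z = 1].

(* [B] is the union of finitely many disjoint embedded copies of S^1 x S^1
   (finitely many suffice, since bindings are compact). *)
Definition disjoint_union_of_tori (R : realType) (n : nat) (M : manifold R n)
    (B : set M) : Prop :=
  exists (k : nat) (tau : 'I_k -> 'rV[R]_2 * 'rV[R]_2 -> M),
    [/\ forall i,
          embedding_on (prod_atlas (@euclid_atlas R 2) (@euclid_atlas R 2))
            (atlas M) (@circle R `*` @circle R) (tau i),
        B = \bigcup_i (tau i @` (@circle R `*` @circle R)) &
        trivIset setT (fun i => tau i @` (@circle R `*` @circle R))].

Definition supports (R : realType) (M : manifold R 4) (ob : open_book M)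
    (D : tangent_distribution M) : Prop :=
  disjoint_union_of_tori (binding ob) /\
  exists W : tangent_distribution M,
    [/\ isotropic_line_field D W,
        (* W is transverse to the interiors of the pages *)
        forall (theta : R) p c, page_interior ob theta p ->
          atlas M c -> dom c p -> forall v, exists w u,
            [/\ W c (coord c p) w,
                tangent_to (page_interior ob theta) c p u & v = w + u] &
        (* W is tangent to the binding *)
        forall p c, binding ob p -> atlas M c -> dom c p ->
          W c (coord c p) `<=` tangent_to (binding ob) c p].

(* Main.v *)
Require Import Defs.
From HB Require Import structures.
From Stdlib Require Import Relation_Operators.
From mathcomp Require Import all_boot all_order all_algebra.
From mathcomp Require Import generic_quotient.
From mathcomp Require Import all_classical all_reals all_analysis.
From mathcomp Require Import ring lra zify.

(* On R^4 with coordinates (t, x, y, z), let f(t) = (0, n t cos t, cos t, 1).  The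
   plane field spanned by d/dt and f(t) is an Engel structure whose isotropic line
   field is spanned by f.  It is invariant under a discrete cocompact group
   containing tau : (t, x, y, z) |-> (t + pi, x + n pi y, y, -z), which maps f to -f,
   so the quotient carries a non-orientable isotropic line field.

   A supporting open book would orient it.  Off the binding the line field is
   transverse to the pages, hence oriented by the increasing angle; on the cover,
   the sign of the derivative of the angle along f is locally constant off the
   preimage of the binding, and, the binding having codimension two, it is globally
   constant.  But composing with tau changes it.

   A homeomorphism of two quotients lifts to R^4 and conjugates the groups.  For n
   even the torsion subgroup of the abelianization has exponent n, so the quotients
   for different even n are not diffeomorphic. *)

Set Implicit Arguments.
Unset Strict Implicit.
Unset Printing Implicit Defensive.

Import Order.TTheory GRing.Theory Num.Theory.
Import numFieldNormedType.Exports.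
Import Defs.

Local Open Scope classical_set_scope.
Local Open Scope ring_scope.

(** * Continuously differentiable maps *)

(** Since [f] depends on t alone, bracketing with d/dt differentiates it, and the flag is spanned by
    d/dt, f, f', f''. Without the entry n t cos t the vectors f' and f'' would be parallel; with it,
    translating t by pi changes [f] by minus a linear map: a shear of x by n pi y, and a flip of z
    that compensates for the constant last entry. The flip contributes a Z/2 beside the torsion Z/n,
    hence the restriction to even n.

    The orientation argument meets two obstacles. The page angle is multivalued; it is replaced by
    the square of its direction, a rational function of the disc coordinate, of which only the sense
    of rotation along [f] matters. And nothing global is known about the complement of the preimage
    of the binding; the sign is therefore made a property of germs, which has a meaning at every
    point of a convex set and is locally constant there. Most of the remaining analysis converts the
    data of an open book, smooth maps on subsets with smooth left inverses, into charts of the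
    4-manifold. *)

Section DirectionalDerivatives.
Context {R : realType}.

Lemma is_derive_line (V W : normedModType R) (f : V -> W) (a v : V) (s : R) :
  derivable f (a + s *: v) v ->
  is_derive s 1 (fun s : R => f (a + s *: v)) ('D_v f (a + s *: v)).
Proof.
have E : (fun h : R => h^-1 *: (((fun s => f (a + s *: v)) \o shift s) (h *: (1 : R))
            - f (a + s *: v)))
     = (fun h : R => h^-1 *: ((f \o shift (a + s *: v)) (h *: v) - f (a + s *: v))).
  apply/funext => h /=; congr (_ *: (f _ - _)).
  by rewrite [_ *: 1]mulr1 scalerDl addrCA.
by move=> d; split; rewrite /derivable /derive E.
Qed.

Lemma derivable_scale (V W : normedModType R) (f : V -> W) (a v : V) (c : R) :
  derivable f a v -> derivable f a (c *: v) /\ 'D_(c *: v) f a = c *: 'D_v f a.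
Proof.
move=> d; have [->|c0] := eqVneq c 0.
  by rewrite !scale0r derive0; split => //; exact: derivable0.
suff H : is_derive a (c *: v) f (c *: 'D_v f a) by split; [exact: ex_derive|exact: derive_val].
have H : (fun h : R => h^-1 *: ((f \o shift a) (h *: (c *: v)) - f a)) @ 0^' -->
     c *: 'D_v f a.
  have -> : (fun h : R => h^-1 *: ((f \o shift a) (h *: (c *: v)) - f a)) =
     (fun h : R => c *: ((fun h => h^-1 *: ((f \o shift a) (h *: v) - f a)) (h * c))).
    apply/funext => h /=; rewrite !scalerA; congr (_ *: _).
    have [->|h0] := eqVneq h 0; first by rewrite mul0r invr0 mulr0.
    by rewrite invfM mulrCA mulfV // mulr1.
  apply: cvgZl_tmp.
  have lim0 : (fun h : R => h * c) @ 0^' --> 0^'.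
    move=> A [e /= e0 H]; exists (e / `|c|) => /=; first by rewrite divr_gt0 // normr_gt0.
    move=> h /=; rewrite sub0r normrN ltr_pdivlMr ?normr_gt0 // => hc h0; apply: H.
      by rewrite /ball_ /= sub0r normrN normrM.
    by rewrite mulf_neq0.
  exact: (cvg_comp _ _ lim0 d).
by split; [apply/cvg_ex; eexists; exact: H|exact: (cvg_lim _ H)].
Qed.

Lemma mean_value_line (V : normedModType R) (g : V -> R) (a v : V) :
  (forall s : R, 0 <= s <= 1 -> derivable g (a + s *: v) v) ->
  exists2 c : R, 0 <= c <= 1 & g (a + v) - g a = 'D_v g (a + c *: v).
Proof.
move=> H.
have d (x : R) : x \in `]0, 1[%R -> is_derive x 1 (fun s : R => g (a + s *: v)) ('D_v g (a + x *: v)).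
  rewrite in_itv /= => /andP[x0 x1]; apply: is_derive_line; apply: H.
  by rewrite !ltW.
have c : {within `[0, 1], continuous (fun s : R => g (a + s *: v))}.
  apply: derivable_within_continuous => x; rewrite in_itv /= => x01.
  by have [] := is_derive_line (H _ x01).
have [x + E] := MVT ltr01 d c.
rewrite in_itv /= => /andP[x0 x1]; exists x; first by rewrite !ltW.
by move: E; rewrite scale1r scale0r addr0 subr0 mulr1.
Qed.

End DirectionalDerivatives.

Section C1.
Context {R : realType}.

Lemma cvg_sumr (T : Type) (F : set_system T) (FF : Filter F) (V : normedModType R) n
    (f : 'I_n -> T -> V) (l : 'I_n -> V) :
  (forall i, f i x @[x --> F] --> l i) ->
  \sum_(i < n) f i x @[x --> F] --> \sum_(i < n) l i.
Proof.
move=> H; rewrite (_ : (fun x => _) = \sum_(i < n) f i); last first.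
  by apply/funext => x; rewrite fct_sumE.
elim/big_ind2 : _ => [|g1 l1 g2 l2 h1 h2|i _]; [exact: cvg_cst|exact: cvgD|exact: H].
Qed.

Lemma rV_norm_le n (x : 'rV[R]_n) (e : R) : 0 <= e ->
  (forall i, `|x 0 i| <= e) -> `|x| <= e.
Proof.
move=> e0 H; rewrite /Num.Def.normr /= mx_normrE; apply: bigmax_le => // -[i j] _ /=.
by rewrite (ord1 i).
Qed.

Lemma rV_coord_le n (x : 'rV[R]_n) i : `|x 0 i| <= `|x|.
Proof.
by rewrite [leRHS]/Num.Def.normr /= mx_normrE; apply: (le_bigmax _ (fun i => `|x i.1 i.2|) (0, i)).
Qed.

Lemma rV_norm_lt n (x : 'rV[R]_n) (e : R) : 0 < e ->
  (forall i, `|x 0 i| < e) -> `|x| < e.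
Proof.
move=> e0 H; rewrite /Num.Def.normr /= mx_normrE; apply: bigmax_lt => // -[i j] _ /=.
by rewrite (ord1 i).
Qed.

Lemma differentiable_rV (V : normedModType R) n (f : V -> 'rV[R]_n) x :
  (forall i, differentiable (fun y => f y 0 i : R) x) -> differentiable f x.
Proof.
move=> H; have -> : f = \sum_(i < n) (fun y => f y 0 i *: delta_mx 0 i).
  by apply/funext => y; rewrite fct_sumE; exact: row_sum_delta.
by apply: differentiable_sum => i; apply: differentiableZl.
Qed.

Lemma differentiable_rV_coord (V : normedModType R) n (f : V -> 'rV[R]_n) x i :
  differentiable f x -> differentiable (fun y => f y 0 i : R) x.
Proof.
move=> H; have := differentiable_comp H (differentiable_coord (f x) 0 i).
exact.
Qed.

Lemma derive_rV_coord (V : normedModType R) n (f : V -> 'rV[R]_n) x v i :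
  derivable f x v -> 'D_v (fun y => f y 0 i : R) x = ('D_v f x) 0 i.
Proof. by move=> H; rewrite derive_mx // mxE. Qed.

Lemma derive_comp (U V W : normedModType R) (f : U -> V) (g : V -> W) x v :
  differentiable f x -> differentiable g (f x) ->
  'D_v (g \o f) x = 'D_('D_v f x) g (f x).
Proof.
move=> df dg; rewrite !deriveE //; last exact: differentiable_comp.
by rewrite diff_comp.
Qed.

Lemma deriveD_dir (V W : normedModType R) (f : V -> W) x u v :
  differentiable f x -> 'D_(u + v) f x = 'D_u f x + 'D_v f x.
Proof. by move=> df; rewrite !deriveE // linearD. Qed.

Lemma deriveZ_dir (V W : normedModType R) (f : V -> W) x c v :
  differentiable f x -> 'D_(c *: v) f x = c *: 'D_v f x.
Proof. by move=> df; rewrite !deriveE // linearZ. Qed.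

Lemma derive_sum_coord (W : normedModType R) n (f : 'rV[R]_n -> W) x v :
  differentiable f x -> 'D_v f x = \sum_(i < n) v 0 i *: 'D_(delta_mx 0 i) f x.
Proof.
move=> df; rewrite deriveE // [in LHS](row_sum_delta v) linear_sum.
by apply: eq_bigr => i _; rewrite linearZ deriveE.
Qed.

Lemma differentiable_of_linear (V W : normedModType R) (f : V -> W)
    (df : {linear V -> W}) x : continuous df ->
  (forall e : R, 0 < e -> \forall h \near (0 : V), `|f (h + x) - f x - df h| <= e * `|h|) ->
  differentiable f x.
Proof.
move=> c H; have E : f \o shift x = cst (f x) + df +o_ 0 id.
  apply/eqaddoP => e e0; apply: filterS (H e e0) => h.
  by rewrite -![(_ + _ : _ -> _) _]/(_ + _) -![(- _ : _ -> _) _]/(- _) /= opprD addrA.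
by apply/diff_locallyP; rewrite (diff_unique c E).
Qed.

(** The vertices of the staircase path from 0 to [h] that changes one coordinate at a time. *)
Let trunc n (k : nat) (h : 'rV[R]_n) : 'rV[R]_n := \row_i (if (i < k)%N then h 0 i else 0).

(** The increment of [g] telescopes along the staircase from [x] to [x + h], and on each edge the
    mean value theorem produces a partial derivative at a nearby point. The edges stay in the ball
    because the norm is the sup norm. [smooth_open] speaks of partial derivatives only, so total
    differentiability has to be recovered in this way. *)
Lemma differentiable_partials n (g : 'rV[R]_n -> R) (x : 'rV[R]_n) :
  (\forall y \near x, forall i, derivable g y (delta_mx 0 i)) ->
  (forall i, {for x, continuous (fun y => 'D_(delta_mx 0 i) g y)}) ->
  differentiable g x.
Proof.
move=> dg cg.
pose L (h : 'rV[R]_n) : R := \sum_(i < n) h 0 i * 'D_(delta_mx 0 i) g x.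
have Llin : linear L.
  move=> a u v; rewrite /L scaler_sumr -big_split /=.
  by apply: eq_bigr => i _; rewrite !mxE mulrDl -[_ *: (_ * _)]/(_ * _) mulrA.
pose LM := GRing.isLinear.Build _ _ _ _ _ Llin.
pose LL : {linear 'rV[R]_n -> R} := HB.pack L LM.
have Lcont : continuous LL.
  rewrite (_ : (LL : 'rV[R]_n -> R) = L) // /L => y.
  apply: (@cvg_sumr _ (nbhs y) _ R^o) => i; apply: cvgMr_tmp; exact: coord_continuous.
apply: (@differentiable_of_linear _ _ g LL x Lcont) => e e0.
(* There are [n] edges, each allowed an error of [e'] times the norm of [h]; [n.+1] keeps the
   quotient meaningful for [n] = 0. *)
pose e' : R := e / n.+1%:R.
have e'0 : 0 < e' by rewrite divr_gt0 // ltr0n.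
have : \forall y \near x, forall i, derivable g y (delta_mx 0 i) /\
    `|'D_(delta_mx 0 i) g y - 'D_(delta_mx 0 i) g x| <= e'.
  near=> y => i; split; first by move: i; near: y.
  move: i; near: y; apply: filter_forall => i.
  have /cvgrPdist_le /(_ _ e'0) := cg i.
  by apply: filterS => y; rewrite distrC.
move=> /nbhs_ballP[d /= d0 Hd].
apply/nbhs_ballP; exists d => //= h; rewrite -ball_normE /= sub0r normrN => hd.
have Hb (y : 'rV[R]_n) : (forall i, `|y 0 i| <= `|h 0 i|) -> ball x d (x + y).
  move=> H; rewrite -ball_normE /= opprD addNKr normrN.
  apply: le_lt_trans hd; apply: rV_norm_le => // i; exact: le_trans (H i) (rV_coord_le _ _).
have step (k : 'I_n) : `|g (x + trunc k.+1 h) - g (x + trunc k h)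
    - h 0 k * 'D_(delta_mx 0 k) g x| <= e' * `|h|.
  have -> : trunc k.+1 h = trunc k h + h 0 k *: delta_mx 0 k.
    apply/rowP => i; rewrite !mxE eqxx /= ltnS leq_eqVlt eq_sym.
    have [->|ik] := eqVneq k i; first by rewrite eqxx ltnn add0r mulr1.
    have -> : (k == i :> nat) = false by apply/negbTE.
    by rewrite /= mulr0 addr0.
  have Hs (s : R) : 0 <= s <= 1 -> ball x d (x + trunc k h + s *: (h 0 k *: delta_mx 0 k)).
    move=> /andP[s0 s1]; rewrite -addrA; apply: Hb => i; rewrite !mxE eqxx /=.
    have [->|ik] := eqVneq i k.
      by rewrite ltnn add0r mulr1 normrM ger0_norm // ler_piMl.
    by rewrite /= !mulr0 addr0; case: ifP; rewrite ?normr0.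
  rewrite addrA.
  have [|c c01 ->] := @mean_value_line R _ g (x + trunc k h) (h 0 k *: delta_mx 0 k).
    move=> s s01; have [dd _] := Hd _ (Hs _ s01) k.
    by have [] := derivable_scale (h 0 k) dd.
  have [dd de] := Hd _ (Hs _ c01) k.
  have [_ ->] := derivable_scale (h 0 k) dd.
  rewrite -[_ *: _]/(_ * _) -mulrBr normrM mulrC ler_pM //.
  exact: rV_coord_le.
have -> : g (h + x) = g x + \sum_(k < n) (g (x + trunc k.+1 h) - g (x + trunc k h)).
  rewrite (eq_bigr (fun k : 'I_n => (fun k => g (x + trunc k h)) k.+1 - (fun k => g (x + trunc k h)) k)) //.
  rewrite -(big_mkord xpredT (fun k => (fun k => g (x + trunc k h)) k.+1 - (fun k => g (x + trunc k h)) k)).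
  rewrite telescope_sumr //.
  have -> : trunc n h = h by apply/rowP => i; rewrite mxE ltn_ord.
  have -> : trunc 0 h = 0 by apply/rowP => i; rewrite !mxE.
  by rewrite addr0 addrCA subrr addr0 addrC.
rewrite [g x + _]addrC addrK -[L h]/(\sum_(i < n) _) -sumrB.
apply: le_trans (ler_norm_sum _ _ _) _.
apply: le_trans (ler_sum _ (fun k _ => step k)) _.
rewrite sumr_const card_ord -mulr_natr mulrAC ler_wpM2r // /e' mulrAC.
by rewrite -mulrA ler_piMr ?(ltW e0) // ler_pdivrMr ?ltr0n // mul1r ler_nat.
Unshelve. all: by end_near. Qed.

Lemma continuous_near_eq (S T : topologicalType) (f g : S -> T) (x : S) :
  (\forall y \near x, f y = g y) -> {for x, continuous f} -> {for x, continuous g}.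
Proof.
move=> fg cf; rewrite /prop_for /continuous_at -(nbhs_singleton fg).
by apply: cvg_trans cf; exact: near_eq_cvg.
Qed.

Lemma near_eq_differentiable (V W : normedModType R) (f g : V -> W) (x : V) :
  (\forall y \near x, f y = g y) -> differentiable f x -> differentiable g x.
Proof.
move=> fg df; apply: (@differentiable_of_linear _ _ g ('d f x) x (diff_continuous df)) => e e0.
have /eqaddoP/(_ e e0) := diff_locally df.
have : \forall h \near (0 : V), f (h + x) = g (h + x).
  have c : (fun h : V => h + x) @ (0 : V) --> x.
    by rewrite -[X in _ --> X]add0r; apply: cvgD; [exact: cvg_id|exact: cvg_cst].
  exact: (c _ fg).
apply: filterS2 => h E; rewrite -E -(nbhs_singleton fg).
by rewrite -![(_ + _ : _ -> _) _]/(_ + _) -![(- _ : _ -> _) _]/(- _) /= opprD addrA.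
Qed.

Definition C1on n m (U : set 'rV[R]_n) (f : 'rV[R]_n -> 'rV[R]_m) : Prop :=
  open U /\ forall x, U x -> differentiable f x /\
    forall v, {for x, continuous (fun y => 'D_v f y)}.

Lemma smooth_open_C1 n m (U : set 'rV[R]_n) (f : 'rV[R]_n -> 'rV[R]_m) :
  open U -> smooth_open U f -> C1on U f.
Proof.
move=> oU sf; split=> //.
have nU x : U x -> nbhs x U by move=> Ux; exact: open_nbhs_nbhs.
have df x : U x -> differentiable f x.
  move=> Ux; apply: differentiable_rV => j; apply: differentiable_partials.
    near=> y => i; have Uy : U y by near: y; exact: nU.
    by have [_ /(_ i) /= /derivable_mxP] := sf [::] y Uy; apply.
  move=> i; have [c _] := sf [:: i] x Ux.
  have c' : {for x, continuous (fun y => ('D_(delta_mx 0 i) f y) 0 j)}.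
    apply: (@continuous_comp _ _ _ (fun y => 'D_(delta_mx 0 i) f y) (fun A : 'rV[R]_m => A 0 j)).
      exact: c.
    exact: coord_continuous.
  refine (continuous_near_eq _ c'); near=> y.
  have Uy : U y by near: y; exact: nU.
  have [_ /(_ i) dy] := sf [::] y Uy.
  by rewrite (derive_rV_coord j dy).
move=> x Ux; split; first exact: df.
move=> v.
have H : {for x, continuous (fun y => \sum_(i < n) v 0 i *: 'D_(delta_mx 0 i) f y)}.
  apply: (@cvg_sumr _ (nbhs x)) => i; apply: cvgZl_tmp.
  by have [] := sf [:: i] x Ux.
apply: continuous_near_eq H; near=> y; rewrite -derive_sum_coord //; apply: df.
by near: y; exact: nU.
Unshelve. all: by end_near. Qed.

(** Close to [y0] the partial derivatives of [H] are close to those of the identity, so by the mean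
    value theorem equal values force |v| <= |v| / 2 for the difference v of the two points. *)
Lemma C1_inj_near_id n (H : 'rV[R]_n -> 'rV[R]_n) (V : set 'rV[R]_n) y0 :
  C1on V H -> V y0 -> (forall v, 'D_v H y0 = v) ->
  \forall e \near 0^'+, forall y y', ball y0 e y -> ball y0 e y' -> H y = H y' -> y = y'.
Proof.
move=> [oV CH] Vy0 dH.
(* Each coordinate of the difference is a sum of [n] terms of size at most k |v|, hence at most |v|
   / 2. *)
pose k : R := (2 * n.+1%:R)^-1.
have k0 : 0 < k by rewrite invr_gt0 mulr_gt0 // ltr0n.
have : \forall y \near y0, V y /\ forall i j, `|('D_(delta_mx 0 j) H y) 0 i - (delta_mx 0 j : 'rV[R]_n) 0 i| <= k.
  near=> y; split; first by near: y; exact: open_nbhs_nbhs.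
  move=> i j; apply: (@le_trans _ _ `|'D_(delta_mx 0 j) H y - delta_mx 0 j|).
    by rewrite (le_trans _ (rV_coord_le _ i)) // !mxE.
  move: j; near: y; apply: filter_forall => j.
  have [_ /(_ (delta_mx 0 j)) /cvgrPdist_le /(_ _ k0)] := CH _ Vy0.
  by apply: filterS => y; rewrite dH distrC.
move=> /nbhs_ballP[d /= d0 Hd].
near=> e => y y' yb y'b E.
have ed : e <= d by near: e; exact: nbhs_right_le.
set v := y - y'.
have inb (s : R) : 0 <= s <= 1 -> ball y0 d (y' + s *: v).
  move=> /andP[s0 s1]; move: yb y'b; rewrite -!ball_normE /= => yb y'b.
  apply: lt_le_trans ed.
  have -> : y0 - (y' + s *: v) = (1 - s) *: (y0 - y') + s *: (y0 - y).
    by rewrite /v !scalerBr !scalerBl !scale1r !opprD !opprK; apply/rowP => i; rewrite !mxE; ring.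
  apply: le_lt_trans (ler_normD _ _) _.
  rewrite !normrZ !ger0_norm ?subr_ge0 //.
  have e0 : 0 < e by [].
  have [->|sn0] := eqVneq s 0; first by rewrite subr0 mul1r mul0r addr0.
  have sp : 0 < s by rewrite lt_def sn0.
  have : s * `|y0 - y| < s * e by rewrite ltr_pM2l.
  have : (1 - s) * `|y0 - y'| <= (1 - s) * e by rewrite ler_wpM2l ?subr_ge0 // ltW.
  lra.
have Hv i : `|v 0 i| <= `|v| / 2.
  have [|c c01] := @mean_value_line R _ (fun y => H y 0 i) y' v.
    move=> s s01; apply: diff_derivable; apply: differentiable_rV_coord.
    by have [Vs _] := Hd _ (inb _ s01); have [] := CH _ Vs.
  have -> : y' + v = y by rewrite /v addrC subrK.
  rewrite E subrr.
  have [Vs Hs] := Hd _ (inb _ c01); have [ds _] := CH _ Vs.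
  rewrite derive_rV_coord; last exact: diff_derivable.
  rewrite derive_sum_coord // summxE => /esym E0.
  have -> : v 0 i = - (\sum_(j < n) v 0 j * (('D_(delta_mx 0 j) H (y' + c *: v)) 0 i - (delta_mx 0 j : 'rV[R]_n) 0 i)).
    under eq_bigr do rewrite mulrBr.
    rewrite sumrB.
    have -> : \sum_(j < n) v 0 j * ('D_(delta_mx 0 j) H (y' + c *: v)) 0 i = 0.
      by rewrite -[RHS]E0; apply: eq_bigr => j _; rewrite !mxE.
    rewrite sub0r opprK [in LHS](row_sum_delta v) summxE.
    by apply: eq_bigr => j _; rewrite !mxE.
  rewrite normrN; apply: le_trans (ler_norm_sum _ _ _) _.
  apply: (@le_trans _ _ (\sum_(j < n) `|v| * k)).
    apply: ler_sum => j _; rewrite normrM ler_pM //; exact: rV_coord_le.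
  rewrite sumr_const card_ord -[leLHS]mulr_natr -mulrA ler_wpM2l //.
  rewrite /k invfM -mulrA ler_piMr // mulrC ler_pdivrMr ?ltr0n //.
  by rewrite mul1r ler_nat.
have : `|v| <= `|v| / 2 by apply: rV_norm_le => //; rewrite divr_ge0.
move=> v2; have /eqP : `|v| = 0 by apply/eqP; rewrite eq_le normr_ge0 andbT; lra.
by rewrite normr_eq0 subr_eq0 => /eqP.
Unshelve. all: by end_near. Qed.

Lemma differentiable_mulmxr n m (A : 'M[R]_(n, m)) (z : 'rV[R]_n) :
  differentiable (mulmxr A : 'rV[R]_n -> 'rV[R]_m) z.
Proof.
apply: differentiable_rV => j.
rewrite (_ : (fun _ => _) = \sum_(i < n) (fun y : 'rV[R]_n => y 0 i *: A i j)).
  by apply: differentiable_sum => i; apply: differentiableZl; exact: differentiable_coord.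
by apply/funext => w; rewrite fct_sumE mxE.
Qed.

(** Jacobians are square, so a one-sided inverse of the Jacobian of [F] at [x0] is two-sided, and
    [G] is injective near [F x0]. As [F (G y)] and [y] have the same image under [G], they
    coincide. *)
Lemma local_section_of_retraction n (F G : 'rV[R]_n -> 'rV[R]_n) (U V : set 'rV[R]_n) x0 :
  nbhs x0 U -> differentiable F x0 -> C1on V G -> V (F x0) ->
  (forall x, U x -> V (F x) -> G (F x) = x) ->
  \forall y \near F x0, U (G y) /\ F (G y) = y.
Proof.
move=> nU dF [oV CG] VF GF.
have cF : {for x0, continuous F} := differentiable_continuous dF.
have nV : nbhs (F x0) V by exact: open_nbhs_nbhs.
have [dG _] := CG _ VF.
have GF0 : G (F x0) = x0 by apply: GF => //; exact: nbhs_singleton.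
have near_id : \forall x \near x0, (G \o F) x = x.
  near=> x => /=; apply: GF; near: x; [exact: nU|exact: (cF _ nV)].
have JFG : jacobian F x0 *m jacobian G (F x0) = 1%:M.
  apply/row_matrixP => i; rewrite !rowE mulmxA -!deriveEjacobian // mulmx1.
  rewrite -derive_comp // (near_eq_derive _ near_id).
  exact: derive_id.
have JGF := mulmx1C JFG.
(* Multiplying by the Jacobian of [F] normalises the derivative at [F x0] to the identity. *)
pose H y := G y *m jacobian F x0.
have lipH : C1on V H.
  split; first exact: oV.
  move=> y Vy; have [dGy cGy] := CG _ Vy.
  have dm := differentiable_mulmxr (jacobian F x0).
  have HE : H = mulmxr (jacobian F x0) \o G by [].
  split; first by rewrite HE; exact: differentiable_comp.
  move=> v; have c : {for y, continuous (fun y => 'D_v G y *m jacobian F x0)}.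
    apply: (@continuous_comp _ _ _ (fun y => 'D_v G y) (mulmxr (jacobian F x0))); first exact: cGy.
    exact: differentiable_continuous.
  have E z : V z -> 'D_v H z = 'D_v G z *m jacobian F x0.
    move=> Vz; have [dGz _] := CG _ Vz.
    rewrite HE derive_comp // deriveE // diff_lin //.
    by move=> w; exact: differentiable_continuous.
  apply: continuous_near_eq c; near=> z; rewrite E //.
  by near: z; exact: open_nbhs_nbhs.
have dH v : 'D_v H (F x0) = v.
  have dm := differentiable_mulmxr (jacobian F x0).
  have HE : H = mulmxr (jacobian F x0) \o G by [].
  rewrite HE derive_comp // deriveE // diff_lin /=; last first.
    by move=> w; exact: differentiable_continuous.
  by rewrite deriveEjacobian // -mulmxA JGF mulmx1.
have /filter_ex [e [inj e0]] : \forall e \near 0^'+, (forall y y', ball (F x0) e y ->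
   ball (F x0) e y' -> H y = H y' -> y = y') /\ 0 < e.
  near=> e; split; last by [].
  by near: e; exact: (C1_inj_near_id lipH).
have cG : {for F x0, continuous G} := differentiable_continuous dG.
have nB : nbhs (F x0) (ball (F x0) e) by exact: nbhsx_ballx.
have nU' : nbhs (G (F x0)) [set x | U x /\ V (F x) /\ ball (F x0) e (F x)].
  rewrite GF0; near=> x; split; [|split]; near: x.
  - exact: nU.
  - exact: (cF _ nV).
  - exact: (cF _ nB).
near=> y.
have [UG [VFG bFG]] : [set x | U x /\ V (F x) /\ ball (F x0) e (F x)] (G y).
  by near: y; exact: (cG _ nU').
split; first exact: UG.
apply: inj; [exact: bFG|by near: y|].
by congr (_ *m _); exact: GF.
Unshelve. all: by end_near. Qed.

End C1.

(** * The manifolds *)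

Definition parity_sign (k : int) : int := (-1) ^+ `|k|%N.

Lemma parity_signD k l : parity_sign (k + l) = parity_sign k * parity_sign l.
Proof.
rewrite /parity_sign -!(signr_odd _ `|_|%N) -signr_addb; congr (_ ^+ _).
by congr nat_of_bool; lia.
Qed.

Lemma parity_sign0 : parity_sign 0 = 1. Proof. by []. Qed.
Lemma parity_sign1 : parity_sign 1 = -1. Proof. by []. Qed.

Lemma parity_signK k : parity_sign k * parity_sign k = 1.
Proof. by rewrite /parity_sign -exprMn mulrNN mulr1 expr1n. Qed.

Lemma parity_signN k : parity_sign (- k) = parity_sign k.
Proof. by rewrite /parity_sign abszN. Qed.

(* [Deck k a b c] acts on R^4 by
     (t, x, y, z) |-> (t + k pi, x + (n k y + a) pi, y + b, (-1)^k z + c). *)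
Record deck := Deck { deck_t : int; deck_x : int; deck_y : int; deck_z : int }.

Section Deck.
Variable n : nat.
Implicit Types g h : deck.

Definition deck1 := Deck 0 0 0 0.

(** The semidirect product of Z^3 by Z in which 1 acts by (a, b, c) |-> (a + n b, b, -c). The
    quotient will thus be the mapping torus of a linear diffeomorphism of the 3-torus. *)
Definition deck_mul g h := Deck (deck_t g + deck_t h)
  (deck_x g + deck_x h + n%:Z * deck_t g * deck_y h) (deck_y g + deck_y h)
  (deck_z g + parity_sign (deck_t g) * deck_z h).

Definition deck_inv g := Deck (- deck_t g)
  (- deck_x g + n%:Z * deck_t g * deck_y g) (- deck_y g)
  (- (parity_sign (deck_t g) * deck_z g)).

Lemma deck_mulV g : deck_mul g (deck_inv g) = deck1.
Proof.
rewrite /deck_mul /deck_inv /deck1 /=; congr Deck; [ring|ring|ring|].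
by rewrite mulrN mulrA parity_signK mul1r subrr.
Qed.

Lemma deck_Vmul g : deck_mul (deck_inv g) g = deck1.
Proof.
rewrite /deck_mul /deck_inv /deck1 /=; congr Deck; [ring|ring|ring|].
by rewrite parity_signN addrC subrr.
Qed.

Lemma deck_mulA g h l : deck_mul g (deck_mul h l) = deck_mul (deck_mul g h) l.
Proof.
rewrite /deck_mul /=; congr Deck; [ring|ring|ring|rewrite parity_signD; ring].
Qed.

Lemma deck_mul1 g : deck_mul g deck1 = g.
Proof. by case: g => k a b c; rewrite /deck_mul /=; congr Deck; ring. Qed.

Lemma deck_1mul g : deck_mul deck1 g = g.
Proof.
by case: g => k a b c; rewrite /deck_mul /= parity_sign0; congr Deck; ring.
Qed.

End Deck.

Section DeckAction.
Variables (R : realType) (n : nat).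
Implicit Types (g h : deck) (x y v : 'rV[R]_4).

Definition row4 (a b c d : R) : 'rV[R]_4 := \row_i nth 0 [:: a; b; c; d] i.

Lemma row4P x a b c d : x 0 0 = a -> x 0 1 = b -> x 0 2 = c -> x 0 3 = d ->
  x = row4 a b c d.
Proof.
move=> <- <- <- <-; apply/rowP => -[i Hi]; rewrite mxE.
by case: i Hi => [|[|[|[|]]]] //= Hi; congr (x _ _); apply/val_inj.
Qed.

(** Vectors are rows and matrices act on the right, so the contribution of y to x sits in row 2,
    column 1. *)
Definition deck_lin g : 'M[R]_4 := \matrix_(i, j)
  (if (i == 2 :> nat) && (j == 1 :> nat) then n%:R * (deck_t g)%:~R * pi
   else if i == j then (if i == 3 :> nat then (parity_sign (deck_t g))%:~R else 1)
   else 0).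

Definition deck_tr g : 'rV[R]_4 :=
  row4 ((deck_t g)%:~R * pi) ((deck_x g)%:~R * pi) (deck_y g)%:~R (deck_z g)%:~R.

Definition deck_act g x := x *m deck_lin g + deck_tr g.

Lemma deck_linE g v : v *m deck_lin g =
  row4 (v 0 0) (v 0 1 + n%:R * (deck_t g)%:~R * pi * v 0 2) (v 0 2)
       ((parity_sign (deck_t g))%:~R * v 0 3).
Proof.
by apply: row4P; rewrite mxE !big_ord_recl big_ord0 !mxE /=;
  rewrite !mulr0 ?mulr1 ?addr0 ?add0r //=; (try by congr (v _ _); apply/val_inj);
  (try by rewrite mulrC; congr (_ * v _ _); apply/val_inj);
  rewrite [X in _ + X]mulrC; congr (v _ _ + _ * v _ _); apply/val_inj.
Qed.

Lemma deck_actE g x : deck_act g x =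
  row4 (x 0 0 + (deck_t g)%:~R * pi)
       (x 0 1 + n%:R * (deck_t g)%:~R * pi * x 0 2 + (deck_x g)%:~R * pi)
       (x 0 2 + (deck_y g)%:~R)
       ((parity_sign (deck_t g))%:~R * x 0 3 + (deck_z g)%:~R).
Proof.
by apply: row4P; rewrite /deck_act mxE deck_linE /deck_tr !mxE.
Qed.

Lemma deck_actM g h x : deck_act g (deck_act h x) = deck_act (deck_mul n g h) x.
Proof.
rewrite !deck_actE; apply: row4P; rewrite !mxE /= ?parity_signD ?(rmorphD, rmorphM) /=; ring.
Qed.

Lemma deck_act1 x : deck_act deck1 x = x.
Proof.
by apply/esym; rewrite deck_actE; apply: row4P; rewrite /= ?parity_sign0; ring.
Qed.

Lemma deck_actK g x : deck_act (deck_inv n g) (deck_act g x) = x.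
Proof. by rewrite deck_actM deck_Vmul deck_act1. Qed.

Lemma int_norm_lt1 (k : int) (c : R) : 1 <= c -> `|k%:~R * c| < 1 -> k = 0.
Proof.
move=> c1 H; apply/eqP/contraT => k0; have : (1 : R) <= `|k%:~R * c|.
  rewrite normrM (ger0_norm (le_trans ler01 c1)) -intr_norm.
  by rewrite mulr_ege1 // -[1]/(1%:~R) ler_int; lia.
by rewrite leNgt H.
Qed.

Lemma pi_ge1 : (1 : R) <= pi.
Proof. by rewrite (le_trans _ (pi_ge2 R)) // ler1n. Qed.

(** The coordinate t comes first: once its translation vanishes, so do the shear and the flip, and
    the remaining displacements are multiples of pi or of 1. Hence the action is free, and balls of
    radius 1/2 embed in the quotient. *)
Lemma deck_small g x : `|deck_act g x - x| < 1 -> g = deck1.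
Proof.
move=> H; have Hi i : `|deck_act g x 0 i - x 0 i| < 1.
  by apply: le_lt_trans H; rewrite (le_trans _ (rV_coord_le _ i)) // !mxE.
case: g H Hi => k a b c _ Hi.
have k0 : k = 0.
  apply: (int_norm_lt1 pi_ge1); have := Hi 0; rewrite deck_actE mxE /=.
  by rewrite addrAC subrr add0r.
rewrite {}k0 in Hi *.
have b0 : b = 0.
  apply: (int_norm_lt1 (lexx 1)); have := Hi 2; rewrite deck_actE mxE /=.
  by rewrite addrAC subrr add0r mulr1.
rewrite {}b0 in Hi *.
have a0 : a = 0.
  apply: (int_norm_lt1 pi_ge1); have := Hi 1; rewrite deck_actE mxE /=.
  by rewrite mulr0 !mul0r addr0 addrAC subrr add0r.
have c0 : c = 0.
  apply: (int_norm_lt1 (lexx 1)); have := Hi 3; rewrite deck_actE mxE /=.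
  by rewrite parity_sign0 mul1r addrAC subrr add0r mulr1.
by rewrite a0 c0.
Qed.

Lemma deck_act_inj g h x : deck_act g x = deck_act h x -> g = h.
Proof.
move=> E; suff : deck_mul n (deck_inv n h) g = deck1.
  by move=> /(congr1 (deck_mul n h)); rewrite deck_mulA deck_mulV deck_1mul deck_mul1.
by apply: (@deck_small _ x); rewrite -deck_actM E deck_actK subrr normr0 ltr01.
Qed.

Lemma deck_actB g x y : deck_act g x - deck_act g y = (x - y) *m deck_lin g.
Proof. by rewrite /deck_act opprD addrACA subrr addr0 -mulmxBl. Qed.

Lemma deck_act_differentiable g x : differentiable (deck_act g) x.
Proof.
have -> : deck_act g = (mulmxr (deck_lin g) : 'rV[R]_4 -> 'rV[R]_4) + cst (deck_tr g) by [].
by apply: differentiableD; [exact: differentiable_mulmxr|exact: differentiable_cst].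
Qed.

Lemma deck_act_continuous g : continuous (deck_act g).
Proof. by move=> x; apply: differentiable_continuous; exact: deck_act_differentiable. Qed.

(* The orbits are closed: an element bringing [x] close to [y] is determined by
   the distance at which it does so. *)
Lemma deck_orbit_closed x y :
  (forall e : R, 0 < e -> exists g, `|deck_act g x - y| < e) -> exists g, deck_act g x = y.
Proof.
move=> H; have h0 : (0 : R) < 2^-1 by [].
have [g Hg] := H _ h0; exists g.
apply/eqP; rewrite -subr_eq0 -normr_eq0; apply/eqP.
suff small (e : R) : 0 < e -> `|deck_act g x - y| < e.
  apply/eqP; apply/contraT; rewrite -normr_gt0 normr_id => /small.
  by rewrite ltxx.
move=> e0; have : 0 < Num.min e 2^-1 by rewrite lt_min e0.
move=> /H[h]; rewrite lt_min => /andP[he h2].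
suff -> : g = h by [].
suff : deck_mul n g (deck_inv n h) = deck1.
  move=> /(congr1 (deck_mul n ^~ h)).
  by rewrite -deck_mulA deck_Vmul deck_1mul deck_mul1.
apply: (@deck_small _ (deck_act h x)); rewrite -deck_actM deck_actK.
have -> : deck_act g x - deck_act h x = (deck_act g x - y) - (deck_act h x - y).
  by rewrite opprB addrA subrK.
by apply: le_lt_trans (ler_normB _ _) _; rewrite [1](splitr 1) mul1r ltrD.
Qed.

(** The action is not isometric, the shear growing with [deck_t g]. The bound depends on [g] only
    through its t-translation, which is read off the displacement of any single point; this is what
    separates orbits. *)
Lemma deck_expansion g x y :
  `|deck_act g x - deck_act g y| <= (1 + n%:R * `|(deck_t g)%:~R * pi|) * `|x - y|.
Proof.
rewrite deck_actB; set v := x - y.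
have p0 : 0 <= n%:R * `|(deck_t g)%:~R * pi| :> R by rewrite mulr_ge0.
have c0 (w : R) : `|w| <= `|v| -> `|w| <= (1 + n%:R * `|(deck_t g)%:~R * pi|) * `|v|.
  by move=> w0; rewrite mulrDl mul1r ler_wpDr // mulr_ge0.
apply: rV_norm_le; first by rewrite mulr_ge0 // addr_ge0.
move=> [i Hi]; rewrite deck_linE mxE.
case: i Hi => [|[|[|[|]]]] //= _.
- exact/c0/rV_coord_le.
- rewrite mulrDl mul1r; apply: le_trans (ler_normD _ _) _.
  rewrite lerD ?rV_coord_le // -mulrA -mulrA mulrA -mulrA normrM ger0_norm // -mulrA ler_wpM2l //.
  by rewrite !mulrA normrM ler_wpM2l // rV_coord_le.
- exact/c0/rV_coord_le.
- apply: c0; rewrite normrM -intr_norm /parity_sign normrX normrN normr1 expr1n mul1r.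
  exact: rV_coord_le.
Qed.

End DeckAction.

Lemma convex_connected (R : realType) (V : normedModType R) (A : set V) :
  (forall x y (t : R), A x -> A y -> 0 <= t <= 1 -> A (x + t *: (y - x))) -> connected A.
Proof.
move=> cA; have [->|/set0P[x Ax]] := eqVneq A set0; first exact: connected0.
have -> : A = \bigcup_(y in A) ((fun t : R => x + t *: (y - x)) @` `[0, 1]).
  apply/seteqP; split => [y Ay|_ [y Ay [t + <-]]].
    by exists y => //; exists 1; rewrite ?scale1r ?subrKC //= in_itv /= lexx ler01.
  by rewrite /= in_itv /= => t01; exact: cA.
apply: bigcup_connected.
  by exists x => y Ay; exists 0; rewrite ?scale0r ?addr0 //= in_itv /= lexx ler01.
move=> y Ay; apply: connected_continuous_connected; first exact: segment_connected.
apply: continuous_subspaceT => t.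
refine (@cvgD _ _ _ (nbhs t) _ (fun=> x) (fun t => t *: (y - x)) _ _ _ _).
  exact: cvg_cst.
exact: scalel_continuous.
Qed.

(** * The orbit space as a topological space *)

Section Quotient.
Local Open Scope quotient_scope.
Variables (R : realType) (n : nat).

Definition same_orbit : rel 'rV[R]_4 := fun x y => `[< exists g, y = deck_act n g x >].

Lemma same_orbit_refl : reflexive same_orbit.
Proof. by move=> x; apply/asboolP; exists deck1; rewrite deck_act1. Qed.

Lemma same_orbit_sym : symmetric same_orbit.
Proof.
by move=> x y; apply/asboolP/asboolP => -[g ->]; exists (deck_inv n g); rewrite deck_actK.
Qed.

Lemma same_orbit_trans : transitive same_orbit.
Proof.
move=> y x z /asboolP[g ->] /asboolP[h ->]; apply/asboolP.
by exists (deck_mul n h g); rewrite deck_actM.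
Qed.

Canonical same_orbit_equiv :=
  EquivRel same_orbit same_orbit_refl same_orbit_sym same_orbit_trans.

Definition orbit_space : topologicalType := quotient_topology {eq_quot same_orbit}.

Definition orbit_of (x : 'rV[R]_4) : orbit_space := (\pi_{eq_quot same_orbit} x)%qT.

Lemma orbit_ofP x y : orbit_of x = orbit_of y <-> exists g, y = deck_act n g x.
Proof.
split; first by move=> /eqmodP /asboolP.
by move=> H; apply/eqmodP/asboolP.
Qed.

Lemma orbit_of_act g x : orbit_of (deck_act n g x) = orbit_of x.
Proof. by apply/esym/orbit_ofP; exists g. Qed.

Lemma orbit_of_surj p : exists x, orbit_of x = p.
Proof. by exists (repr (p : {eq_quot same_orbit}))%qT; exact: reprK. Qed.

Lemma orbit_of_continuous : continuous orbit_of.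
Proof. exact: pi_continuous. Qed.

Lemma orbit_of_open (A : set 'rV[R]_4) : open A -> open (orbit_of @` A).
Proof.
move=> oA; rewrite /open /= /quotient_open.
rewrite (_ : _ @^-1` _ = \bigcup_(g in setT) (deck_act n g @^-1` A)).
  by apply: bigcup_open => g _; move/continuousP: (@deck_act_continuous R n g); exact.
apply/seteqP; split => [x [y Ay yx]|x [g _ Ax]].
  have /orbit_ofP[g E] : orbit_of x = orbit_of y by rewrite yx.
  by exists g => //=; rewrite -E.
by exists (deck_act n g x) => //; exact: orbit_of_act.
Qed.

Lemma orbit_of_inj_ball x0 x y : ball x0 2^-1 x -> ball x0 2^-1 y ->
  orbit_of x = orbit_of y -> x = y.
Proof.
rewrite -!ball_normE /= => xb yb /orbit_ofP[g yE].
suff g1 : g = deck1 by rewrite yE g1 deck_act1.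
apply: (@deck_small R n g x); rewrite -yE.
have -> : y - x = (x0 - x) - (x0 - y) by rewrite opprB [RHS]addrC addrA subrK.
by apply: le_lt_trans (ler_normB _ _) _; rewrite [1](splitr 1) mul1r ltrD.
Qed.

Lemma orbit_nbhs x (A : set orbit_space) : nbhs x (orbit_of @^-1` A) -> nbhs (orbit_of x) A.
Proof.
rewrite !nbhsE /= => -[U [oU Ux] UA]; exists (orbit_of @` U).
  by split; [exact: orbit_of_open|exists x].
by move=> _ [y Uy <-]; exact: UA.
Qed.

(** If the neighbourhoods of two orbits always meet, some [g] takes a point near [x] to a point near
    [y]. Its t-translation is bounded in terms of [y - x], so [g] expands by at most a factor [K]
    independent of it, and [g] takes [x] itself close to [y]. Closedness of orbits concludes. *)
Lemma orbit_space_hausdorff : hausdorff_space orbit_space.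
Proof.
move=> p q; have [x <-] := orbit_of_surj p; have [y <-] := orbit_of_surj q => pq.
apply/orbit_ofP; suff [g <-] : exists g, deck_act n g x = y by exists g.
apply: (@deck_orbit_closed R n) => e e0.
pose K : R := 1 + n%:R * (`|y - x| + 2).
have K1 : 1 <= K by rewrite lerDl mulr_ge0 // addr_ge0.
(* An error [K * d] comes from replacing x' by [x], another [d] from replacing y' by [y]; [d] <= 1
   accounts for the 2 in [K]. *)
pose d := Num.min 1 (e / (K + 1)).
have d0 : 0 < d by rewrite lt_min ltr01 divr_gt0 //; lra.
have nb z : nbhs (orbit_of z) (orbit_of @` ball z d).
  by apply: orbit_nbhs; near=> w; exists w => //; near: w; exact: nbhsx_ballx.
have [_ [[x' x'b <-] [y' y'b /esym/orbit_ofP[g yE]]]] := pq _ _ (nb x) (nb y).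
move: x'b y'b; rewrite -!ball_normE /= => x'b y'b.
exists g.
have tg : `|(deck_t g)%:~R * pi : R| <= `|y - x| + 2.
  have -> : (deck_t g)%:~R * pi = (y' - x') 0 0 :> R.
    by rewrite yE deck_actE !mxE /=; ring.
  apply: le_trans (rV_coord_le _ _) _.
  have -> : y' - x' = (y - x) + ((x - x') - (y - y')).
    by apply/rowP => i; rewrite !mxE; ring.
  apply: le_trans (ler_normD _ _) _; rewrite lerD2l.
  apply: le_trans (ler_normB _ _) _.
  have d1 : d <= 1 by rewrite ge_min lexx.
  by rewrite -[2]/(1 + 1) lerD // ltW // (lt_le_trans _ d1).
have -> : deck_act n g x - y = (deck_act n g x - deck_act n g x') - (y - y').
  by rewrite -yE opprB addrA subrK.
apply: le_lt_trans (ler_normB _ _) _.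
have h1 : `|deck_act n g x - deck_act n g x'| <= K * `|x - x'|.
  apply: le_trans (deck_expansion _ _ _ _) _; rewrite ler_wpM2r // lerD2l ler_wpM2l //.
apply: (@lt_le_trans _ _ ((K + 1) * d)).
  rewrite mulrDl mul1r ler_ltD //; apply: le_trans h1 _.
  by rewrite ler_wpM2l ?(ltW x'b) // (le_trans ler01).
rewrite mulrC -ler_pdivlMr; last lra.
by rewrite ge_min lexx orbT.
Unshelve. all: by end_near. Qed.

Lemma orbit_space_second_countable : @second_countable orbit_space.
Proof.
pose b (u : 'rV[rat]_4 * nat) : set orbit_space :=
  orbit_of @` ball (map_mx ratr u.1 : 'rV[R]_4) u.2.+1%:R^-1.
exists (range b); first exact: sub_countable (card_image_le b setT) (countableP _).
split; first by move=> _ [u _ <-]; apply: orbit_of_open; exact: ball_open.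
move=> p A nA; have [x xp] := orbit_of_surj p.
have : nbhs x (orbit_of @^-1` A).
  by apply: orbit_of_continuous; rewrite xp.
move=> /nbhs_ballP[e /= e0 He].
have [m Hm] : exists m : nat, m.+1%:R^-1 < e / 2.
  have e20 : 0 < e / 2 by rewrite divr_gt0.
  have [m _ /(_ m (leqnn m))] := near_infty_natSinv_lt (PosNum e20).
  by exists m.
have Hq (i : 'I_4) : exists q : rat, `|x 0 i - ratr q| < m.+1%:R^-1.
  have /rat_in_itvoo[q] : x 0 i - m.+1%:R^-1 < x 0 i + m.+1%:R^-1.
    by rewrite ltrD2l gtrN.
  rewrite in_itv /= => /andP[q1 q2]; exists q.
  by rewrite distrC ltr_distl q1 q2.
pose q : 'rV[rat]_4 := \row_i sval (cid (Hq i)).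
have qx : ball (map_mx ratr q : 'rV[R]_4) m.+1%:R^-1 x.
  rewrite -ball_normE /= distrC; apply: rV_norm_lt => // i.
  by rewrite !mxE; exact: svalP (cid (Hq i)).
exists (b (q, m)); first by split; [exists (q, m)|rewrite -xp; exists x].
move=> _ [y qy <-]; apply: He.
move: qx qy; rewrite -!ball_normE /= => qx qy.
have -> : x - y = (map_mx ratr q - y) - (map_mx ratr q - x).
  by rewrite opprB [RHS]addrC addrA subrK.
by apply: le_lt_trans (ler_normB _ _) _; rewrite [e]splitr ltrD // (lt_trans _ Hm).
Qed.

Lemma orbit_space_connected : connected [set: orbit_space].
Proof.
have -> : [set: orbit_space] = orbit_of @` setT.
  by apply/seteqP; split => // p _; have [x <-] := orbit_of_surj p; exists x.
apply: connected_continuous_connected; last first.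
  exact: continuous_subspaceT orbit_of_continuous.
exact: convex_connected.
Qed.

Lemma int_translate (c : R) (s : R) : 0 < c -> exists k : int, 0 <= s + k%:~R * c <= c.
Proof.
move=> c0; exists (- Num.floor (s / c)).
have /andP[h1 h2] := real_floor_itv (num_real (s / c)).
rewrite rmorphN mulNr subr_ge0 lerBlDr -ler_pdivlMr // h1 /=.
have := ltW h2; rewrite ler_pdivrMr // intrD mulrDl mul1r; lra.
Qed.

(** The cube of side pi contains a fundamental domain. The t-translation is chosen first because it
    affects x by the shear and z by the sign; y and z then land in [0, 1], which lies in [0, pi]. *)
Lemma orbit_space_compact : compact [set: orbit_space].
Proof.
have -> : [set: orbit_space] = orbit_of @` [set v : 'rV[R]_4 | forall i, `[0, pi]%classic (v 0 i)].
  apply/seteqP; split => // p _; have [x <-] := orbit_of_surj p.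
  have [k Hk] := int_translate (x 0 0) (pi_gt0 R).
  have [b Hb] := int_translate (x 0 2) (@ltr01 R).
  have [a Ha] := int_translate (x 0 1 + n%:R * k%:~R * pi * x 0 2) (pi_gt0 R).
  have [c Hc] := int_translate ((parity_sign k)%:~R * x 0 3) (@ltr01 R).
  exists (deck_act n (Deck k a b c) x); last exact: orbit_of_act.
  have p1 := pi_ge1 R.
  move=> [i Hi]; rewrite deck_actE /= mxE in_itv /=.
  by move: Hb Hc; rewrite !mulr1; case: i Hi => [|[|[|[|]]]] //= _; lra.
apply: continuous_compact; first exact: continuous_subspaceT orbit_of_continuous.
exact: rV_compact (fun=> @segment_compact R 0 pi).
Qed.

End Quotient.

Section SmoothExamples.
Context {R : realType}.

Lemma derive_affine n m (A : 'M[R]_(n, m)) (b : 'rV[R]_m) x v :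
  'D_v (fun y : 'rV[R]_n => y *m A + b) x = v *m A.
Proof.
have -> : (fun y : 'rV[R]_n => y *m A + b) = (mulmxr A : 'rV[R]_n -> 'rV[R]_m) + cst b by [].
rewrite deriveD; last 2 first.
- exact/diff_derivable/differentiable_mulmxr.
- exact/diff_derivable/differentiable_cst.
rewrite derive_cst addr0 deriveE; last exact: differentiable_mulmxr.
by rewrite diff_lin // => z; apply: differentiable_continuous; exact: differentiable_mulmxr.
Qed.

Lemma differentiable_affine n m (A : 'M[R]_(n, m)) (b : 'rV[R]_m) x :
  differentiable (fun y : 'rV[R]_n => y *m A + b) x.
Proof.
have -> : (fun y : 'rV[R]_n => y *m A + b) = (mulmxr A : 'rV[R]_n -> 'rV[R]_m) + cst b by [].
by apply: differentiableD; [exact: differentiable_mulmxr|exact: differentiable_cst].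
Qed.

Lemma smooth_affine n m (A : 'M[R]_(n, m)) (b : 'rV[R]_m) U :
  smooth_open U (fun y : 'rV[R]_n => y *m A + b).
Proof.
move=> s x _.
suff [B [c ->]] : exists (B : 'M[R]_(n, m)) c, partials s (fun y : 'rV[R]_n => y *m A + b)
    = (fun y => y *m B + c).
  split; first exact/differentiable_continuous/differentiable_affine.
  by move=> i; exact/diff_derivable/differentiable_affine.
elim: s => [|i s [B [c IH]]] /=; first by exists A, b.
exists 0, (delta_mx 0 i *m B); apply/funext => y.
by rewrite -/(partials s _) IH derive_affine mulmx0 add0r.
Qed.

Lemma differentiable_coord0 n m (H : R -> 'rV[R]_m) (x : 'rV[R]_n.+1) :
  derivable H (x 0 0) 1 -> differentiable (fun y : 'rV[R]_n.+1 => H (y 0 0)) x.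
Proof.
move=> /derivable1_diffP dH.
exact: (differentiable_comp (differentiable_coord x 0 0) dH).
Qed.

Lemma derive_coord0 n m (H : R -> 'rV[R]_m) H' (x v : 'rV[R]_n.+1) :
  is_derive (x 0 0) 1 H H' -> 'D_v (fun y : 'rV[R]_n.+1 => H (y 0 0)) x = v 0 0 *: H'.
Proof.
move=> [dH eH]; have /derivable1_diffP dH' := dH.
rewrite (@derive_comp _ _ _ _ (fun y : 'rV[R]_n.+1 => y 0 0) H) //; last exact: differentiable_coord.
have -> : 'D_v (fun y : 'rV[R]_n.+1 => y 0 0) x = v 0 0 *: 1.
  rewrite (@derive_rV_coord _ _ _ id); last exact: derivable_id.
  by rewrite derive_id [RHS]mulr1.
by rewrite deriveZ_dir // eH.
Qed.

(** Each [H k.+1] being the derivative of [H k], an iterated partial derivative is again some [H k']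
    of the first coordinate, or 0 once another direction has occurred. This is why the curve below
    is given together with closed forms for all its derivatives. *)
Lemma smooth_coord0 n m (H : nat -> R -> 'rV[R]_m) (k : nat) (U : set 'rV[R]_n.+1) :
  (forall k (t : R), is_derive t (1 : R) (H k) (H k.+1 t)) ->
  smooth_open U (fun y => H k (y 0 0)).
Proof.
move=> dH s x _.
suff [E|[k' E]] : partials s (fun y : 'rV[R]_n.+1 => H k (y 0 0)) = cst 0 \/
    exists k', partials s (fun y : 'rV[R]_n.+1 => H k (y 0 0)) = (fun y => H k' (y 0 0)).
- rewrite E; split; first exact/differentiable_continuous/differentiable_cst.
  by move=> i; exact: derivable_cst.
- have d y : differentiable (fun y : 'rV[R]_n.+1 => H k' (y 0 0)) y.
    by apply: differentiable_coord0; have [] := dH k' (y 0 0).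
  rewrite E; split; first exact/differentiable_continuous/d.
  by move=> i; exact/diff_derivable/d.
elim: s => [|i s [IH|[k' IH]]] /=; first by right; exists k.
  by left; apply/funext => y; rewrite -/(partials s _) IH derive_cst.
have [->|i0] := eqVneq i 0.
  right; exists k'.+1; apply/funext => y; rewrite -/(partials s _) IH (derive_coord0 _ (dH k' _)).
  by rewrite mxE eqxx /= scale1r.
left; apply/funext => y; rewrite -/(partials s _) IH (derive_coord0 _ (dH k' _)).
by rewrite mxE eqxx eq_sym (negbTE i0) /= scale0r.
Qed.

End SmoothExamples.

(** * The smooth structure of the orbit space *)

Section OrbitManifold.
Variables (R : realType) (n : nat).
Implicit Types (x y z : 'rV[R]_4) (g : deck).
Let M0 := orbit_space R n.
Let pr : 'rV[R]_4 -> M0 := @orbit_of R n.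

Definition orbit_coord x (p : M0) : 'rV[R]_4 :=
  xget x [set y | ball x 2^-1 y /\ pr y = p].

Definition orbit_chart x : chart R M0 4 :=
  Chart (pr @` ball x 2^-1) (orbit_coord x) pr.

Lemma orbit_coordK x y : ball x 2^-1 y -> orbit_coord x (pr y) = y.
Proof.
move=> xy; rewrite /orbit_coord; case: xgetP => [z _ [xz zy]|/(_ y)]; last by case.
exact: (@orbit_of_inj_ball _ n x).
Qed.

Lemma orbit_coord_continuous x p : dom (orbit_chart x) p ->
  {for p, continuous (orbit_coord x)}.
Proof.
move=> [y xy <-] A; rewrite orbit_coordK // => nA; apply: orbit_nbhs.
near=> z => /=; rewrite orbit_coordK; near: z => //.
by apply: open_nbhs_nbhs; split => //; exact: ball_open.
Unshelve. all: by end_near. Qed.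

Lemma image_of_orbit_chart x : image_of (orbit_chart x) = ball x 2^-1.
Proof.
apply/seteqP; split => [_ [_ [y xy <-] <-] /=|y xy]; first by rewrite orbit_coordK.
by exists (pr y); [exists y|exact: orbit_coordK].
Qed.

Lemma ball_t_gt x y : 1 <= x 0 0 -> ball x 2^-1 y -> 2^-1 < y 0 0.
Proof.
rewrite -ball_normE /= => x1 xy; have := le_lt_trans (rV_coord_le _ 0) xy.
rewrite !mxE ltr_norml => /andP[_]; lra.
Qed.

Lemma orbit_chartP x : 1 <= x 0 0 -> is_chart (orbit_chart x).
Proof.
move=> x1; split.
- by apply: orbit_of_open; exact: ball_open.
- exists (ball x 2^-1); first exact: ball_open.
  rewrite image_of_orbit_chart; apply/esym/setIidPl => y /(ball_t_gt x1) y0 i /eqP i0.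
  have -> : i = 0 by apply/val_inj/eqP.
  by rewrite ltW // (lt_trans _ y0).
- by move=> _ [y xy <-] /=; rewrite orbit_coordK.
- rewrite continuous_open_subspace; last by apply: orbit_of_open; exact: ball_open.
  by move=> p; rewrite inE => xp; exact: orbit_coord_continuous.
- exact/continuous_subspaceT/orbit_of_continuous.
Qed.

(** Two lifts of a point differ by a deck transformation, and by injectivity of the projection on
    the second ball the same one serves for all nearby points. Transitions are therefore locally
    affine. *)
Lemma orbit_transition x x' y :
  (orbit_coord x @` (dom (orbit_chart x) `&` dom (orbit_chart x'))) y ->
  exists g, [/\ ball x 2^-1 y, ball x' 2^-1 (deck_act n g y) &
    forall z, (deck_act n g @^-1` ball x' 2^-1) z ->
      transition (orbit_chart x) (orbit_chart x') z = deck_act n g z].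
Proof.
move=> [_ [[z xz <-] [z' xz' /esym zz']] <-] /=; rewrite orbit_coordK //.
have /orbit_ofP[g zE] := zz'; exists g; split => //; first by rewrite -zE.
move=> w xw.
have -> : pr w = pr (deck_act n g w) by exact/esym/orbit_of_act.
by rewrite orbit_coordK.
Qed.

(* The model space of charts is a half-space; translating the first coordinate
   places every chart in its interior. *)
Definition orbit_atlas : set (chart R M0 4) :=
  [set orbit_chart x | x in [set x : 'rV[R]_4 | 1 <= x 0 0]].

Lemma orbit_rep (p : M0) : exists2 x : 'rV[R]_4, 1 <= x 0 0 & pr x = p.
Proof.
have [x <-] := @orbit_of_surj R n p.
have [k /andP[k0 _]] := int_translate (x 0 0 - 1) (pi_gt0 R).
exists (deck_act n (Deck k 0 0 0) x); last exact: orbit_of_act.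
by rewrite deck_actE mxE /=; lra.
Qed.

Lemma orbit_cover (p : M0) : exists2 c, orbit_atlas c & dom c p.
Proof.
have [x x1 <-] := orbit_rep p.
by exists (orbit_chart x); [exists x|exists x => //; exact: ballxx].
Qed.

Lemma orbit_compat c d : orbit_atlas c -> orbit_atlas d ->
  smooth_on (coord c @` (dom c `&` dom d)) (transition c d).
Proof.
move=> [x _ <-] [x' _ <-] y /orbit_transition[g [xy xgy E]].
exists (deck_act n g @^-1` ball x' 2^-1), (deck_act n g); split => //.
- by move/continuousP: (@deck_act_continuous R n g); apply; exact: ball_open.
- exact: smooth_affine.
- by move=> z _ ?; exact: E.
Qed.

Definition orbit_manifold : manifold R 4 :=
  @Manifold R 4 M0 orbit_atlas (@orbit_space_hausdorff R n)
    (@orbit_space_second_countable R n)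
    (fun c '(ex_intro2 x x1 E) => eq_ind _ (fun c => is_chart c) (orbit_chartP x1) _ E)
    orbit_cover orbit_compat.

Lemma orbit_manifold_closed : closed_manifold orbit_manifold.
Proof.
split; first exact: orbit_space_compact.
apply/seteqP; split => // p [_ [x x1 <-]] [[y xy <-] [i /eqP i0]] /=.
have -> : i = 0 by apply/val_inj/eqP.
rewrite orbit_coordK // => y0.
by have := ball_t_gt x1 xy; rewrite y0 ltNge invr_ge0 ler0n.
Qed.

Lemma orbit_manifold_connected : connected_manifold orbit_manifold.
Proof.
by split; [exists (pr 0)|exact: orbit_space_connected].
Qed.

End OrbitManifold.

(** * The Engel structures *)

Section EngelCurve.
Variables (R : realType) (n : nat).
Implicit Types (t : R) (x v : 'rV[R]_4) (k : nat).

(** The k-th derivative of cos is the cosine of this phase. For t cos t the Leibniz rule adds k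
    times the preceding derivative of cos, which is the sine of this phase. *)
Definition engel_phase k t : R := t + k%:R * (pi / 2).

(* The [k]-th derivative of the curve [t |-> (0, n t cos t, cos t, 1)]. *)
Definition engel_curve k t : 'rV[R]_4 :=
  row4 0 (n%:R * (t * cos (engel_phase k t) + k%:R * sin (engel_phase k t)))
       (cos (engel_phase k t)) (k == 0)%:R.

Lemma is_derive_row4 (a b c d : R -> R) (a' b' c' d' t : R) :
  is_derive t (1 : R) a a' -> is_derive t (1 : R) b b' ->
  is_derive t (1 : R) c c' -> is_derive t (1 : R) d d' ->
  is_derive t (1 : R) (fun t => row4 (a t) (b t) (c t) (d t)) (row4 a' b' c' d').
Proof.
move=> ha hb hc hd.
have H (j : 'I_4) : is_derive t (1 : R) (fun t => row4 (a t) (b t) (c t) (d t) 0 j) (row4 a' b' c' d' 0 j).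
  rewrite mxE; under eq_fun do rewrite mxE.
  by case: j => [[|[|[|[|]]]]].
have D : derivable (fun t => row4 (a t) (b t) (c t) (d t)) t (1 : R).
  by apply/derivable_mxP => i j; rewrite (ord1 i); have [] := H j.
split => //; rewrite derive_mx //; apply/rowP => j; rewrite mxE.
by have [_ ->] := H j.
Qed.

Lemma is_derive_engel_phase k t : is_derive t (1 : R) (engel_phase k) 1.
Proof.
have := @is_deriveD _ _ _ id (cst (k%:R * (pi / 2))) t (1 : R) 1 0 _ _.
by rewrite addr0; apply.
Qed.

Lemma engel_phaseS k t : engel_phase k.+1 t = engel_phase k t + pi / 2.
Proof. by rewrite /engel_phase -addrA; congr (_ + _); rewrite -natr1 mulrDl mul1r. Qed.

Lemma cos_phaseS k t : cos (engel_phase k.+1 t) = - sin (engel_phase k t).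
Proof. by rewrite engel_phaseS cosDpihalf. Qed.

Lemma sin_phaseS k t : sin (engel_phase k.+1 t) = cos (engel_phase k t).
Proof. by rewrite engel_phaseS sinDpihalf. Qed.

Lemma engel_phase0 t : engel_phase 0 t = t.
Proof. by rewrite /engel_phase mul0r addr0. Qed.

Lemma is_derive_engel_curve k t : is_derive t (1 : R) (engel_curve k) (engel_curve k.+1 t).
Proof.
have hc : is_derive t (1 : R) (cos \o engel_phase k) (- sin (engel_phase k t)).
  have := is_derive_engel_phase k t => hp.
  by apply: is_derive_eq; rewrite mulr1.
have hs : is_derive t (1 : R) (sin \o engel_phase k) (cos (engel_phase k t)).
  have := is_derive_engel_phase k t => hp.
  by apply: is_derive_eq; rewrite mulr1.
apply: is_derive_row4.
- have -> : (fun t => n%:R * (t * cos (engel_phase k t) + k%:R * sin (engel_phase k t))) =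
     n%:R \*: (id * (cos \o engel_phase k) + k%:R \*: (sin \o engel_phase k)) by [].
  apply: is_derive_eq; rewrite cos_phaseS sin_phaseS -natr1 /GRing.scale /=; ring.
- by rewrite cos_phaseS.
Qed.

Lemma cos_int_pi (m : int) t : cos (t + m%:~R * pi) = (parity_sign m)%:~R * cos t.
Proof.
have N (l : nat) s : cos (s + l%:R * pi) = (-1) ^+ l * cos s.
  elim: l s => [|l IH] s; first by rewrite mul0r addr0 expr0 mul1r.
  by rewrite -natr1 mulrDl mul1r addrA cosDpi IH exprS mulN1r mulNr.
rewrite /parity_sign rmorphXn rmorphN1; case: m => l; first exact: N.
rewrite NegzE abszN /=.
have {2}-> : t = (t + (- l.+1%:Z)%:~R * pi) + l.+1%:R * pi by rewrite mulrNz; ring.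
by rewrite N mulrA -exprMn mulrNN mulr1 expr1n mul1r.
Qed.

Lemma sin_int_pi (m : int) t : sin (t + m%:~R * pi) = (parity_sign m)%:~R * sin t.
Proof.
have S (s : R) : sin s = - cos (s + pi / 2) by rewrite cosDpihalf opprK.
by rewrite !S addrAC cos_int_pi mulrN.
Qed.

(** Translation by k pi multiplies cos and sin by (-1)^k; the factor t then produces the shear, and
    the constant last entry is restored by the sign in z. The scalar in front is the source of
    non-orientability: the line spanned by [f] is invariant, [f] is not. *)
Lemma engel_curve_deck g k t : engel_curve k (t + (deck_t g)%:~R * pi) =
  (parity_sign (deck_t g))%:~R *: (engel_curve k t *m deck_lin R n g).
Proof.
rewrite deck_linE /engel_curve.
have -> : engel_phase k (t + (deck_t g)%:~R * pi) = engel_phase k t + (deck_t g)%:~R * pi.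
  by rewrite /engel_phase addrAC.
have sK : (parity_sign (deck_t g))%:~R * (parity_sign (deck_t g))%:~R = 1 :> R.
  by rewrite -intrM parity_signK.
rewrite cos_int_pi sin_int_pi; apply/esym/row4P; rewrite !mxE /=.
- by rewrite mulr0.
- ring.
- by [].
- by rewrite mulrA sK mul1r.
Qed.

(** A single family for the whole flag: [k] = 1, 2, 3 yields the Engel structure, its derived
    distribution and the tangent space. *)
Definition engel_frame k t : 'M[R]_(k.+1, 4) :=
  \matrix_i (if unlift 0 i is Some j then engel_curve j t else row4 1 0 0 0).

Lemma row_engel_frame0 k t : row 0 (engel_frame k t) = row4 1 0 0 0.
Proof. by rewrite rowK unlift_none. Qed.

Lemma row_engel_frameS k t (j : 'I_k) : row (lift 0 j) (engel_frame k t) = engel_curve j t.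
Proof. by rewrite rowK liftK. Qed.

Lemma mul_engel_frame k t (u : 'rV[R]_k.+1) : u *m engel_frame k t =
  u 0 0 *: row4 1 0 0 0 + \sum_(j < k) u 0 (lift 0 j) *: engel_curve j t.
Proof.
rewrite mulmx_sum_row big_ord_recl row_engel_frame0; congr (_ + _).
by apply: eq_bigr => j _; rewrite row_engel_frameS.
Qed.

Lemma engel_frameP k t v : reflect
  (exists a (b : nat -> R), v = a *: row4 1 0 0 0 + \sum_(j < k) b j *: engel_curve j t)
  (v <= engel_frame k t)%MS.
Proof.
apply: (iffP submxP) => [[u ->]|[a [b ->]]].
  exists (u 0 0), (fun j => if insub j is Some i then u 0 (lift 0 i) else 0).
  by rewrite mul_engel_frame; congr (_ + _); apply: eq_bigr => j _; rewrite valK.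
exists (\row_i (if unlift 0 i is Some j then b j else a)).
rewrite mul_engel_frame mxE unlift_none; congr (_ + _).
by apply: eq_bigr => j _; rewrite mxE liftK.
Qed.

Hypothesis n_gt0 : (0 < n)%N.

(** This is the determinant of the (x, y)-parts of f' and f''. It equals -n (1 + sin^2 t). *)
Lemma engel_wronskian t : n%:R * (t * - sin t + cos t) * - cos t
   - n%:R * (t * - cos t + 2 * - sin t) * - sin t != 0.
Proof.
have cs := cos2Dsin2 t.
have -> : n%:R * (t * - sin t + cos t) * - cos t
   - n%:R * (t * - cos t + 2 * - sin t) * - sin t = - (n%:R * (1 + sin t ^+ 2)) :> R.
  by rewrite -[X in X + sin t ^+ 2]cs; ring.
by rewrite oppr_eq0 mulf_neq0 ?pnatr_eq0 -?lt0n // gt_eqF // ltr_wpDr // sqr_ge0.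
Qed.

Lemma engel_frame_free t (a b c d : R) :
  a *: row4 1 0 0 0 + b *: engel_curve 0 t + c *: engel_curve 1 t + d *: engel_curve 2 t = 0 ->
  [/\ a = 0, b = 0, c = 0 & d = 0].
Proof.
move=> /rowP E; have := E 0; have := E 1; have := E 2; have := E 3; rewrite !mxE /=.
rewrite !cos_phaseS !sin_phaseS !cos_phaseS engel_phase0.
have := engel_wronskian t; set s := sin t; set co := cos t => w.
rewrite !mulr0 !addr0 !add0r !mulr1 => b0.
rewrite b0 => e2 e1 -> ; split => //.
  (* The t- and z-entries have given a = 0 and b = 0; what remains is Cramer's rule in the (x,
     y)-entries. *)
  apply: (mulIf w); rewrite mul0r; move: e1 e2; rewrite !mul0r !add0r mul1r => e1 e2.
  transitivity ((c * (n%:R * (t * - s + co)) + d * (n%:R * (t * - co + 2 * - s))) * - co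
    - n%:R * (t * - co + 2 * - s) * (c * - s + d * - co)); first ring.
  by rewrite e1 e2; ring.
apply: (mulIf w); rewrite mul0r; move: e1 e2; rewrite !mul0r !add0r mul1r => e1 e2.
transitivity ((c * - s + d * - co) * (n%:R * (t * - s + co))
   - (c * (n%:R * (t * - s + co)) + d * (n%:R * (t * - co + 2 * - s))) * - s); first ring.
by rewrite e1 e2; ring.
Qed.

End EngelCurve.

(** * The rank-3 distribution as the kernel of a 1-form *)

Section EvenContact.
Variables (R : realType) (n : nat).
Hypothesis n_gt0 : (0 < n)%N.
Implicit Types (t : R) (x v : 'rV[R]_4) (k : nat).

Local Notation e0 := (row4 (1 : R) 0 0 0).
Local Notation F := (engel_curve n).

(* The cross product of [engel_curve 0] and [engel_curve 1] (their first coordinate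
   vanishes), paired with [v]; then its derivative in [t]. *)
Definition even_form t v : R := sin t * v 0 1 + n%:R * (cos t - t * sin t) * v 0 2
  - n%:R * cos t ^+ 2 * v 0 3.

Definition even_form' t v : R := cos t * v 0 1 - n%:R * (2 * sin t + t * cos t) * v 0 2
  + n%:R * 2 * cos t * sin t * v 0 3.

Lemma even_formD t v w : even_form t (v + w) = even_form t v + even_form t w.
Proof. by rewrite /even_form !mxE; ring. Qed.

Lemma even_formN t v : even_form t (- v) = - even_form t v.
Proof. by rewrite /even_form !mxE; ring. Qed.

Lemma even_formZ t a v : even_form t (a *: v) = a * even_form t v.
Proof. by rewrite /even_form !mxE; ring. Qed.

Lemma even_form'D t v w : even_form' t (v + w) = even_form' t v + even_form' t w.
Proof. by rewrite /even_form' !mxE; ring. Qed.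

Lemma even_form'Z t a v : even_form' t (a *: v) = a * even_form' t v.
Proof. by rewrite /even_form' !mxE; ring. Qed.

Lemma engel_curve0E t : F 0 t = row4 0 (n%:R * (t * cos t)) (cos t) 1.
Proof. by apply: row4P; rewrite mxE /= ?engel_phase0 ?mul0r ?addr0. Qed.

Lemma engel_curve1E t : F 1 t = row4 0 (n%:R * (cos t - t * sin t)) (- sin t) 0.
Proof.
apply: row4P; rewrite mxE /= ?cos_phaseS ?sin_phaseS ?engel_phase0 //.
by rewrite mul1r mulrN addrC.
Qed.

Lemma engel_curve2E t : F 2 t = row4 0 (- (n%:R * (2 * sin t + t * cos t))) (- cos t) 0.
Proof.
apply: row4P; rewrite mxE /= ?cos_phaseS ?sin_phaseS ?cos_phaseS ?sin_phaseS ?engel_phase0 //.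
ring.
Qed.

Lemma even_form_e0 t : even_form t e0 = 0.
Proof. by rewrite /even_form !mxE /=; ring. Qed.

Lemma even_form_F0 t : even_form t (F 0 t) = 0.
Proof. by rewrite engel_curve0E /even_form !mxE /=; ring. Qed.

Lemma even_form_F1 t : even_form t (F 1 t) = 0.
Proof. by rewrite engel_curve1E /even_form !mxE /=; ring. Qed.

Lemma even_form_F2 t : even_form t (F 2 t) != 0.
Proof.
have cs := cos2Dsin2 t.
have -> : even_form t (F 2 t) = - (n%:R * (1 + sin t ^+ 2)).
  by rewrite -[X in X + sin t ^+ 2]cs engel_curve2E /even_form !mxE /=; ring.
by rewrite oppr_eq0 mulf_neq0 ?pnatr_eq0 -?lt0n // gt_eqF // ltr_wpDr // sqr_ge0.
Qed.

Lemma even_form'_e0 t : even_form' t e0 = 0.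
Proof. by rewrite /even_form' !mxE /=; ring. Qed.

Lemma even_form'_F0 t : even_form' t (F 0 t) = 0.
Proof. by rewrite engel_curve0E /even_form' !mxE /=; ring. Qed.

Lemma engel_frame1P t v : reflect (exists a b : R, v = a *: e0 + b *: F 0 t)
  (v <= engel_frame n 1 t)%MS.
Proof.
apply: (iffP (engel_frameP _ _ _ _)) => [[a [b ->]]|[a [b ->]]].
  by exists a, (b 0%N); rewrite big_ord_recl big_ord0 addr0.
by exists a, (fun=> b); rewrite big_ord_recl big_ord0 addr0.
Qed.

Lemma engel_frame1_even_form t v : (v <= engel_frame n 1 t)%MS -> even_form t v = 0.
Proof.
by move=> /engel_frame1P[a [b ->]]; rewrite even_formD !even_formZ even_form_e0 even_form_F0 !mulr0 addr0.
Qed.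

Lemma engel_frame1_even_form' t v : (v <= engel_frame n 1 t)%MS -> even_form' t v = 0.
Proof.
by move=> /engel_frame1P[a [b ->]]; rewrite even_form'D !even_form'Z even_form'_e0 even_form'_F0 !mulr0 addr0.
Qed.

Lemma engel_frame2_even_form t v : (v <= engel_frame n 2 t)%MS = (even_form t v == 0).
Proof.
apply/engel_frameP/eqP => [[a [b ->]]|].
  by rewrite !big_ord_recl big_ord0 addr0 !even_formD !even_formZ /bump /= even_form_e0 even_form_F0 even_form_F1; ring.
(* Removing the multiple of [F 0 t] with the same z-entry leaves the (x, y)-part (w1, w2). That of
   [F 1 t] is (p, - sin t), of squared length [N], and [c] below is the coefficient of the
   orthogonal projection onto it. *)
pose w1 := v 0 1 - v 0 3 * (n%:R * (t * cos t)); pose w2 := v 0 2 - v 0 3 * cos t.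
pose p := n%:R * (cos t - t * sin t); pose N := p ^+ 2 + sin t ^+ 2.
move=> E; have E' : sin t * w1 + p * w2 = 0 by rewrite -E /w1 /w2 /p /even_form; ring.
have N0 : N != 0.
  apply/negP; rewrite paddr_eq0 ?sqr_ge0 // !sqrf_eq0 => /andP[/eqP p0 /eqP s0].
  have := cos2Dsin2 t; move/eqP: p0; rewrite /p s0 mulr0 subr0 mulf_eq0 pnatr_eq0.
  by rewrite gtn_eqF //= => /eqP ->; rewrite expr0n addr0 => /esym/eqP; rewrite oner_eq0.
pose c := (p * w1 - sin t * w2) / N.
exists (v 0 0), (fun j => if j == 0%N then v 0 3 else c).
rewrite !big_ord_recl big_ord0 addr0 /= /bump /= engel_curve0E engel_curve1E.
have c1 : c * p = w1.
  rewrite /c mulrAC; apply/eqP; rewrite -subr_eq0; apply/eqP.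
  have -> : (p * w1 - sin t * w2) * p / N - w1 = - (sin t * (sin t * w1 + p * w2)) / N.
    by rewrite /N; field.
  by rewrite E' mulr0 oppr0 mul0r.
have c2 : c * - sin t = w2.
  rewrite /c mulrAC; apply/eqP; rewrite -subr_eq0; apply/eqP.
  have -> : (p * w1 - sin t * w2) * - sin t / N - w2 = - (p * (sin t * w1 + p * w2)) / N.
    by rewrite /N; field.
  by rewrite E' mulr0 oppr0 mul0r.
rewrite [LHS](row4P erefl erefl erefl erefl); apply/esym/row4P; rewrite !mxE /=.
- ring.
- by rewrite -/p c1 /w1; ring.
- by rewrite c2 /w2; ring.
- ring.
Qed.

Lemma is_derive_coord0 (h : R -> R) (h' : R) x v :
  is_derive (x 0 0) (1 : R) h h' -> is_derive x v (fun y : 'rV[R]_4 => h (y 0 0)) (v 0 0 * h').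
Proof.
move=> [dh eh]; have /derivable1_diffP dh' := dh.
have dc := differentiable_coord x 0 0.
split; first exact: diff_derivable (differentiable_comp dc dh').
rewrite (@derive_comp _ _ _ _ (fun y : 'rV[R]_4 => y 0 0) h) //.
have -> : 'D_v (fun y : 'rV[R]_4 => y 0 0) x = v 0 0 *: 1.
  rewrite (@derive_rV_coord _ _ _ id); last exact: derivable_id.
  by rewrite derive_id [RHS]mulr1.
by rewrite deriveZ_dir // eh.
Qed.

Lemma is_derive_coord (X : 'rV[R]_4 -> 'rV[R]_4) x v j : derivable X x v ->
  is_derive x v (fun y => X y 0 j) (('D_v X x) 0 j).
Proof. by move=> dX; split; [move/derivable_mxP: dX; exact|exact: derive_rV_coord]. Qed.

(** The Leibniz rule for the vanishing function [even_form (y 0 0) (X y)], whose coefficients depend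
    on t alone. It converts the derivatives of sections that occur in a bracket into pointwise
    values. *)
Lemma derive_annihilated (X : 'rV[R]_4 -> 'rV[R]_4) (U : set 'rV[R]_4) x v :
  nbhs x U -> derivable X x v -> (forall y, U y -> even_form (y 0 0) (X y) = 0) ->
  even_form (x 0 0) ('D_v X x) = - (v 0 0 * even_form' (x 0 0) (X x)).
Proof.
move=> nU dX XU.
have D1 := is_derive_coord 1 dX; have D2 := is_derive_coord 2 dX; have D3 := is_derive_coord 3 dX.
have C1 := is_derive_coord0 v (is_derive_sin (x 0 0)).
pose h2 (t : R) := n%:R * (cos t - t * sin t); pose h3 (t : R) := n%:R * cos t ^+ 2.
have H2 (t : R) : is_derive t (1 : R) h2 (- (n%:R * (2 * sin t + t * cos t))).
  have -> : h2 = n%:R \*: (cos - id * sin) by [].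
  by apply: is_derive_eq; rewrite /GRing.scale /=; ring.
have H3 (t : R) : is_derive t (1 : R) h3 (- (n%:R * 2 * cos t * sin t)).
  have -> : h3 = n%:R \*: (cos * cos) by apply/funext => s; rewrite /h3 expr2.
  by apply: is_derive_eq; rewrite /GRing.scale /=; ring.
have C2 := is_derive_coord0 v (H2 (x 0 0)); have C3 := is_derive_coord0 v (H3 (x 0 0)).
pose g := (fun y : 'rV[R]_4 => sin (y 0 0)) * (fun y => X y 0 1)
  + (fun y : 'rV[R]_4 => h2 (y 0 0)) * (fun y => X y 0 2)
  - (fun y : 'rV[R]_4 => h3 (y 0 0)) * (fun y => X y 0 3).
have gE y : g y = even_form (y 0 0) (X y) by [].
have : is_derive x v g (even_form (x 0 0) ('D_v X x) + v 0 0 * even_form' (x 0 0) (X x)).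
  by apply: is_derive_eq; rewrite /even_form /even_form' /h2 /h3 /GRing.scale /=; ring.
move=> [_ Dg]; apply/eqP; rewrite -addr_eq0 -Dg.
rewrite (@near_eq_derive _ _ _ _ (cst 0)) ?derive_cst //.
by apply: filterS nU => y /XU; rewrite -gE.
Qed.

Lemma row4_deck_lin g : e0 *m deck_lin R n g = e0.
Proof. by rewrite deck_linE; apply/esym/row4P; rewrite !mxE /=; ring. Qed.

Lemma deck_linK g v : v *m deck_lin R n g *m deck_lin R n (deck_inv n g) = v.
Proof.
rewrite !deck_linE; apply/esym/row4P; rewrite !mxE /=; [by []|by rewrite mulrNz; ring|by []|].
by rewrite mulrA -intrM parity_signN parity_signK mul1r.
Qed.

Lemma engel_frame_deck g k t v : (v <= engel_frame n k t)%MS ->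
  (v *m deck_lin R n g <= engel_frame n k (t + (deck_t g)%:~R * pi))%MS.
Proof.
move=> /engel_frameP[a [b ->]]; apply/engel_frameP.
exists a, (fun j => b j * (parity_sign (deck_t g))%:~R).
rewrite mulmxDl -scalemxAl row4_deck_lin; congr (_ + _).
rewrite mulmx_suml; apply: eq_bigr => j _.
rewrite engel_curve_deck -scalemxAl scalerA -mulrA -intrM parity_signK.
by rewrite mulr1.
Qed.

Lemma engel_frame_deckE g k t v :
  (v *m deck_lin R n g <= engel_frame n k (t + (deck_t g)%:~R * pi))%MS =
  (v <= engel_frame n k t)%MS.
Proof.
apply/idP/idP; last exact: engel_frame_deck.
move=> /(engel_frame_deck (deck_inv n g)); rewrite deck_linK /=.
by rewrite mulrNz mulNr addrK.
Qed.

Lemma engel_frame_row_free k t : (k <= 3)%N -> row_free (engel_frame n k t).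
Proof.
move=> k3; apply: inj_row_free => u; rewrite mul_engel_frame => u0.
have H : [/\ u 0 0 = 0 & forall j : 'I_k, u 0 (lift 0 j) = 0].
  move: k3 u u0; case: k => [|[|[|[|//]]]] _ u; rewrite ?big_ord_recl ?big_ord0 ?addr0 ?addrA.
  - have := @engel_frame_free R n n_gt0 t (u 0 0) 0 0 0.
    by rewrite !scale0r !addr0 => H /H[]; split => // -[].
  - have := @engel_frame_free R n n_gt0 t (u 0 0) (u 0 (lift 0 0)) 0 0.
    rewrite !scale0r !addr0 => H /H[-> u1 _ _]; split => // j; rewrite (ord1 j); exact: u1.
  - have := @engel_frame_free R n n_gt0 t (u 0 0) (u 0 (lift 0 0)) (u 0 (lift 0 (lift ord0 ord0))) 0.
    rewrite !scale0r !addr0 => H /H[-> u1 u2 _]; split => // -[[|[|//]] Hj].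
    + by rewrite -u1; congr (u _ _); apply/val_inj.
    + by rewrite -u2; congr (u _ _); apply/val_inj.
  - have := @engel_frame_free R n n_gt0 t (u 0 0) (u 0 (lift 0 0)) (u 0 (lift 0 (lift ord0 ord0)))
      (u 0 (lift 0 (lift ord0 (lift ord0 ord0)))).
    move=> H /H[-> u1 u2 u3]; split => // -[[|[|[|//]]] Hj].
    + by rewrite -u1; congr (u _ _); apply/val_inj.
    + by rewrite -u2; congr (u _ _); apply/val_inj.
    + by rewrite -u3; congr (u _ _); apply/val_inj.
case: H => h0 hS; apply/rowP => i; rewrite mxE.
by have [j ->|->] := unliftP 0 i.
Qed.

End EvenContact.

Lemma is_distribution_ext (R : realType) m k (M : manifold R m) (D D' : tangent_distribution M) :
  (forall c x, atlas M c -> image_of c x -> D c x = D' c x) ->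
  is_distribution k D -> is_distribution k D'.
Proof.
move=> DD' [Dt Df]; split.
  move=> c d ac ad x v xcd; have xc : image_of c x by case: xcd => p [pc _] <-; exists p.
  rewrite -DD' // -DD' //; first exact: Dt.
  case: xcd => p [pc pd] <-; exists p => //; rewrite /transition /=.
  by have [_ _ -> //] := manifold_chart ac.
move=> c p ac pc; have [U [X [[oU Uc] Up Xs XD]]] := Df c p ac pc.
exists U, X; split => // x Ux; have [Xf XDx] := XD x Ux; split => // v.
by rewrite -DD' //; exact: Uc.
Qed.

Lemma linear_span_sub (R : realType) m k (S : set 'rV[R]_m) (A : 'M[R]_(k, m)) v :
  (forall u, S u -> (u <= A)%MS) -> linear_span S v -> (v <= A)%MS.
Proof.
by move=> SA [l [B [BS vB]]]; apply: submx_trans vB _; apply/row_subP => i; exact/SA/BS.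
Qed.

Lemma linear_span_row (R : realType) m k (S : set 'rV[R]_m) (A : 'M[R]_(k, m)) v :
  (forall i, S (row i A)) -> (v <= A)%MS -> linear_span S v.
Proof. by move=> SA vA; exists k, A. Qed.

Section EngelManifold.
Variables (R : realType) (n : nat).
Hypothesis n_gt0 : (0 < n)%N.
Implicit Types (t : R) (x v : 'rV[R]_4) (k : nat).

Local Notation M := (orbit_manifold R n).
Local Notation e0 := (row4 (1 : R) 0 0 0).
Local Notation F := (@engel_curve R n).

(* [engel_dist 1] is the Engel structure and [engel_dist 2] its derived distribution. *)
Definition engel_dist k : tangent_distribution M :=
  fun _ x v => (v <= engel_frame n k (x 0 0))%MS.

Lemma smooth_engel_curve k (U : set 'rV[R]_4) : smooth_open U (fun y => F k (y 0 0)).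
Proof. by apply: smooth_coord0 => l t; exact: is_derive_engel_curve. Qed.

Lemma smooth_cst (b : 'rV[R]_4) (U : set 'rV[R]_4) : smooth_open U (fun=> b).
Proof.
have -> : (fun=> b) = (fun y : 'rV[R]_4 => y *m (0 : 'M[R]_4) + b).
  by apply/funext => y; rewrite mulmx0 add0r.
exact: smooth_affine.
Qed.

Lemma orbit_image_open c : atlas M c -> open (image_of c).
Proof. by move=> [x _ <-]; rewrite image_of_orbit_chart; exact: ball_open. Qed.

Lemma engel_dist_distribution k : (k <= 3)%N -> is_distribution k.+1 (engel_dist k).
Proof.
move=> k3; split.
  move=> c d [x0 _ <-] [x1 _ <-] x v /orbit_transition[g [xx0 xx1 E]].
  have nE : \forall z \near x, deck_act n g z = transition (orbit_chart n x0) (orbit_chart n x1) z.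
    have : nbhs x (deck_act n g @^-1` ball x1 2^-1).
      apply: deck_act_continuous; apply: open_nbhs_nbhs; split => //; exact: ball_open.
    by apply: filterS => z /E.
  rewrite -(near_eq_derive _ nE) derive_affine E // /engel_dist.
  have -> : deck_act n g x 0 0 = x 0 0 + (deck_t g)%:~R * pi by rewrite deck_actE mxE.
  by rewrite engel_frame_deckE.
move=> c p ac pc; exists (image_of c), (fun x => engel_frame n k (x 0 0)).
split; [split => //; exact: orbit_image_open|by exists p| |].
  move=> i; have [j ->|->] := unliftP 0 i.
    have -> : (fun x : 'rV[R]_4 => row (lift 0 j) (engel_frame n k (x 0 0))) = (fun x => F j (x 0 0)).
      by apply/funext => x; rewrite row_engel_frameS.
    exact: smooth_engel_curve.
  have -> : (fun x : 'rV[R]_4 => row 0 (engel_frame n k (x 0 0))) = (fun=> e0).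
    by apply/funext => x; rewrite row_engel_frame0.
  exact: smooth_cst.
by move=> x _; split => //; exact: engel_frame_row_free.
Qed.

Lemma engel_dist_e0 k c x : engel_dist k c x e0.
Proof. by rewrite /engel_dist -(row_engel_frame0 n k (x 0 0)); exact: row_sub. Qed.

Lemma engel_dist_curve k j c x : (j < k)%N -> engel_dist k c x (F j (x 0 0)).
Proof.
by move=> jk; rewrite /engel_dist -(row_engel_frameS n (x 0 0) (Ordinal jk)); exact: row_sub.
Qed.

Lemma lie_bracket_e0 k x : lie_bracket (fun=> e0) (fun y : 'rV[R]_4 => F k (y 0 0)) x = F k.+1 (x 0 0).
Proof.
rewrite /lie_bracket (derive_coord0 _ (is_derive_engel_curve n k (x 0 0))).
by rewrite (_ : (fun=> e0) = cst e0) // derive_cst subr0 mxE /= scale1r.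
Qed.

(** One inclusion is f' = [d/dt, f]. For the other, [derive_annihilated] expresses [even_form] of a
    bracket through [even_form'] of the two sections, which vanishes on d/dt and on [f]; for the
    latter, differentiate [even_form_F0] and use [even_form_F1]. *)
Lemma derived_engel_dist1 c x : atlas M c -> image_of c x ->
  derived (engel_dist 1) c x = engel_dist 2 c x.
Proof.
move=> ac xc; have oc := orbit_image_open ac.
have Se0 : local_section (engel_dist 1) c (image_of c) (fun=> e0).
  by split => //; [exact: smooth_cst|move=> y _; exact: engel_dist_e0].
have SF0 : local_section (engel_dist 1) c (image_of c) (fun y => F 0 (y 0 0)).
  by split => //; [exact: smooth_engel_curve|move=> y _; exact: engel_dist_curve].
apply/seteqP; split => v; last first.
  apply: linear_span_row => i; exists (image_of c); have [[[|[|//]] Hj] ->|->] := unliftP 0 i.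
  - by exists (fun y => F 0 (y 0 0)), (fun=> e0); split => //; left; rewrite row_engel_frameS.
  - exists (fun=> e0), (fun y => F 0 (y 0 0)); split => //; right.
    by rewrite row_engel_frameS lie_bracket_e0.
  - by exists (fun=> e0), (fun=> e0); split => //; left; rewrite row_engel_frame0.
apply: linear_span_sub => u [U [X [Y [[oU Uc sX XD] [_ _ sY YD] Ux uE]]]].
rewrite engel_frame2_even_form //; apply/eqP.
have [_ CX] := smooth_open_C1 oU sX; have [_ CY] := smooth_open_C1 oU sY.
have [dX _] := CX x Ux; have [dY _] := CY x Ux.
have nU : nbhs x U by exact: open_nbhs_nbhs.
case: uE => ->; first exact/engel_frame1_even_form/XD.
rewrite /lie_bracket even_formD even_formN.
rewrite !(derive_annihilated nU) //; try exact: diff_derivable; last 2 first.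
- by move=> y Uy; exact/engel_frame1_even_form/XD.
- by move=> y Uy; exact/engel_frame1_even_form/YD.
by rewrite (engel_frame1_even_form' (XD _ Ux)) (engel_frame1_even_form' (YD _ Ux)) !mulr0 !oppr0 addr0.
Qed.

Lemma local_section_derived (U : set 'rV[R]_4) c X : atlas M c -> open U -> U `<=` image_of c ->
  smooth_open U X -> (forall y, U y -> engel_dist 2 c y (X y)) ->
  local_section (derived (engel_dist 1)) c U X.
Proof.
move=> ac oU Uc sX XD; split => // y Uy.
by rewrite derived_engel_dist1 //; [exact: XD|exact: Uc].
Qed.

Lemma engel_dist_engel : engel_structure (engel_dist 1).
Proof.
split; first exact: engel_dist_distribution.
  apply: (@is_distribution_ext _ _ _ _ (engel_dist 2)); last exact: engel_dist_distribution.
  by move=> c x ac xc; rewrite derived_engel_dist1.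
move=> c p ac pc; set x := coord c p; have xc : image_of c x by exists p.
have oc := orbit_image_open ac.
have Se0 : local_section (derived (engel_dist 1)) c (image_of c) (fun=> e0).
  by apply: local_section_derived => //; [exact: smooth_cst|move=> y _; exact: engel_dist_e0].
have SF j : (j < 2)%N -> local_section (derived (engel_dist 1)) c (image_of c) (fun y => F j (y 0 0)).
  move=> j2; apply: local_section_derived => //; first exact: smooth_engel_curve.
  by move=> y _; exact: engel_dist_curve.
apply/seteqP; split => v // _.
apply: (@linear_span_row _ _ _ _ (engel_frame n 3 (x 0 0))); last first.
  apply: submx_full; rewrite /row_full; have := @engel_frame_row_free R n n_gt0 3 (x 0 0) isT.
  by rewrite /row_free.
move=> i; exists (image_of c); have [[[|[|[|//]]] Hj] ->|->] := unliftP 0 i.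
- by exists (fun y => F 0 (y 0 0)), (fun=> e0); split => //; [exact: SF|left; rewrite row_engel_frameS].
- by exists (fun y => F 1 (y 0 0)), (fun=> e0); split => //; [exact: SF|left; rewrite row_engel_frameS].
- exists (fun=> e0), (fun y => F 1 (y 0 0)); split => //; first exact: SF.
  by right; rewrite row_engel_frameS lie_bracket_e0.
- by exists (fun=> e0), (fun=> e0); split => //; left; rewrite row_engel_frame0.
Qed.

(** The bracket condition is tested on the section f'. As f' has no t-component, [even_form] of its
    bracket with a section X of [W] reduces to the t-component of X times [even_form] of f'', which
    is nonzero. So X has no d/dt part. *)
Lemma isotropic_engel_dist (W : tangent_distribution M) c x w :
  isotropic_line_field (engel_dist 1) W -> atlas M c -> image_of c x -> W c x w ->
  exists a : R, w = a *: F 0 (x 0 0).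
Proof.
move=> [[_ Wf] WD WE] ac [p pc xE] Ww.
have [U [X [[oU Uc] Up Xs XW]]] := Wf c p ac pc.
rewrite {}xE in Up; pose X1 y := row 0 (X y).
have XX1 y : X y = X1 y by apply/rowP => j; rewrite mxE.
have sX1 : smooth_open U X1 by exact: Xs.
have X1D y : U y -> engel_dist 1 c y (X1 y).
  move=> Uy; have [q qc qy] := Uc y Uy.
  rewrite -qy; apply: WD => //; rewrite qy; have [_ ->] := XW y Uy.
  by rewrite -XX1.
have SX : local_section W c U X1.
  split => // y Uy; have [_ ->] := XW y Uy; exact: row_sub.
have SF : local_section (derived (engel_dist 1)) c U (fun y => F 1 (y 0 0)).
  apply: (local_section_derived ac oU Uc); first exact: smooth_engel_curve.
  by move=> y _; exact: engel_dist_curve.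
have := WE c U X1 _ ac SX SF x Up.
rewrite derived_engel_dist1 //; last exact: Uc.
rewrite /engel_dist engel_frame2_even_form // /lie_bracket even_formD even_formN => /eqP.
rewrite (derive_coord0 _ (is_derive_engel_curve n 1 (x 0 0))) even_formZ.
have nU : nbhs x U by exact: open_nbhs_nbhs.
have [_ CX] := smooth_open_C1 oU sX1; have [dX _] := CX x Up.
rewrite (derive_annihilated nU) //; last 2 first.
- exact: diff_derivable.
- by move=> y Uy; exact/engel_frame1_even_form/X1D.
have F10 : F 1 (x 0 0) 0 0 = 0 by rewrite mxE.
rewrite F10 mul0r !oppr0 addr0 => /eqP.
rewrite mulf_eq0 (negbTE (even_form_F2 n_gt0 _)) orbF => /eqP X0.
have /engel_frame1P[a [b XE]] := X1D x Up.
have a0 : a = 0.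
  by move: X0; rewrite XE !mxE /= mulr1 mulr0 addr0.
have [_ /(_ w)[+ _]] := XW x Up; move=> /(_ Ww).
rewrite XX1 => /sub_rVP[l ->]; exists (l * b).
by rewrite XE a0 scale0r add0r scalerA.
Qed.

End EngelManifold.

(** * Lifting to the universal cover *)

(** A locally constant property is open in [A] together with its negation. This replaces paths
    throughout: existence and uniqueness of lifts and constancy of the sign are instances. *)
Lemma connected_transfer (T : topologicalType) (A : set T) (P : T -> Prop) :
  connected A -> (forall x, A x -> \forall y \near x, A y -> (P y <-> P x)) ->
  forall x y, A x -> A y -> P x -> P y.
Proof.
move=> cA H x y Ax Ay Px.
suff E : [set z | A z /\ P z] = A by have [] : [set z | A z /\ P z] y by rewrite E.
apply: cA; first by exists x.
- exists (interior [set z | A z -> P z]); first exact: open_interior.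
  apply/seteqP; split => z [Az]; last by move=> /interior_subset /(_ Az).
  move=> Pz; split => //; rewrite /interior /=.
  by apply: filterS (H z Az) => w zw /zw [_]; exact.
- exists (~` interior [set z | A z -> ~ P z]); first by rewrite closedC; exact: open_interior.
  apply/seteqP; split => z [Az].
    by move=> Pz; split => // /interior_subset /(_ Az).
  move=> Iz; split => //; apply: contrapT => Pz; apply: Iz; rewrite /interior /=.
  by apply: filterS (H z Az) => w zw /zw [+ _]; tauto.
Qed.

Section Convex.
Context {R : realType} {d : nat}.
Implicit Types (x y : 'rV[R]_d) (A B : set 'rV[R]_d).

Definition convex_set A :=
  forall x y (t : R), A x -> A y -> 0 <= t <= 1 -> A (x + t *: (y - x)).

Lemma convex_setI A B : convex_set A -> convex_set B -> convex_set (A `&` B).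
Proof. by move=> cA cB x y t [Ax Bx] [Ay By] t01; split; [exact: cA|exact: cB]. Qed.

Lemma convex_setT : convex_set setT. Proof. by []. Qed.

Lemma norm_convex_lt x y (r t : R) : `|x| < r -> `|y| < r -> 0 <= t <= 1 ->
  `|(1 - t) *: x + t *: y| < r.
Proof.
move=> xr yr /andP[t0 t1].
apply: le_lt_trans (ler_normD _ _) _; rewrite !normrZ !ger0_norm ?subr_ge0 //.
have [->|tn0] := eqVneq t 0; first by rewrite subr0 mul1r mul0r addr0.
have tp : 0 < t by rewrite lt_def tn0.
have : t * `|y| < t * r by rewrite ltr_pM2l.
have : (1 - t) * `|x| <= (1 - t) * r by rewrite ler_wpM2l ?subr_ge0 // ltW.
lra.
Qed.

Lemma ball_convex x (r : R) : convex_set (ball x r).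
Proof.
move=> y z t; rewrite -ball_normE /= => yr zr t01.
have -> : x - (y + t *: (z - y)) = (1 - t) *: (x - y) + t *: (x - z).
  by apply/rowP => i; rewrite !mxE; ring.
exact: norm_convex_lt.
Qed.

(** A neighbourhood of the segment from 0 to [s *: x]; being convex, it allows at most one lift with
    a given value at 0. *)
Definition tube x (s e : R) : set 'rV[R]_d :=
  [set y | exists2 r : R, 0 <= r <= s & `|y - r *: x| < e].

Lemma tube_convex x s e : convex_set (tube x s e).
Proof.
move=> y z t [r /andP[r0 rs] yr] [r' /andP[r'0 r's] zr] t01; move: (t01) => /andP[t0 t1].
exists ((1 - t) * r + t * r').
  have a : (1 - t) * r <= (1 - t) * s by rewrite ler_wpM2l ?subr_ge0.
  have b : t * r' <= t * s by rewrite ler_wpM2l.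
  have a0 : 0 <= (1 - t) * r by rewrite mulr_ge0 ?subr_ge0.
  have b0 : 0 <= t * r' by rewrite mulr_ge0.
  by apply/andP; split; lra.
have -> : y + t *: (z - y) - ((1 - t) * r + t * r') *: x =
   (1 - t) *: (y - r *: x) + t *: (z - r' *: x).
  by apply/rowP => i; rewrite !mxE; ring.
exact: norm_convex_lt.
Qed.

Lemma tube_open x s e : open (tube x s e).
Proof.
rewrite openE => y [r rs yr]; rewrite /interior /=; apply/nbhs_ballP.
exists (e - `|y - r *: x|) => /=; first by rewrite subr_gt0.
move=> z; rewrite -ball_normE /= => yz; exists r => //.
have -> : z - r *: x = (y - r *: x) - (y - z) by apply/rowP => i; rewrite !mxE; ring.
by apply: le_lt_trans (ler_normB _ _) _; lra.
Qed.

Lemma tube_sub x s s' e e' : s' <= s -> e' <= e -> tube x s' e' `<=` tube x s e.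
Proof.
move=> ss ee y [r /andP[r0 rs] yr]; exists r; last exact: lt_le_trans ee.
by rewrite r0 (le_trans rs).
Qed.

Lemma tube0 x s e : 0 <= s -> 0 < e -> tube x s e 0.
Proof. by move=> s0 e0; exists 0; rewrite ?lexx // scale0r subrr normr0. Qed.

Lemma tube_end x s e : 0 <= s -> 0 < e -> tube x s e (s *: x).
Proof. by move=> s0 e0; exists s; rewrite ?s0 ?lexx // subrr normr0. Qed.

Lemma convex_set_connected A : convex_set A -> connected A.
Proof. by move=> cA; apply: convex_connected. Qed.

End Convex.

Section Lifting.
Context {R : realType} {n d : nat}.
Variable f : 'rV[R]_d -> orbit_space R n.
Hypothesis f_continuous : continuous f.
Local Notation pr := (@orbit_of R n).

Definition lift_on (U : set 'rV[R]_d) (s : 'rV[R]_d -> 'rV[R]_4) :=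
  forall x, U x -> {for x, continuous s} /\ pr (s x) = f x.

Lemma lift_on_sub (U V : set 'rV[R]_d) s : V `<=` U -> lift_on U s -> lift_on V s.
Proof. by move=> VU H x Vx; apply: H; exact: VU. Qed.

(** Where two lifts agree, both stay nearby in a ball of radius 1/2, on which the projection is
    injective; where they differ, continuity keeps them apart. *)
Lemma lift_unique (U : set 'rV[R]_d) s s' x y : open U -> convex_set U ->
  lift_on U s -> lift_on U s' -> U x -> U y -> s x = s' x -> s y = s' y.
Proof.
move=> oU cU ls ls' Ux Uy; move: Ux Uy.
apply: (@connected_transfer _ U (fun z => s z = s' z) (convex_set_connected cU)) => {x y} x Ux.
 have [cs sf] := ls x Ux; have [cs' s'f] := ls' x Ux.
have [E|E] := pselect (s x = s' x).
- have n1 : \forall y \near x, ball (s x) 2^-1 (s y) by apply: cs; exact: nbhsx_ballx.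
  have n2 : \forall y \near x, ball (s x) 2^-1 (s' y).
    by rewrite E; apply: cs'; exact: nbhsx_ballx.
  near=> y => Uy; split => // _.
  have [_ e1] := ls y Uy; have [_ e2] := ls' y Uy.
  apply: (@orbit_of_inj_ball R n (s x)); [by near: y|by near: y|by rewrite e1 e2].
- have e0 : 0 < `|s x - s' x| / 2.
    by rewrite divr_gt0 // normr_gt0 subr_eq0; apply/eqP.
  have n1 : \forall y \near x, ball (s x) (`|s x - s' x| / 2) (s y) by apply: cs; exact: nbhsx_ballx.
  have n2 : \forall y \near x, ball (s' x) (`|s x - s' x| / 2) (s' y) by apply: cs'; exact: nbhsx_ballx.
  near=> y => Uy; split => // E'; exfalso.
  have b1 : ball (s x) (`|s x - s' x| / 2) (s y) by near: y.
  have b2 : ball (s' x) (`|s x - s' x| / 2) (s' y) by near: y.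
  move: b1 b2; rewrite -!ball_normE /= E' => b1 b2.
  have : `|s x - s' x| < `|s x - s' x|.
    have {1}-> : s x - s' x = (s x - s' y) - (s' x - s' y) by rewrite opprB addrA subrK.
    apply: le_lt_trans (ler_normB _ _) _; lra.
  by rewrite ltxx.
Unshelve. all: by end_near. Qed.

Lemma lift_act (U : set 'rV[R]_d) s g : lift_on U s -> lift_on U (deck_act n g \o s).
Proof.
move=> ls x Ux; have [cs sf] := ls x Ux; split; last by rewrite /= orbit_of_act.
by apply: continuous_comp; [exact: cs|exact: deck_act_continuous].
Qed.

(** A chart provides one lift, and a deck transformation adjusts its value. The radius depends
    neither on the point [y] nor on the prescribed value [w], which the continuation along segments
    relies on. *)
Lemma local_lift x : exists2 r : R, 0 < r & forall y w, ball x r y -> pr w = f y ->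
  exists2 s, lift_on (ball x r) s & s y = w.
Proof.
have [z zx] := @orbit_of_surj R n (f x).
have : nbhs x (f @^-1` (dom (orbit_chart n z))).
  apply: f_continuous; apply: open_nbhs_nbhs; split; last by exists z => //; exact: ballxx.
  by apply: orbit_of_open; exact: ball_open.
move=> /nbhs_ballP[r /= r0 Hr]; exists r => // y w xy wy.
have ls : lift_on (ball x r) (orbit_coord z \o f).
  move=> y' /Hr /= fy'; split.
    by apply: continuous_comp; [exact: f_continuous|exact: orbit_coord_continuous].
  by case: fy' => u zu <-; rewrite /= orbit_coordK.
have [_ /esym] := ls y xy; rewrite -wy => /esym/orbit_ofP[g wE].
by exists (deck_act n g \o (orbit_coord z \o f)); [exact: lift_act|rewrite /= wE].
Qed.

(** The lift over the tube up to [s1] is glued to a lift over the ball around [s0 *: x] chosen to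
    agree with it at [s1 *: x]. The two then agree on their whole common domain, which is convex. *)
Lemma tube_lift_extend x y0 (r s0 s1 s2 e : R) (h : 'rV[R]_d -> 'rV[R]_4) :
  (forall y w, ball (s0 *: x) r y -> pr w = f y ->
    exists2 s, lift_on (ball (s0 *: x) r) s & s y = w) ->
  0 < e -> 0 <= s1 -> lift_on (tube x s1 e) h -> h 0 = y0 ->
  `|s1 - s0| * `|x| < r / 2 -> `|s2 - s0| * `|x| < r / 2 ->
  exists2 e', 0 < e' & exists2 h', lift_on (tube x s2 e') h' & h' 0 = y0.
Proof.
move=> H e0 s1p lh h0 xs1 xs2.
have [s21|s12] := leP s2 s1.
  by exists e => //; exists h => //; apply: lift_on_sub lh; exact: tube_sub.
have r0 : 0 < r / 2 by apply: le_lt_trans xs1; rewrite mulr_ge0.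
have b1 : ball (s0 *: x) r (s1 *: x).
  by rewrite -ball_normE /= -scalerBl normrZ distrC; lra.
have t1 : tube x s1 e (s1 *: x) by exact: tube_end.
have [_ fh] := lh _ t1.
have [h' lh' hE] := H _ _ b1 fh.
have agree y : tube x s1 e y -> ball (s0 *: x) r y -> h' y = h y.
  move=> ty ry; apply: (@lift_unique (tube x s1 e `&` ball (s0 *: x) r) _ _ (s1 *: x)) => //.
  - by apply: openI; [exact: tube_open|exact: ball_open].
  - by apply: convex_setI; [exact: tube_convex|exact: ball_convex].
  - by apply: lift_on_sub lh' => z [].
  - by apply: lift_on_sub lh => z [].
pose k y := if `[< tube x s1 e y >] then h y else h' y.
(* A point of the new tube beyond [s1] is within r / 2 of a point of the segment that is itself
   within r / 2 of the centre, so it lies in the ball. *)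
exists (Num.min e (r / 2)); first by rewrite lt_min e0.
exists k; last by rewrite /k asboolT //; exact: tube0.
have lk1 : lift_on (tube x s1 e) k.
  move=> y ty; have [ch fy] := lh y ty; split; last by rewrite /k asboolT.
  apply: continuous_near_eq ch.
  have : nbhs y (tube x s1 e) by apply: open_nbhs_nbhs; split => //; exact: tube_open.
  by apply: filterS => z tz; rewrite /k asboolT.
have lk2 : lift_on (ball (s0 *: x) r) k.
  have kE z : ball (s0 *: x) r z -> h' z = k z.
    by move=> rz; rewrite /k; case: asboolP => // tz; exact: agree.
  move=> y ry; have [ch fy] := lh' y ry; split; last by rewrite -kE.
  apply: continuous_near_eq ch.
  have : nbhs y (ball (s0 *: x) r) by apply: open_nbhs_nbhs; split => //; exact: ball_open.
  by apply: filterS => z; exact: kE.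
move=> y [u /andP[u0 us2]]; rewrite lt_min => /andP[ye yr].
have [us1|us1] := leP u s1; first by apply: lk1; exists u; rewrite ?u0.
apply: lk2; rewrite -ball_normE /=.
have -> : s0 *: x - y = (s0 - u) *: x - (y - u *: x) by apply/rowP => i; rewrite !mxE; ring.
apply: le_lt_trans (ler_normB _ _) _; rewrite normrZ.
suff : `|s0 - u| * `|x| < r / 2 by lra.
have [us0|us0] := leP u s0.
  apply: le_lt_trans xs1; rewrite ler_wpM2r // ger0_norm ?subr_ge0 // distrC.
  by apply: le_trans (ler_norm _); lra.
apply: le_lt_trans xs2; rewrite ler_wpM2r // ltr0_norm ?subr_lt0 //.
by apply: le_trans (ler_norm _); lra.
Qed.

(** A continuity method: having a lift over some tube up to [s] is a locally constant property of
    [s] in [0, 1]. The width of the tube may shrink at each extension. *)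
Lemma tube_lift x y0 : pr y0 = f 0 ->
  exists2 e : R, 0 < e & exists2 h, lift_on (tube x 1 e) h & h 0 = y0.
Proof.
move=> fy0; pose P (s : R) := exists2 e : R, 0 < e & exists2 h, lift_on (tube x s e) h & h 0 = y0.
have P0 : P 0.
  have [r r0 H] := local_lift 0.
  have [h lh h0] := H 0 y0 (ballxx _ r0) fy0.
  exists r => //; exists h => //; apply: lift_on_sub lh => y [u].
  rewrite -eq_le => /eqP <-; rewrite scale0r subr0 => yr.
  by rewrite -ball_normE /= sub0r normrN.
apply: (connected_transfer (@segment_connected R 0 1)) P0 => /=; rewrite ?in_itv /= ?lexx ?ler01 //.
move=> s0; rewrite in_itv /= => s01.
have [r r0 H] := local_lift (s0 *: x).
pose d0 := r / (2 * (`|x| + 1)).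
have x1 : 0 < `|x| + 1 by rewrite ltr_wpDl.
have d00 : 0 < d0 by rewrite divr_gt0 // mulr_gt0.
have small (s : R) : `|s - s0| < d0 -> `|s - s0| * `|x| < r / 2.
  move=> sd; apply: (@le_lt_trans _ _ (`|s - s0| * (`|x| + 1))).
    by rewrite ler_wpM2l // lerDl.
  by rewrite -ltr_pdivlMr // -mulrA -invfM.
have step (s s' : R) : 0 <= s -> `|s - s0| < d0 -> `|s' - s0| < d0 -> P s -> P s'.
  move=> sp /small sd /small s'd [e e0 [h lh h0]].
  exact: (tube_lift_extend H e0 sp lh h0 sd s'd).
apply/nbhs_ballP; exists d0 => // s; rewrite -ball_normE /= distrC => sd.
rewrite in_itv /= => /andP[sp _]; have s0p : 0 <= s0 by case/andP: s01.
have s00 : `|s0 - s0| < d0 by rewrite subrr normr0.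
by split; exact: step.
Qed.

(** The value at [x] is the endpoint of the lift along the segment from 0 to [x]. For [y] near [x],
    the tubes of [x] and [y] meet in a convex set containing 0 and [y], so their lifts agree there,
    and near [x] the map is the lift over one tube. *)
Lemma lift_exists y0 : pr y0 = f 0 ->
  exists s, [/\ continuous s, forall x, pr (s x) = f x & s 0 = y0].
Proof.
move=> fy0.
have H x : exists eh : R * ('rV[R]_d -> 'rV[R]_4),
    [/\ 0 < eh.1, lift_on (tube x 1 eh.1) eh.2 & eh.2 0 = y0].
  by have [e e0 [h lh h0]] := tube_lift x fy0; exists (e, h).
have {H}[eh Heh] := choice H.
pose s x := (eh x).2 x.
have sE x y : tube x 1 (eh x).1 y -> s y = (eh x).2 y.
  move=> xy; have [ex lx hx] := Heh x; have [ey ly hy] := Heh y.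
  apply: (@lift_unique (tube y 1 (eh y).1 `&` tube x 1 (eh x).1) (eh y).2 (eh x).2 0 y).
  - by apply: openI; exact: tube_open.
  - by apply: convex_setI; exact: tube_convex.
  - by apply: lift_on_sub ly => z [].
  - by apply: lift_on_sub lx => z [].
  - by split; exact: tube0.
  - by split => //; rewrite -[X in tube y _ _ X]scale1r; exact: tube_end.
  - by rewrite hx.
have self x : tube x 1 (eh x).1 x.
  by have [ex _ _] := Heh x; rewrite -[X in tube x _ _ X]scale1r; exact: tube_end.
exists s; split.
- move=> x; have [ex lx hx] := Heh x; have [cx _] := lx x (self x).
  apply: continuous_near_eq cx.
  have : nbhs x (tube x 1 (eh x).1) by apply: open_nbhs_nbhs; split => //; exact: tube_open.
  by apply: filterS => y xy; rewrite -sE.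
- by move=> x; have [ex lx hx] := Heh x; have [_] := lx x (self x).
- by have [] := Heh 0.
Qed.

End Lifting.

(** * Homomorphisms between the deck groups *)

Fixpoint deck_pow n (g : deck) (l : nat) : deck :=
  if l is l'.+1 then deck_mul n g (deck_pow n g l') else deck1.

Lemma deck_pow_t n g l : deck_t (deck_pow n g l) = deck_t g *+ l.
Proof. by elim: l => //= l ->; rewrite mulrS. Qed.

Lemma deck_pow_y n g l : deck_y (deck_pow n g l) = deck_y g *+ l.
Proof. by elim: l => //= l ->; rewrite mulrS. Qed.

Lemma deck_pow_xz n (p r : int) l :
  deck_pow n (Deck 0 p 0 r) l = Deck 0 (p *+ l) 0 (r *+ l).
Proof.
elim: l => //= l ->; rewrite /deck_mul /= parity_sign0 !mulrS.
by congr Deck; ring.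
Qed.

Section Equivariance.
Variables (R : realType) (m n : nat) (phi : orbit_space R m -> orbit_space R n).
Variable Phi : 'rV[R]_4 -> 'rV[R]_4.
Hypothesis Phi_continuous : continuous Phi.
Hypothesis Phi_lift : forall x, orbit_of n (Phi x) = phi (orbit_of m x).

(** For a suitable [h], the maps [Phi \o deck_act m g] and [deck_act n h \o Phi] agree at 0; both
    lift [phi \o orbit_of m], so they agree everywhere. Multiplicativity follows from freeness. *)
Lemma deck_transfer : exists al : deck -> deck,
  [/\ forall g x, Phi (deck_act m g x) = deck_act n (al g) (Phi x),
      forall g h, al (deck_mul m g h) = deck_mul n (al g) (al h) & al deck1 = deck1].
Proof.
have H g : exists h, forall x, Phi (deck_act m g x) = deck_act n h (Phi x).
  have /esym/orbit_ofP[h E] : orbit_of n (Phi (deck_act m g 0)) = orbit_of n (Phi 0).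
    by rewrite !Phi_lift orbit_of_act.
  exists h => x.
  apply: (@lift_unique R n 4 (phi \o orbit_of m) setT (Phi \o deck_act m g)
    (deck_act n h \o Phi) 0 x).
  - exact: openT.
  - exact: convex_setT.
  - move=> y _; split; last by rewrite /= Phi_lift orbit_of_act.
    by apply: continuous_comp; [exact: deck_act_continuous|exact: Phi_continuous].
  - move=> y _; split; last by rewrite /= orbit_of_act Phi_lift.
    by apply: continuous_comp; [exact: Phi_continuous|exact: deck_act_continuous].
  - exact: I.
  - exact: I.
  - exact: E.
have [al Hal] := choice H.
exists al; split => // [g h|].
  by apply: (@deck_act_inj R n _ _ (Phi 0)); rewrite -deck_actM -!Hal deck_actM.
by apply: (@deck_act_inj R n _ _ (Phi 0)); rewrite -Hal !deck_act1.
Qed.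

End Equivariance.

Lemma deck_pow_transfer m n (al : deck -> deck) g l :
  (forall g h, al (deck_mul m g h) = deck_mul n (al g) (al h)) -> al deck1 = deck1 ->
  al (deck_pow m g l) = deck_pow n (al g) l.
Proof. by move=> alM al1; elim: l => //= l IH; rewrite alM IH. Qed.

(* In the deck group with parameter [m], the [m]-th power of the translation
   along [x] is a commutator, and no smaller power is.  When [n] is even, the
   [n]-th power of every torsion element modulo commutators is a commutator in the
   deck group with parameter [n]. *)
Lemma deck_iso_dvdn m n (al be : deck -> deck) :
  (0 < m)%N -> ~~ odd n ->
  (forall g h, al (deck_mul m g h) = deck_mul n (al g) (al h)) -> al deck1 = deck1 ->
  (forall g h, be (deck_mul n g h) = deck_mul m (be g) (be h)) -> be deck1 = deck1 ->
  be (al (Deck 0 1 0 0)) = Deck 0 1 0 0 -> (m %| n)%N.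
Proof.
move=> m0 n2 alM al1 beM be1 beal.
set ga := Deck 0 1 0 0; set ta := Deck 1 0 0 0; set ya := Deck 0 0 1 0.
have E1 : deck_mul m (deck_pow m ga m) (deck_mul m ya ta) = deck_mul m ta ya.
  rewrite deck_pow_xz /deck_mul /= /parity_sign /=; congr Deck; lia.
have E2 := congr1 al E1; rewrite !alM (deck_pow_transfer _ _ alM al1) in E2.
have [p [r aE]] : exists p r, al ga = Deck 0 p 0 r.
  (* [deck_t] and [deck_y] are additive, so they vanish on an element whose m-th power is a
     commutator. *)
  case aE : (al ga) => [k p q r]; exists p, r; rewrite aE in E2.
  move: (congr1 deck_t E2) (congr1 deck_y E2); rewrite /= deck_pow_t deck_pow_y /=.
  rewrite [deck_t (al ta) + _]addrC [deck_y (al ta) + _]addrC => /eqP + /eqP.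
  rewrite -[X in _ == X]add0r -[X in _ -> _ == X -> _]add0r !(inj_eq (addIr _)) !mulrn_eq0.
  by rewrite !gtn_eqF //= => /eqP -> /eqP ->.
have [h hn] : exists h : nat, n = (h + h)%N by exists n./2; rewrite addnn even_halfK.
(* The commutator of [ta] and [u] has x-part n p and z-part 2 r h = n r, hence is the n-th power of
   [al ga]; halving n is possible because it is even. *)
pose u := Deck 0 0 p (- (r *+ h)).
have E3 : deck_mul n (deck_pow n (al ga) n) (deck_mul n u ta) = deck_mul n ta u.
  rewrite aE deck_pow_xz /deck_mul /= !parity_sign0 !parity_sign1; congr Deck.
  - by rewrite -mulr_natr natz; ring.
  - ring.
  - by rewrite {1}hn mulrnDr; ring.
have E4 := congr1 be E3; rewrite !beM (deck_pow_transfer _ _ beM be1) beal in E4.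
move: (congr1 deck_x E4); rewrite deck_pow_xz /= => E5.
have : n%:Z = m%:Z * (deck_t (be ta) * deck_y (be u) - deck_t (be u) * deck_y (be ta)).
  by move: E5; rewrite -mulr_natr natz mul1r mulr0 mul0r; lia.
move=> /(congr1 absz); rewrite abszM !absz_nat => ->.
exact: dvdn_mulr.
Qed.

Lemma orbit_space_homeo_dvdn (R : realType) m n
    (phi : orbit_space R m -> orbit_space R n) (psi : orbit_space R n -> orbit_space R m) :
  (0 < m)%N -> ~~ odd n -> continuous phi -> continuous psi ->
  (forall p, psi (phi p) = p) -> (m %| n)%N.
Proof.
move=> m0 n2 cphi cpsi psiK.
have lift (a b : nat) (f : orbit_space R a -> orbit_space R b) : continuous f ->
    exists Phi : 'rV[R]_4 -> 'rV[R]_4, continuous Phi /\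
      forall x, orbit_of b (Phi x) = f (orbit_of a x).
  move=> cf; have [y0 y0E] := @orbit_of_surj R b (f (orbit_of a 0)).
  have cf' : continuous (f \o @orbit_of R a).
    by move=> x; apply: continuous_comp; [exact: orbit_of_continuous|exact: cf].
  by have [Phi [cP lP _]] := lift_exists cf' y0E; exists Phi.
have [Phi [cPhi lPhi]] := lift _ _ _ cphi; have [Psi [cPsi lPsi]] := lift _ _ _ cpsi.
have [al [alP alM al1]] := deck_transfer cPhi lPhi.
have [be [beP beM be1]] := deck_transfer cPsi lPsi.
have [e eE] : exists e, forall x, Psi (Phi x) = deck_act m e x.
  have /esym/orbit_ofP[e E] : orbit_of m (Psi (Phi 0)) = orbit_of m 0.
    by rewrite lPsi lPhi psiK.
  exists e => x; apply: (@lift_unique R m 4 (orbit_of m) setT (Psi \o Phi) (deck_act m e) 0 x).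
  - exact: openT.
  - exact: convex_setT.
  - move=> y _; split; last by rewrite /= lPsi lPhi psiK.
    by apply: continuous_comp; [exact: cPhi|exact: cPsi].
  - by move=> y _; split; [exact: deck_act_continuous|rewrite orbit_of_act].
  - exact: I.
  - exact: I.
  - exact: E.
apply: (@deck_iso_dvdn m n al be) => //.
(* The composite of [al] and [be] is conjugation by [e], and the translation along x is central. *)
apply: (@deck_act_inj R m _ _ (Psi (Phi 0))); rewrite -beP -alP !eE !deck_actM.
congr (deck_act m _ _); case: e {eE} => k p q r; rewrite /deck_mul /= parity_sign0.
by congr Deck; ring.
Qed.

Lemma orbit_manifold_diffeo (R : realType) m n : (0 < m)%N -> (0 < n)%N ->
  ~~ odd m -> ~~ odd n -> diffeomorphic (orbit_manifold R m) (orbit_manifold R n) -> m = n.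
Proof.
move=> m0 n0 m2 n2 [phi [[cphi _] phiT [psi [cpsi _] psiK]]].
have {}cphi := (continuous_subspace_setT _).2 cphi.
have {}cpsi := (continuous_subspace_setT _).2 cpsi.
have phiK p : phi (psi p) = p.
  have [q _ <-] : (phi @` setT) p by rewrite phiT.
  by rewrite psiK.
apply/eqP; rewrite eqn_dvd; apply/andP; split.
  by apply: (@orbit_space_homeo_dvdn R m n phi psi) => // p; exact: psiK.
exact: (@orbit_space_homeo_dvdn R n m psi phi).
Qed.

(** * Open books *)

Section Plane.
Context {R : realType}.
Implicit Types (z w : 'rV[R]_2) (t : R).

Definition row2 (a b : R) : 'rV[R]_2 := \row_i (if i == 0 then a else b).

Lemma row2P z a b : z 0 0 = a -> z 0 1 = b -> z = row2 a b.
Proof.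
move=> <- <-; apply/rowP => -[i Hi]; rewrite mxE.
by case: i Hi => [|[|]] //= Hi; congr (z _ _); apply/val_inj.
Qed.

Lemma sqnorm2_gt0 z : z != 0 -> 0 < sqnorm2 z.
Proof.
move=> z0; rewrite lt_def addr_ge0 ?sqr_ge0 // andbT; apply: contra z0.
rewrite paddr_eq0 ?sqr_ge0 // !sqrf_eq0 => /andP[/eqP a /eqP b].
by rewrite (row2P a b); apply/eqP/esym/row2P; rewrite mxE.
Qed.

Lemma sqnorm2Z r z : sqnorm2 (r *: z) = r ^+ 2 * sqnorm2 z.
Proof. by rewrite /sqnorm2 !mxE; ring. Qed.

Lemma sqnorm2_circle_point t : sqnorm2 (circle_point t) = 1.
Proof. by rewrite /sqnorm2 !mxE /= cos2Dsin2. Qed.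

Lemma circle_pointE t : circle_point t = row2 (cos (2 * pi * t)) (sin (2 * pi * t)).
Proof. by apply: row2P; rewrite mxE. Qed.

Lemma circle_pointD1 t : circle_point (t + 1) = circle_point t.
Proof.
have E : 2 * pi * (t + 1) = 2 * pi * t + pi *+ 2 by rewrite mulr2n; ring.
by rewrite !circle_pointE E cosD2pi sinD2pi.
Qed.

Lemma polar z : z != 0 -> exists r t, [/\ 0 < r, r ^+ 2 = sqnorm2 z & z = r *: circle_point t].
Proof.
move=> z0; have N0 := sqnorm2_gt0 z0; pose r := Num.sqrt (sqnorm2 z).
have r0 : 0 < r by rewrite sqrtr_gt0.
have r2 : r ^+ 2 = sqnorm2 z by rewrite sqr_sqrtr // ltW.
pose c := z 0 0 / r; pose s := z 0 1 / r.
have cs : c ^+ 2 + s ^+ 2 = 1.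
  by rewrite /c /s !expr_div_n -mulrDl r2 divff // gt_eqF.
have c1 : -1 <= c <= 1.
  rewrite -ler_norml -(@ler_pXn2r _ 2) ?nnegrE // expr1n real_normK ?num_real //.
  by rewrite -cs lerDl sqr_ge0.
have [a [ac asn]] : exists a, cos a = c /\ sin a = s.
  have s2 : 1 - c ^+ 2 = s ^+ 2 by rewrite -cs addrC addKr.
  have [s0|s0] := leP 0 s.
    by exists (acos c); rewrite acosK // sin_acos // s2 sqrtr_sqr ger0_norm.
  exists (- acos c); rewrite cosN sinN acosK // sin_acos // s2 sqrtr_sqr ltr0_norm //.
  by rewrite opprK.
exists r, (a / (2 * pi)); split => //.
have pi0 : (pi : R) != 0 by rewrite gt_eqF // pi_gt0.
have -> : circle_point (a / (2 * pi)) = row2 c s.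
  have E : 2 * pi * (a / (2 * pi)) = a by rewrite mulrC divfK // mulf_neq0 // pnatr_eq0.
  by rewrite circle_pointE E ac asn.
by rewrite [LHS](row2P erefl erefl); apply/esym/row2P; rewrite !mxE /= mulrC divfK // gt_eqF.
Qed.

(* The square of the direction of [z], seen as a complex number; it is smooth
   away from the origin and invariant under dilations. *)
Definition double_dir z : 'rV[R]_2 :=
  row2 ((z 0 0 ^+ 2 - z 0 1 ^+ 2) / sqnorm2 z) (2 * z 0 0 * z 0 1 / sqnorm2 z).

Lemma double_dirZ r z : r != 0 -> double_dir (r *: z) = double_dir z.
Proof.
move=> r0; rewrite /double_dir sqnorm2Z !mxE.
have r20 : r ^+ 2 != 0 by rewrite expf_neq0.
have k (a : R) : r ^+ 2 * a / (r ^+ 2 * sqnorm2 z) = a / sqnorm2 z by rewrite -mulf_div divff ?mul1r.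
by congr row2; rewrite -[RHS]k; congr (_ / _); ring.
Qed.

(** The determinant of the two vectors: for a point z moving with velocity w, |z|^2 times its
    angular velocity. It detects rotation without a choice of angle. *)
Definition cross z w : R := z 0 0 * w 0 1 - z 0 1 * w 0 0.

Lemma crossD z w w' : cross z (w + w') = cross z w + cross z w'.
Proof. by rewrite /cross !mxE; ring. Qed.

Lemma crossZ z a w : cross z (a *: w) = a * cross z w.
Proof. by rewrite /cross !mxE; ring. Qed.

Lemma is_derive_rV_coord z w i : is_derive z w (fun y : 'rV[R]_2 => y 0 i) (w 0 i).
Proof.
split; first exact/diff_derivable/differentiable_coord.
have := @derive_rV_coord R _ 2 id z w i (ltac:(exact: derivable_id)).
by rewrite derive_id.
Qed.

Lemma sqnorm2E : @sqnorm2 R = (fun z => z 0 0) * (fun z => z 0 0) + (fun z => z 0 1) * (fun z => z 0 1).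
Proof. by apply/funext => w; rewrite /sqnorm2 !expr2. Qed.

Lemma differentiable_sqnorm2 z : differentiable (@sqnorm2 R) z.
Proof.
rewrite sqnorm2E.
by apply: differentiableD; apply: differentiableM; exact: differentiable_coord.
Qed.

Lemma differentiable_double_dir z : z != 0 -> differentiable double_dir z.
Proof.
move=> z0; have N0 : sqnorm2 z != 0 by rewrite gt_eqF // sqnorm2_gt0.
have c i : differentiable (fun z : 'rV[R]_2 => z 0 i) z := differentiable_coord z 0 i.
have dN : differentiable (fun z => (sqnorm2 z)^-1) z.
  by apply: differentiableV => //; exact: differentiable_sqnorm2.
apply: differentiable_rV => -[[|[|//]] Hi].
- rewrite (_ : (fun y => _) = ((fun z : 'rV[R]_2 => z 0 0) ^+ 2 - (fun z : 'rV[R]_2 => z 0 1) ^+ 2) *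
    (fun z => (sqnorm2 z)^-1)); last by apply/funext => y; rewrite mxE !expr2.
  by apply: differentiableM => //; apply: differentiableB; apply: differentiableX.
- rewrite (_ : (fun y => _) = (cst 2 * (fun z : 'rV[R]_2 => z 0 0) * (fun z : 'rV[R]_2 => z 0 1)) *
    (fun z => (sqnorm2 z)^-1)); last by apply/funext => y; rewrite mxE.
  apply: differentiableM => //; apply: differentiableM => //; apply: differentiableM => //.
Qed.

(** Squaring doubles the angle and [double_dir] has norm 1, whence twice the angular velocity of
    z. *)
Lemma cross_derive_double_dir z w : z != 0 ->
  cross (double_dir z) ('D_w double_dir z) = 2 * cross z w / sqnorm2 z.
Proof.
move=> z0; have N0 : sqnorm2 z != 0 by rewrite gt_eqF // sqnorm2_gt0.
have d := diff_derivable (v := w) (differentiable_double_dir z0).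
pose X : 'rV[R]_2 -> R := fun z => z 0 0; pose Y : 'rV[R]_2 -> R := fun z => z 0 1.
have dX : is_derive z w X (w 0 0) by exact: is_derive_rV_coord.
have dY : is_derive z w Y (w 0 1) by exact: is_derive_rV_coord.
have dN : is_derive z w (@sqnorm2 R) (2 * (z 0 0 * w 0 0 + z 0 1 * w 0 1)).
  have -> : @sqnorm2 R = X * X + Y * Y by exact: sqnorm2E.
  by apply: is_derive_eq; rewrite /GRing.scale /= /X /Y; ring.
have dV : is_derive z w (fun z => (sqnorm2 z)^-1)
    (- (sqnorm2 z) ^- 2 * (2 * (z 0 0 * w 0 0 + z 0 1 * w 0 1))).
  split; first by apply: (derivableV N0); case: dN.
  by rewrite (deriveV N0); case: dN => // _ ->.
have dA : is_derive z w (X * X - Y * Y) (2 * (z 0 0 * w 0 0 - z 0 1 * w 0 1)).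
  by apply: is_derive_eq; rewrite /GRing.scale /= /X /Y; ring.
have dB : is_derive z w (2 \*: (X * Y)) (2 * (z 0 0 * w 0 1 + z 0 1 * w 0 0)).
  by apply: is_derive_eq; rewrite /GRing.scale /= /X /Y; ring.
have e0 : ('D_w double_dir z) 0 0 = 'D_w ((X * X - Y * Y) * (fun z => (sqnorm2 z)^-1)) z.
  by rewrite -derive_rV_coord //; congr (derive _ z w); apply/funext => y; rewrite mxE !expr2.
have e1 : ('D_w double_dir z) 0 1 = 'D_w ((2 \*: (X * Y)) * (fun z => (sqnorm2 z)^-1)) z.
  rewrite -derive_rV_coord //; congr (derive _ z w); apply/funext => y.
  by rewrite mxE /= -[2 * _ * _]mulrA.
rewrite /cross e0 e1 !derive_val !mxE /= -![(_ - _ : _ -> _) _]/(_ - _) -![(_ * _ : _ -> _) _]/(_ * _).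
rewrite /GRing.scale /= /X /Y.
move: N0; rewrite /sqnorm2 => N0; field; exact: N0.
Qed.

End Plane.

Section Book.
Context {R : realType} {m : nat} {M : manifold R m.+1} (ob : open_book M).
Local Notation V := (ob_page ob).
Local Notation h := (ob_monodromy ob).
Local Notation bd := (boundary V).

Definition piece_dir (u : V * R + V * 'rV[R]_2) : 'rV[R]_2 :=
  match u with inl (_, t) => double_dir (circle_point t) | inr (_, z) => double_dir z end.

Lemma piece_dir_glue u v : clos_refl_sym_trans _ (book_glue h) u v -> piece_dir u = piece_dir v.
Proof.
elim=> {u v} [u v [x|x t _ _] //|//|u v _ -> //|u v w _ -> _ -> //].
by rewrite /= -[1]add0r circle_pointD1.
Qed.

(* The square of the angular coordinate; unlike the angle, it takes values in a
   vector space, and the junk value of [double_dir] at [0] marks the binding. *)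
Definition page_dir (p : M) : 'rV[R]_2 := piece_dir (s2val (cid2 (ob_surj ob p))).

Lemma page_dir_piece u : book_pieces u ->
  page_dir (sum_rect (fun=> M) (ob_a ob) (ob_b ob) u) = piece_dir u.
Proof.
move=> bu; rewrite /page_dir; case: cid2 => u' bu' /= E.
exact/piece_dir_glue/(ob_inj bu' bu).
Qed.

Lemma ob_monodromy_surj x : exists y, h y = x.
Proof.
have [_ hT _] := ob_monodromy_diffeo ob.
have [y _ yx] : (h @` setT) x by rewrite hT.
by exists y.
Qed.

Lemma ob_a_shift (k : int) t x : exists y, ob_a ob (x, t + k%:~R) = ob_a ob (y, t).
Proof.
have P (l : nat) s y : exists y', ob_a ob (y, s + l%:R) = ob_a ob (y', s).
  elim: l y => [|l IH] y; first by exists y; rewrite addr0.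
  rewrite -natr1 addrA ob_a_period; exact: IH.
have N (l : nat) s y : exists y', ob_a ob (y, s) = ob_a ob (y', s + l%:R).
  elim: l y => [|l IH] y; first by exists y; rewrite addr0.
  have [y' ->] := IH y; have [y'' <-] := ob_monodromy_surj y'.
  by exists y''; rewrite -natr1 addrA ob_a_period.
case: k => l; first exact: P.
have [y ->] := N l.+1 (t + (Negz l)%:~R) x.
by exists y; rewrite NegzE mulrNz -addrA addNr addr0.
Qed.

Lemma circle_pointD_int (k : int) (t : R) : circle_point (t + k%:~R) = circle_point t.
Proof.
have P (l : nat) (s : R) : circle_point (s + l%:R) = circle_point s.
  by elim: l s => [|l IH] s; rewrite ?addr0 // -natr1 addrA circle_pointD1.
case: k => l; first exact: P.
by rewrite -(P l.+1) NegzE mulrNz -addrA addNr addr0.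
Qed.

Lemma page_dir_a x t : page_dir (ob_a ob (x, t)) = double_dir (circle_point t).
Proof.
have /andP[f1 f2] := real_floor_itv (num_real t).
have -> : t = (t - (Num.floor t)%:~R) + (Num.floor t)%:~R by rewrite subrK.
have [y ->] := ob_a_shift (Num.floor t) (t - (Num.floor t)%:~R) x.
rewrite circle_pointD_int; apply: (page_dir_piece (u := inl (y, _))) => /=.
by move: f2; rewrite intrD => f2; apply/andP; split; lra.
Qed.

(** On the closed unit disc this is the construction of [page_dir]. For 1 < |z| < 2 the point lies
    in the collar, hence in the mapping torus, and [ob_b_collar] matches the two angles. *)
Lemma page_dir_b x z : bd x -> sqnorm2 z < 4 -> page_dir (ob_b ob (x, z)) = double_dir z.
Proof.
move=> bx z4; have [z1|z1] := leP (sqnorm2 z) 1.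
  exact: (@page_dir_piece (inr (x, z))).
have z0 : z != 0.
  by apply: contraTneq z1 => ->; rewrite /sqnorm2 !mxE expr0n addr0 -leNgt.
have [r [t [r0 r2 zE]]] := polar z0.
have r1 : 1 < r by rewrite -(@ltr_pXn2r _ 2) ?nnegrE ?(ltW r0) // expr1n r2.
have r4 : r < 2.
  by rewrite -(@ltr_pXn2r _ 2) ?nnegrE ?(ltW r0) // r2 -natrX.
have rE : r = 1 + (r - 1) by rewrite addrC subrK.
rewrite zE {1}rE ob_b_collar //; last by apply/andP; split; lra.
by rewrite page_dir_a double_dirZ // gt_eqF.
Qed.

Lemma page_dir_page theta p : page_interior ob theta p ->
  page_dir p = double_dir (circle_point theta).
Proof.
move=> [[[x _ <-]|[x [r [bx /andP[r0 r1] pE]]]] pb]; first exact: page_dir_a.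
have rn0 : r != 0.
  by apply/eqP => rE; apply: pb; exists x => //; rewrite pE rE scale0r.
rewrite pE page_dir_b ?double_dirZ //.
rewrite sqnorm2Z sqnorm2_circle_point mulr1 (@le_lt_trans _ _ 1) ?ltr1n //.
by rewrite expr_le1.
Qed.

(** The alternatives are the open pieces on which embeddings are available. A point of the mapping
    torus over the boundary of the page lies outside the first piece; the gluing moves it to the
    unit circle of the disc. *)
Lemma off_binding p : ~ binding ob p ->
  (exists x t, ~ bd x /\ p = ob_a ob (x, t)) \/
  (exists x z, [/\ bd x, z != 0, sqnorm2 z < 4 & p = ob_b ob (x, z)]).
Proof.
move=> pb; have [[[x t]|[x z]] /= bu pE] := ob_surj ob p.
  have [bx|nbx] := pselect (bd x); last by left; exists x, t; rewrite pE.
  right; exists x, (circle_point t); split => //.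
  - apply/eqP => c0; have := sqnorm2_circle_point t.
    by rewrite c0 /sqnorm2 !mxE expr0n addr0 => /eqP; rewrite eq_sym oner_eq0.
  - by rewrite sqnorm2_circle_point ltr1n.
  - rewrite -pE; apply: (iffRL (@ob_inj _ _ _ ob (inl (x, t)) (inr (x, circle_point t)) _ _)).
    + exact: bu.
    + by split => //; rewrite sqnorm2_circle_point.
    + by apply: rst_step; exact: glue_boundary.
case: bu => bx z1; right; exists x, z; split => //.
  by apply/eqP => z0; apply: pb; exists x => //; rewrite -pE z0.
by rewrite (le_lt_trans z1) // ltr1n.
Qed.

Lemma off_binding_page p : ~ binding ob p -> exists theta, page_interior ob theta p.
Proof.
move=> pb; have [[x [t [_ pE]]]|[x [z [bx z0 z4 pE]]]] := off_binding pb.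
  by exists t; split => //; left; exists x.
have [r [t [r0 r2 zE]]] := polar z0; exists t; split => //.
have [r1|r1] := leP r 1.
  by right; exists x, r; split; rewrite ?(ltW r0) // pE zE.
have r4 : r < 2.
  by rewrite -(@ltr_pXn2r _ 2) ?nnegrE ?(ltW r0) // r2 -natrX.
have rE : r = 1 + (r - 1) by rewrite addrC subrK.
left; exists (ob_collar ob (x, r - 1)) => //.
by rewrite -ob_b_collar //; [rewrite -rE -zE|apply/andP; split; lra].
Qed.

End Book.

Section LinearComposition.
Context {R : realType}.

Lemma derive_mulmxr n m (A : 'M[R]_(n, m)) (x v : 'rV[R]_n) : 'D_v (mulmxr A) x = v *m A.
Proof.
rewrite deriveE; last exact: differentiable_mulmxr.
by rewrite diff_lin // => z; apply: differentiable_continuous; exact: differentiable_mulmxr.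
Qed.

Lemma mulmxr_continuous n m (A : 'M[R]_(n, m)) : continuous (mulmxr A : 'rV[R]_n -> 'rV[R]_m).
Proof. by move=> x; apply: differentiable_continuous; exact: differentiable_mulmxr. Qed.

Lemma C1on_subset n m (U V : set 'rV[R]_n) (f : 'rV[R]_n -> 'rV[R]_m) :
  open V -> V `<=` U -> C1on U f -> C1on V f.
Proof. by move=> oV VU [_ C]; split; [exact: oV|move=> x /VU; exact: C]. Qed.

Lemma C1on_precomp l n m (P : 'M[R]_(l, n)) U (f : 'rV[R]_n -> 'rV[R]_m) :
  C1on U f -> C1on [set w | U (w *m P)] (fun w => f (w *m P)).
Proof.
move=> [oU Cf]; have oU' : open [set w : 'rV[R]_l | U (w *m P)].
  by move/continuousP: (@mulmxr_continuous _ _ P); exact.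
split; first exact: oU'.
have D w v : U (w *m P) -> 'D_v (fun w => f (w *m P)) w = 'D_(v *m P) f (w *m P).
  move=> Uw; have [df _] := Cf _ Uw.
  by rewrite (@derive_comp _ _ _ _ (mulmxr P) f) ?derive_mulmxr //; exact: differentiable_mulmxr.
move=> w Uw; have [df cf] := Cf _ Uw; split.
  exact: (differentiable_comp (differentiable_mulmxr P w) df).
move=> v; have c : {for w, continuous (fun w : 'rV[R]_l => 'D_(v *m P) f (w *m P))}.
  apply: (@continuous_comp _ _ _ (mulmxr P) (fun y => 'D_(v *m P) f y)); last exact: cf.
  exact: mulmxr_continuous.
apply: continuous_near_eq c.
have : nbhs w [set w | U (w *m P)] by exact: open_nbhs_nbhs.
by apply: filterS => z Uz; rewrite D.
Qed.

Lemma C1on_postcomp n m l (Q : 'M[R]_(m, l)) U (f : 'rV[R]_n -> 'rV[R]_m) :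
  C1on U f -> C1on U (fun w => f w *m Q).
Proof.
move=> [oU Cf]; split; first exact: oU.
have D w v : U w -> 'D_v (fun w => f w *m Q) w = 'D_v f w *m Q.
  move=> Uw; have [df _] := Cf _ Uw.
  by rewrite (@derive_comp _ _ _ _ f (mulmxr Q)) ?derive_mulmxr //; exact: differentiable_mulmxr.
move=> w Uw; have [df cf] := Cf _ Uw; split.
  exact: (differentiable_comp df (differentiable_mulmxr Q _)).
move=> v; have c : {for w, continuous (fun w => 'D_v f w *m Q)}.
  apply: (@continuous_comp _ _ _ (fun y => 'D_v f y) (mulmxr Q)); first exact: cf.
  exact: mulmxr_continuous.
apply: continuous_near_eq c.
have : nbhs w U by exact: open_nbhs_nbhs.
by apply: filterS => z Uz; rewrite D.
Qed.

End LinearComposition.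

(* An embedding of a [d]-dimensional piece into a [d]-manifold is open; this is
   how invariance of domain is avoided.  [P] and [Q] identify the piece, read in
   a chart, with an open set of R^d. *)
Lemma embedding_local (R : realType) (X Y : topologicalType) (N d : nat)
    (A : set (chart R X N)) (B : set (chart R Y d)) (S : set X) (e : X -> Y) (g : Y -> X)
    (ga : chart R X N) (c : chart R Y d) (x0 : X) (P : 'M[R]_(d, N)) (Q : 'M[R]_(N, d))
    (w0 : 'rV[R]_d) :
  smooth_map A B S e -> smooth_map B A (e @` S) g -> (forall x, S x -> g (e x) = x) ->
  A ga -> B c -> open (dom c) ->
  (forall x, dom ga x -> param ga (coord ga x) = x) ->
  (forall y, dom c y -> param c (coord c y) = y) ->
  S x0 -> dom ga x0 -> dom c (e x0) ->
  P *m Q = 1%:M -> w0 *m P = coord ga x0 ->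
  (\forall w \near w0, (coord ga @` (dom ga `&` S)) (w *m P)) ->
  (fun w => param ga (w *m P)) @ w0 --> x0 ->
  exists (U V : set 'rV[R]_d) (F G : 'rV[R]_d -> 'rV[R]_d),
    [/\ C1on U F, C1on V G, U w0, V (coord c (e x0)) & F w0 = coord c (e x0)] /\
    [/\ forall w, U w -> [/\ S (param ga (w *m P)), dom ga (param ga (w *m P)) &
          coord ga (param ga (w *m P)) = w *m P],
        forall w, U w -> dom c (e (param ga (w *m P))) /\ F w = coord c (e (param ga (w *m P))),
        forall w, U w -> V (F w) /\ G (F w) = w &
        forall y, V y -> U (G y) /\ F (G y) = y].
Proof.
move=> [ce se] [cg sg] ge Aga Bc odc gaK cK Sx0 gx0 cx0 PQ w0E HS Hc.
have [U1 [F1 [oU1 U10 sF1 F1E]]] : exists (U1 : set 'rV[R]_N) F1,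
    [/\ open U1, U1 (coord ga x0), smooth_open U1 F1 &
    forall y, (coord ga @` (dom ga `&` S `&` e @^-1` dom c)) y -> U1 y ->
    (coord c \o e \o param ga) y = F1 y].
  by apply: se => //; exists x0.
have [V1 [G1 [oV1 V10 sG1 G1E]]] : exists (V1 : set 'rV[R]_d) G1,
    [/\ open V1, V1 (coord c (e x0)), smooth_open V1 G1 &
    forall y, (coord c @` (dom c `&` (e @` S) `&` g @^-1` dom ga)) y -> V1 y ->
    (coord ga \o g \o param c) y = G1 y].
  apply: sg => //; exists (e x0) => //; split; last by rewrite /preimage /= ge.
  by split => //; exists x0.
pose F w := F1 (w *m P); pose G y := G1 y *m Q.
have CF : C1on [set w | U1 (w *m P)] F := C1on_precomp P (smooth_open_C1 oU1 sF1).
have CG : C1on V1 G := C1on_postcomp Q (smooth_open_C1 oV1 sG1).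
(* The parameters at which the smooth local formula [F1] represents [e] in the charts. *)
pose good w := [/\ (coord ga @` (dom ga `&` S)) (w *m P),
  dom c (e (param ga (w *m P))) & U1 (w *m P)].
have goodS w : good w -> [/\ S (param ga (w *m P)), dom ga (param ga (w *m P)) &
    coord ga (param ga (w *m P)) = w *m P].
  by move=> [[x [gx Sx] <-] _ _]; rewrite gaK.
have goodF w : good w -> F w = coord c (e (param ga (w *m P))).
  move=> gw; have [Sw gaw wE] := goodS w gw; have [_ cw Uw] := gw.
  rewrite /F -F1E //; exists (param ga (w *m P)) => //; split => //.
have near_good : nbhs w0 good.
  have nS : \forall x \near x0, S x -> dom c (e x).
    have nc : nbhs (e x0) (dom c) by exact: open_nbhs_nbhs.
    have : @nbhs_subspace X S x0 (e @^-1` dom c) by exact: (ce x0 _ nc).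
    by rewrite -(nbhs_subspace_in Sx0).
  have nS' := Hc _ nS.
  have nU : nbhs w0 [set w | U1 (w *m P)].
    by apply: open_nbhs_nbhs; split; [have [] := CF|rewrite /= w0E].
  near=> w; split.
  - by near: w.
  - have [x [gx Sx] xE] : (coord ga @` (dom ga `&` S)) (w *m P) by near: w.
    have : S (param ga (w *m P)) -> dom c (e (param ga (w *m P))) by near: w.
    by apply; rewrite -xE gaK.
  - by near: w.
have Fw0 : F w0 = coord c (e x0).
  by rewrite goodF ?w0E ?gaK //; exact: nbhs_singleton.
have GF w : good w -> V1 (F w) -> G (F w) = w.
  move=> gw VF; have [Sw gaw wE] := goodS w gw; have [_ cw _] := gw.
  rewrite /G -G1E //.
    by rewrite /= goodF // cK // ge // wE -mulmxA PQ mulmx1.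
  exists (e (param ga (w *m P))); last by rewrite goodF.
  split; last by rewrite /preimage /= ge.
  by split => //; exists (param ga (w *m P)).
pose U0 := interior good.
have nU0 : nbhs w0 U0.
  by apply: open_nbhs_nbhs; split; [exact: open_interior|exact: near_good].
have U0good w : U0 w -> good w by exact: interior_subset.
have CF0 : C1on U0 F.
  by apply: C1on_subset CF; [exact: open_interior|move=> w /U0good[]].
have [dF0 _] : differentiable F w0 /\ True by have [_ /(_ _ (nbhs_singleton nU0))[]] := CF0.
have VF0 : V1 (F w0).
  rewrite Fw0; exact: V10.
have HGF w : U0 w -> V1 (F w) -> G (F w) = w by move=> /U0good; exact: GF.
have near_y := local_section_of_retraction nU0 dF0 CG VF0 HGF.
pose V := interior [set y | V1 y /\ (U0 (G y) /\ F (G y) = y)].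
have oV : open V by exact: open_interior.
have VV1 y : V y -> V1 y /\ (U0 (G y) /\ F (G y) = y) by exact: interior_subset.
have nV : V (F w0).
  apply: filterI; [exact: open_nbhs_nbhs|exact: near_y].
(* Cutting [U0] down to the preimage of [V] makes [F] and [G] mutually inverse bijections between
   [U] and [V]. *)
pose U := [set w | U0 w /\ V (F w)].
have oU : open U.
  rewrite openE => w [Uw Vw]; have [_ /(_ _ Uw)[dFw _]] := CF0.
  have cFw : {for w, continuous F} := differentiable_continuous dFw.
  apply: filterI; first by apply: open_nbhs_nbhs; split; [exact: open_interior|exact: Uw].
  by apply: cFw; apply: open_nbhs_nbhs; split; [exact: oV|exact: Vw].
exists U, V, F, G; split; split.
- by apply: C1on_subset CF0; [exact: oU|move=> w []].
- by apply: C1on_subset CG; [exact: oV|move=> y /VV1[]].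
- by split; [exact: nbhs_singleton|].
- by rewrite -Fw0.
- exact: Fw0.
- by move=> w [/U0good gw _]; exact: goodS.
- by move=> w [/U0good gw _]; split; [case: gw|exact: goodF].
- move=> w [Uw Vw]; have [Vw1 _] := VV1 _ Vw; split; [exact: Vw|exact: HGF].
- move=> y Vy; have [Vy1 [Uy Fy]] := VV1 y Vy; split; last exact: Fy.
  split; first exact: Uy.
  rewrite Fy; exact: Vy.
Unshelve. all: by end_near. Qed.

(** * Independence of the boundary from the chart *)

Section Boundary.
Context {R : realType} {m : nat} (V : manifold R m.+1).
Implicit Types (c d : chart R V m.+1) (x : V).

Lemma param_coord c x : atlas V c -> dom c x -> param c (coord c x) = x.
Proof. by move=> ac cx; have [_ _ cK _ _] := manifold_chart ac; exact: cK. Qed.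

Lemma param_near c x (N : set V) : atlas V c -> dom c x -> nbhs x N ->
  \forall w \near coord c x, image_of c w -> N (param c w).
Proof.
move=> ac cx nN; have [_ _ cK _ cp] := manifold_chart ac.
have xc : image_of c (coord c x) by exists x.
have : @nbhs_subspace _ (image_of c) (coord c x) (param c @^-1` N).
  have nN' : nbhs (param c (coord c x)) N by rewrite cK.
  exact: (cp _ _ nN').
by rewrite -(nbhs_subspace_in xc).
Qed.

Lemma halfspace0 (w : 'rV[R]_m.+1) : 0 <= w 0 0 -> @halfspace R m.+1 w.
Proof. by move=> w0 i /eqP i0; have -> : i = 0 by exact/val_inj/eqP. Qed.

Lemma image_of_ge0 c w : atlas V c -> image_of c w -> 0 <= w 0 0.
Proof.
by move=> ac; have [_ [Q oQ E] _ _ _] := manifold_chart ac; rewrite E => -[_]; exact.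
Qed.

Lemma image_of_near c x : atlas V c -> dom c x ->
  \forall w \near coord c x, 0 <= (w : 'rV[R]_m.+1) 0 0 -> image_of c w.
Proof.
move=> ac cx; have [_ [Q oQ E] _ _ _] := manifold_chart ac.
have : Q (coord c x) by have [] : (Q `&` @halfspace R m.+1) (coord c x) by rewrite -E; exists x.
move=> Qx; have : nbhs (coord c x) Q by exact: open_nbhs_nbhs.
by apply: filterS => w Qw w0; rewrite E; split => //; exact: halfspace0.
Qed.

Lemma smooth_map_id : smooth_map (atlas V) (atlas V) setT id.
Proof.
split; first by apply: continuous_subspaceT => x; exact: cvg_id.
move=> c d ac ad; rewrite setIT; exact: manifold_compat.
Qed.

(** [boundary] asks for a single chart with vanishing first coordinate. If [d] were such a chart at
    [x], then [embedding_local], applied to the identity, would put a neighbourhood of [coord d x]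
    into the image of [d], including points with negative first coordinate. *)
Lemma interior_not_boundary c x : atlas V c -> dom c x -> 0 < coord c x 0 0 -> ~ boundary V x.
Proof.
move=> ac cx x0 [d ad [dx [i /eqP i0]]].
have {i i0} -> : i = 0 by exact/val_inj/eqP.
move=> dx0; have [od _ _ _ _] := manifold_chart ad.
have idT : smooth_map (atlas V) (atlas V) (id @` [set: V]) id.
  by rewrite image_id; exact: smooth_map_id.
have near0 : \forall w \near coord c x, 0 <= (w : 'rV[R]_m.+1) 0 0.
  have c0 : {for coord c x, continuous (fun w : 'rV[R]_m.+1 => w 0 0)}.
    exact: coord_continuous.
  have : nbhs (coord c x 0 0) [set r : R | 0 < r] by exact: lt_nbhsr.
  by move=> /c0 H; near=> w; apply: ltW; near: w; exact: H.
have near_im : \forall w \near coord c x, image_of c w.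
  near=> w; have : 0 <= w 0 0 -> image_of c w by near: w; exact: image_of_near.
  by apply; near: w.
have [||||U [U' [F [G [[_ CG _ U'x _] [_ HF _ HG]]]]]] := @embedding_local R V V m.+1 m.+1 (atlas V)
  (atlas V) setT id id c d x 1%:M 1%:M (coord c x) smooth_map_id idT (fun _ _ => erefl) ac ad od
  (fun x => param_coord ac) (fun x => param_coord ad) I cx dx.
- by rewrite mulmx1.
- by rewrite mulmx1.
- by near=> w; rewrite mulmx1 setIT; near: w.
- move=> N nN; suff H : \forall w \near coord c x, N (param c (w *m 1%:M)) by exact: H.
  near=> w; rewrite mulmx1.
  have : image_of c w -> N (param c w) by near: w; exact: param_near.
  by apply; near: w.
have [oU' _] := CG.
have : nbhs (coord d x) U' by exact: open_nbhs_nbhs.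
move=> /nbhs_ballP[e /= e0 He].
pose y := coord d x - (e / 2) *: delta_mx 0 0.
have yU' : U' y.
  apply: He; rewrite -ball_normE /= /y opprB addrC subrK normrZ gtr0_norm ?divr_gt0 //.
  apply: (@le_lt_trans _ _ (e / 2)); last lra.
  rewrite ler_piMr ?divr_ge0 ?(ltW e0) //; apply: rV_norm_le => // i.
  by rewrite !mxE eqxx /=; case: (_ == _); rewrite ?normr1 ?normr0.
have [Uy Fy] := HG y yU'; have [dy yE] := HF _ Uy.
have : image_of d y by exists (param c (G y *m 1%:M)) => //; rewrite -[RHS]Fy yE.
move=> /(image_of_ge0 ad); rewrite /y !mxE dx0 !eqxx mulr1 sub0r oppr_ge0; lra.
Unshelve. all: by end_near. Qed.

Lemma boundary_coord0 c x : atlas V c -> dom c x -> (boundary V x <-> coord c x 0 0 = 0).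
Proof.
move=> ac cx; split=> [bx|x0]; last by exists c => //; split => //; exists 0.
apply/eqP/negPn/negP => x0; apply: (interior_not_boundary ac cx) => //.
by rewrite lt_def x0 (@image_of_ge0 c) //; exists x.
Qed.

End Boundary.

Section UnitCircle.
Context {R : realType}.

Lemma sqnorm2_double_dir (z : 'rV[R]_2) : z != 0 -> sqnorm2 (double_dir z) = 1.
Proof.
move=> z0; have N0 : sqnorm2 z != 0 by rewrite gt_eqF // sqnorm2_gt0.
rewrite {1}/sqnorm2 !mxE /=; move: N0; rewrite /sqnorm2 => N0; field; exact: N0.
Qed.

Lemma double_dir_neq0 (z : 'rV[R]_2) : z != 0 -> double_dir z != 0.
Proof.
move=> z0; apply/eqP => E; have := sqnorm2_double_dir z0.
by rewrite E /sqnorm2 !mxE expr0n addr0 => /eqP; rewrite eq_sym oner_eq0.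
Qed.

Lemma double_dir0 : double_dir (0 : 'rV[R]_2) = 0.
Proof. by apply/esym/row2P; rewrite !mxE ?expr0n ?mulr0 ?subrr ?mul0r. Qed.

Lemma circle_point_neq0 (t : R) : circle_point t != 0.
Proof.
apply/eqP => c0; have := sqnorm2_circle_point t.
by rewrite c0 /sqnorm2 !mxE expr0n addr0 => /eqP; rewrite eq_sym oner_eq0.
Qed.

Definition circle_velocity (t : R) : 'rV[R]_2 :=
  row2 (- (2 * pi * sin (2 * pi * t))) (2 * pi * cos (2 * pi * t)).

Lemma is_derive_row2 (a b : R -> R) (a' b' t : R) :
  is_derive t (1 : R) a a' -> is_derive t (1 : R) b b' ->
  is_derive t (1 : R) (fun t => row2 (a t) (b t)) (row2 a' b').
Proof.
move=> ha hb.
have H (j : 'I_2) : is_derive t (1 : R) (fun t => row2 (a t) (b t) 0 j) (row2 a' b' 0 j).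
  by rewrite mxE; under eq_fun do rewrite mxE; case: (j == 0).
have D : derivable (fun t => row2 (a t) (b t)) t (1 : R).
  by apply/derivable_mxP => i j; rewrite (ord1 i); have [] := H j.
split; first exact: D.
by rewrite (derive_mx D); apply/rowP => j; rewrite mxE; have [_ ->] := H j.
Qed.

Lemma is_derive_circle_point (t : R) : is_derive t (1 : R) (@circle_point R) (circle_velocity t).
Proof.
have -> : @circle_point R = fun t => row2 (cos (2 * pi * t)) (sin (2 * pi * t)).
  by apply/funext => s; exact: circle_pointE.
have dl : is_derive t (1 : R) ((2 * pi) \*: (@id R)) (2 * pi).
  by apply: is_derive_eq; rewrite /GRing.scale /= mulr1.
have hc : is_derive t (1 : R) (cos \o ((2 * pi) \*: (@id R))) (- (2 * pi * sin (2 * pi * t))).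
  by apply: is_derive_eq; rewrite /GRing.scale /=; ring.
have hs : is_derive t (1 : R) (sin \o ((2 * pi) \*: (@id R))) (2 * pi * cos (2 * pi * t)).
  by apply: is_derive_eq; rewrite /GRing.scale /=; ring.
exact: is_derive_row2.
Qed.

Lemma cross_circle_velocity (t : R) : cross (circle_point t) (circle_velocity t) = 2 * pi.
Proof.
rewrite /cross circle_pointE !mxE /=.
transitivity (2 * pi * (cos (2 * pi * t) ^+ 2 + sin (2 * pi * t) ^+ 2)); first ring.
by rewrite cos2Dsin2 mulr1.
Qed.

Lemma continuous_circle_velocity : continuous circle_velocity.
Proof.
have d t : differentiable circle_velocity t.
  apply: differentiable_rV => i.
  have l s : is_derive s (1 : R) ((2 * pi) \*: (@id R)) (2 * pi).
    by apply: is_derive_eq; rewrite /GRing.scale /= mulr1.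
  have hc : is_derive t (1 : R) (cos \o ((2 * pi) \*: (@id R))) (- (2 * pi * sin (2 * pi * t))).
    by have ls := l t; apply: is_derive_eq; rewrite /GRing.scale /=; ring.
  have hs : is_derive t (1 : R) (sin \o ((2 * pi) \*: (@id R))) (2 * pi * cos (2 * pi * t)).
    by have ls := l t; apply: is_derive_eq; rewrite /GRing.scale /=; ring.
  apply/derivable1_diffP; case: i => [[|[|//]] Hi].
  - rewrite (_ : (fun y => _) = - ((2 * pi) \*: (sin \o ((2 * pi) \*: (@id R))))).
      by apply/derivableN/derivableZ; case: hs.
    by apply/funext => s; rewrite mxE.
  - rewrite (_ : (fun y => _) = (2 * pi) \*: (cos \o ((2 * pi) \*: (@id R)))).
      by apply: derivableZ; case: hc.
    by apply/funext => s; rewrite mxE.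
by move=> t; apply: differentiable_continuous.
Qed.

Lemma C1on_circle_point n (U : set 'rV[R]_n) (f : 'rV[R]_n -> 'rV[R]_n) i :
  C1on U f -> C1on U (fun y => circle_point (f y 0 i)) /\
  forall y v, U y -> 'D_v (fun y => circle_point (f y 0 i)) y = ('D_v f y) 0 i *: circle_velocity (f y 0 i).
Proof.
move=> [oU Cf].
have dc t : differentiable (@circle_point R) t.
  by apply/derivable1_diffP; have [] := is_derive_circle_point t.
have df y : U y -> differentiable (fun y => f y 0 i) y.
  by move=> /Cf[d _]; exact: differentiable_rV_coord.
have D y v : U y -> 'D_v (fun y => circle_point (f y 0 i)) y = ('D_v f y) 0 i *: circle_velocity (f y 0 i).
  move=> Uy; rewrite (@derive_comp _ _ _ _ (fun y => f y 0 i) (@circle_point R)) //; last exact: df.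
  have [d _] := Cf y Uy; rewrite derive_rV_coord; last exact: diff_derivable.
  rewrite -[X in derive _ _ X]mulr1 -[X in derive _ _ X]/(_ *: _) deriveZ_dir //.
  by have [_ ->] := is_derive_circle_point (f y 0 i).
split; last exact: D.
split; first exact: oU.
move=> y Uy; have [d c] := Cf y Uy; split.
  exact: (differentiable_comp (df y Uy) (dc _)).
move=> v.
have c1 : {for y, continuous (fun y => ('D_v f y) 0 i)}.
  apply: (@continuous_comp _ _ _ (fun y => 'D_v f y) (fun z : 'rV[R]_n => z 0 i)); first exact: c.
  exact: coord_continuous.
have c2 : {for y, continuous (fun y => circle_velocity (f y 0 i))}.
  apply: (@continuous_comp _ _ _ (fun y => f y 0 i) circle_velocity); last exact: continuous_circle_velocity.
  exact: differentiable_continuous (df y Uy).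
apply: continuous_near_eq (cvgZ c1 c2).
have : nbhs y U by exact: open_nbhs_nbhs.
by apply: filterS => z Uz; rewrite D.
Qed.

End UnitCircle.

(** * The page angle in charts of the 4-manifold *)

Section LocalBook.
Context {R : realType} {M : manifold R 4} (ob : open_book M).
Local Notation V := (ob_page ob).
Local Notation bd := (boundary V).

Lemma binding_dir p : binding ob p <-> page_dir ob p = 0.
Proof.
split=> [[x bx <-]|p0].
  by rewrite page_dir_b ?double_dir0 // /sqnorm2 !mxE expr0n addr0.
apply: contrapT => /off_binding[[x [t [_ pE]]]|[x [z [bx z0 z4 pE]]]]; move: p0; rewrite pE.
  by rewrite page_dir_a => /eqP; apply/negP/double_dir_neq0/circle_point_neq0.
by rewrite page_dir_b // => /eqP; apply/negP/double_dir_neq0.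
Qed.

(* Up to scale, [Z] is a local square root of [page_dir]: the disc coordinate near
   the binding, the circle coordinate on the mapping torus. *)
Definition phase_at (c : chart R M 4) (eta0 : 'rV[R]_4) : Prop :=
  exists (N : set 'rV[R]_4) (Z : 'rV[R]_4 -> 'rV[R]_2),
  [/\ C1on N Z, N eta0,
      forall y, N y -> Z y != 0 /\ page_dir ob (param c y) = double_dir (Z y) &
      exists v, cross (Z eta0) ('D_v Z eta0) != 0].

Lemma lsubmx1 (w : 'rV[R]_(3 + 1)) : rsubmx w = const_mx (w 0 (rshift 3 0)).
Proof. by apply/rowP => j; rewrite !mxE (ord1 j). Qed.

(** [embedding_local] turns [ob_a] into local coordinates made of three page coordinates and t. [Z]
    is the point of the circle at angle t, and it rotates in the direction d/dt. *)
Lemma phase_at_interior c x t : atlas M c -> ~ bd x -> dom c (ob_a ob (x, t)) ->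
  phase_at c (coord c (ob_a ob (x, t))).
Proof.
move=> ac nbx cp; have [od _ _ _ _] := manifold_chart ac.
have [d ad dx] := manifold_cover x.
(* The window of length 1 on which [ob_a] is an embedding is centred at [t]. *)
have [sa _ [g sg ga]] := ob_a_embedding ob (t - 2^-1).
set S := (_ `*` _) in sa sg ga.
pose li : chart R R 1 := Chart setT (fun t : R => const_mx t) (fun v : 'rV[R]_1 => v 0 0).
pose w0 : 'rV[R]_4 := coord (prod_chart d li) (x, t).
have ap : prod_atlas (atlas V) (@line_atlas R) (prod_chart d li) by exists d => //; exists li.
have pK : forall y : V * R, dom (prod_chart d li) y -> param (prod_chart d li) (coord (prod_chart d li) y) = y.
  move=> [y s] [/= dy _]; rewrite row_mxKl row_mxKr mxE; congr pair; exact: param_coord.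
have Sx : S (x, t) by split => //=; apply/andP; split; lra.
have px : dom (prod_chart d li) (x, t) by [].
have x0 : 0 < coord d x 0 0.
  rewrite lt_def; apply/andP; split; last by apply: (@image_of_ge0 _ _ V d) => //; exists x.
  by apply/eqP => /(boundary_coord0 ad dx).
have cl : {for w0, continuous (fun w : 'rV[R]_(3 + 1) => lsubmx w)}.
  exact: continuous_lsubmx.
have lw0 : lsubmx (w0 : 'rV[R]_(3 + 1)) = coord d x by exact: row_mxKl.
have rw0 : (w0 : 'rV[R]_(3 + 1)) 0 (rshift 3 0) = t by rewrite /w0 /= row_mxEr mxE.
have near_int : \forall w \near w0, exists x', [/\ dom d x', ~ bd x' & coord d x' = lsubmx (w : 'rV[R]_(3 + 1))].
  have near_pos : \forall v \near coord d x, 0 < (v : 'rV[R]_3) 0 0.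
    have c0 : {for coord d x, continuous (fun w : 'rV[R]_3 => w 0 0)} by exact: coord_continuous.
    have : nbhs (coord d x 0 0) [set r : R | 0 < r] by exact: lt_nbhsr.
    by move=> /c0.
  have near_v : \forall v \near coord d x, exists x', [/\ dom d x', ~ bd x' & coord d x' = v].
    near=> v; have v0 : 0 < v 0 0 by near: v.
    have : 0 <= v 0 0 -> image_of d v by near: v; exact: image_of_near.
    move=> /(_ (ltW v0))[x' dx' vE]; exists x'; split => //.
    by apply: (interior_not_boundary ad dx'); rewrite vE.
  by rewrite -lw0 in near_v; exact: (cl _ near_v).
have near_t : \forall w \near w0, t - 2^-1 < (w : 'rV[R]_(3 + 1)) 0 (rshift 3 0) < t - 2^-1 + 1.
  have c3 : {for w0, continuous (fun w : 'rV[R]_(3 + 1) => w 0 (rshift 3 0))} by exact: coord_continuous.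
  have nt : nbhs ((w0 : 'rV[R]_(3 + 1)) 0 (rshift 3 0)) [set s : R | t - 2^-1 < s < t - 2^-1 + 1].
    by rewrite rw0; apply/nbhs_ballP; exists 2^-1 => //= s; rewrite -ball_normE /= ltr_distl; lra.
  exact: (c3 _ nt).
have Hnear : \forall w \near w0, (coord (prod_chart d li) @` (dom (prod_chart d li) `&` S)) (w *m (1%:M : 'M[R]_(4, 3 + 1))).
  near=> w; rewrite mulmx1.
  have [x' [dx' nbx' x'E]] : exists x', [/\ dom d x', ~ bd x' & coord d x' = lsubmx (w : 'rV[R]_(3 + 1))] by near: w.
  exists (x', (w : 'rV[R]_(3 + 1)) 0 (rshift 3 0)).
    by split => //; split => //=; near: w.
  by rewrite /= x'E -lsubmx1 hsubmxK.
have Hlim : (fun w : 'rV[R]_4 => param (prod_chart d li) (w *m (1%:M : 'M[R]_(4, 3 + 1)))) @ w0 --> (x, t).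
  move=> N [[A B] [/= nA nB] AB].
  suff H : \forall w \near w0, N (param (prod_chart d li) (w *m (1%:M : 'M[R]_(4, 3 + 1)))) by exact: H.
  have nA' : \forall w \near w0, image_of d (lsubmx (w : 'rV[R]_(3 + 1))) -> A (param d (lsubmx (w : 'rV[R]_(3 + 1)))).
    have := param_near ad dx nA; rewrite -lw0 => nA'; exact: (cl _ nA').
  have nB' : \forall w \near w0, B ((w : 'rV[R]_(3 + 1)) 0 (rshift 3 0)).
    have c3 : {for w0, continuous (fun w : 'rV[R]_(3 + 1) => w 0 (rshift 3 0))} by exact: coord_continuous.
    by rewrite -rw0 in nB; exact: (c3 _ nB).
  near=> w; rewrite mulmx1; apply: AB; split => /=.
    have [x' [dx' _ x'E]] : exists x', [/\ dom d x', ~ bd x' & coord d x' = lsubmx (w : 'rV[R]_(3 + 1))] by near: w.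
    have : image_of d (lsubmx (w : 'rV[R]_(3 + 1))) -> A (param d (lsubmx (w : 'rV[R]_(3 + 1)))) by near: w.
    by apply; exists x'.
  by rewrite mxE; near: w.
have [||U [N [F [G [[CF CG Uw0 Nx Fw0] [HS HF HFG HGF]]]]]] := @embedding_local R (V * R)%type M (3 + 1) 4
  (prod_atlas (atlas V) (@line_atlas R)) (atlas M) S (ob_a ob) g (prod_chart d li) c (x, t)
  (1%:M : 'M[R]_(4, 3 + 1)) (1%:M : 'M[R]_(3 + 1, 4)) w0 sa sg ga ap ac od pK
  (fun y => param_coord ac) Sx px cp _ _ Hnear Hlim.
- exact: mulmx1.
- exact: mulmx1.
have [CZ DZ] := C1on_circle_point (rshift 3 0 : 'I_(3 + 1)) CG.
exists N, (fun y => circle_point (G y 0 (rshift 3 0 : 'I_(3 + 1)))); split => //.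
  move=> y Ny; split; first exact: circle_point_neq0.
  have [Uy yE] := HGF y Ny; have [cy Fy] := HF _ Uy.
  rewrite -{1}yE Fy param_coord // mulmx1 /= page_dir_a; congr (double_dir (circle_point _)).
  by rewrite mxE.
have oU : open U by case: CF.
have nU : nbhs w0 U by exact: open_nbhs_nbhs.
have [dF _] : differentiable F w0 /\ True by case: CF => _ /(_ _ Uw0)[].
have [dG _] : differentiable G (F w0) /\ True.
  by rewrite Fw0; case: CG => _ /(_ _ Nx)[].
pose v := 'D_(delta_mx 0 (rshift 3 0 : 'I_(3 + 1))) F w0.
exists v; rewrite DZ //.
have -> : 'D_v G (coord c (ob_a ob (x, t))) = delta_mx 0 (rshift 3 0 : 'I_(3 + 1)).
  rewrite -Fw0 /v -derive_comp //.
  rewrite (@near_eq_derive _ _ _ _ id); first exact: derive_id.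
  by apply: filterS nU => w Uw; have [] := HFG w Uw.
rewrite mxE !eqxx scale1r cross_circle_velocity mulf_neq0 ?pnatr_eq0 //.
by rewrite gt_eqF // pi_gt0.
Unshelve. all: by end_near. Qed.

End LocalBook.

Section Tubular.
Context {R : realType} {M : manifold R 4} (ob : open_book M).
Local Notation V := (ob_page ob).
Local Notation bd := (boundary V).

(** Coordinates on the tube are two along the binding followed by the two of the disc; this matrix
    extracts the latter. *)
Definition normal_mx : 'M[R]_(4, 2) := (col_mx 0 1%:M : 'M[R]_(2 + 2, 2)).

(* [insert_mx] inserts a zero in front: the boundary of a page is given by the
   vanishing of the first coordinate. *)
Definition insert_mx : 'M[R]_(4, 3 + 2) :=
  (row_mx (0 : 'M[R]_(4, 1)) (1%:M : 'M[R]_4) : 'M[R]_(4, 1 + 4)).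

Definition delete_mx : 'M[R]_(3 + 2, 4) :=
  (col_mx (0 : 'M[R]_(1, 4)) (1%:M : 'M[R]_4) : 'M[R]_(1 + 4, 4)).

Lemma insert_deleteK : insert_mx *m delete_mx = 1%:M.
Proof.
have := mul_row_col (0 : 'M[R]_(4, 1)) (1%:M : 'M[R]_4) (0 : 'M[R]_(1, 4)) (1%:M : 'M[R]_4).
by rewrite mul0mx mulmx1 add0r.
Qed.

Lemma mul_insert_mx (w : 'rV[R]_4) : w *m insert_mx = (row_mx (0 : 'rV[R]_1) w : 'rV[R]_(1 + 4)).
Proof.
by have := mul_mx_row w (0 : 'M[R]_(4, 1)) (1%:M : 'M[R]_4); rewrite mulmx0 mulmx1.
Qed.

Lemma normal_mxE (w : 'rV[R]_4) : w *m normal_mx = rsubmx (w *m insert_mx).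
Proof.
have -> : w *m normal_mx = rsubmx (w : 'rV[R]_(2 + 2)).
  rewrite -[w in LHS](@hsubmxK _ 1 2 2 w).
  have := mul_row_col (lsubmx (w : 'rV[R]_(2 + 2))) (rsubmx (w : 'rV[R]_(2 + 2))) (0 : 'M[R]_(2, 2)) (1%:M : 'M[R]_2).
  by rewrite mulmx0 mulmx1 add0r.
rewrite mul_insert_mx; apply/rowP => j; rewrite [LHS]mxE [RHS]mxE.
have -> : rshift 3 j = rshift 1 (rshift 2 j : 'I_(2 + 2)) by exact/val_inj.
by rewrite -[RHS]/(row_mx (0 : 'rV[R]_1) w 0 (rshift 1 (rshift 2 j : 'I_(2 + 2)))) row_mxEr.
Qed.

Lemma lsubmx_insert0 (w : 'rV[R]_4) : (lsubmx (w *m insert_mx)) 0 0 = 0.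
Proof.
rewrite mul_insert_mx mxE.
have -> : lshift 2 (0 : 'I_3) = lshift 4 (0 : 'I_1) by exact/val_inj.
by rewrite -[LHS]/(row_mx (0 : 'rV[R]_1) w 0 (lshift 4 (0 : 'I_1))) row_mxEl mxE.
Qed.

Lemma delete_insertK (u : 'rV[R]_(3 + 2)) : (lsubmx u) 0 0 = 0 -> u *m delete_mx *m insert_mx = u.
Proof.
move=> u0; rewrite mul_insert_mx.
have -> : u *m delete_mx = rsubmx (u : 'rV[R]_(1 + 4)).
  rewrite -[u in LHS](@hsubmxK _ 1 1 4 u).
  have := mul_row_col (lsubmx (u : 'rV[R]_(1 + 4))) (rsubmx (u : 'rV[R]_(1 + 4))) (0 : 'M[R]_(1, 4)) (1%:M : 'M[R]_4).
  by rewrite mulmx0 mulmx1 add0r.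
have <- : lsubmx (u : 'rV[R]_(1 + 4)) = 0; last exact: (@hsubmxK _ 1 1 4 u).
apply/rowP => j; rewrite !mxE (ord1 j) -u0 mxE; congr (u _ _); exact/val_inj.
Qed.

(** The product of the boundary with the disc is read in a five-dimensional chart of page times
    plane, as the slice with vanishing first coordinate; [insert_mx] and [delete_mx] identify the
    slice with R^4 for [embedding_local]. The case z = 0 is included, so the binding appears as a
    coordinate plane. *)
Lemma tubular_chart c x z : atlas M c -> bd x -> sqnorm2 z < 4 -> dom c (ob_b ob (x, z)) ->
  exists (U N : set 'rV[R]_4) (F G : 'rV[R]_4 -> 'rV[R]_4) (w0 : 'rV[R]_4),
  [/\ C1on U F, C1on N G, U w0, N (coord c (ob_b ob (x, z))) & F w0 = coord c (ob_b ob (x, z))] /\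
  [/\ w0 *m normal_mx = z,
      forall w, U w -> page_dir ob (param c (F w)) = double_dir (w *m normal_mx),
      forall w, U w -> N (F w) /\ G (F w) = w &
      forall y, N y -> U (G y) /\ F (G y) = y].
Proof.
move=> ac bx z4 cp; have [od _ _ _ _] := manifold_chart ac.
have [d ad dx] := manifold_cover x.
have [sb _ [g sg gb]] := ob_b_embedding ob.
set S := (_ `*` _) in sb sg gb.
pose pl : chart R 'rV[R]_2 2 := Chart setT id id.
pose ga := prod_chart d pl.
pose w0 : 'rV[R]_4 := coord ga (x, z) *m delete_mx.
have ap : prod_atlas (atlas V) (@euclid_atlas R 2) ga by exists d => //; exists pl.
have pK : forall y : V * 'rV[R]_2, dom ga y -> param ga (coord ga y) = y.
  move=> [y s] [/= dy _]; rewrite row_mxKl row_mxKr; congr pair; exact: param_coord.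
have Sx : S (x, z) by [].
have px : dom ga (x, z) by [].
have w0E : w0 *m insert_mx = coord ga (x, z).
  apply: delete_insertK; rewrite row_mxKl; exact/(boundary_coord0 ad dx).
have cl : {for w0, continuous (fun w : 'rV[R]_4 => lsubmx (w *m insert_mx))}.
  apply: (@continuous_comp _ _ _ (mulmxr insert_mx) (fun u : 'rV[R]_(3 + 2) => lsubmx u)).
    exact: mulmxr_continuous.
  exact: continuous_lsubmx.
have cr : {for w0, continuous (fun w : 'rV[R]_4 => rsubmx (w *m insert_mx))}.
  apply: (@continuous_comp _ _ _ (mulmxr insert_mx) (fun u : 'rV[R]_(3 + 2) => rsubmx u)).
    exact: mulmxr_continuous.
  exact: continuous_rsubmx.
have lw0 : lsubmx (w0 *m insert_mx) = coord d x by rewrite w0E; exact: row_mxKl.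
have rw0 : rsubmx (w0 *m insert_mx) = z by rewrite w0E; exact: row_mxKr.
have near_bd : \forall w \near w0, exists x', [/\ dom d x', bd x' & coord d x' = lsubmx (w *m insert_mx)].
  have near_im : \forall w \near w0, 0 <= (lsubmx (w *m insert_mx)) 0 0 -> image_of d (lsubmx (w *m insert_mx)).
    have := image_of_near ad dx; rewrite -lw0 => H; exact: (cl _ H).
  near=> w; have : 0 <= (lsubmx (w *m insert_mx)) 0 0 -> image_of d (lsubmx (w *m insert_mx)) by near: w.
  rewrite lsubmx_insert0 lexx => /(_ isT)[x' dx' x'E]; exists x'; split => //.
  by apply/(boundary_coord0 ad dx'); rewrite x'E lsubmx_insert0.
have near_z : \forall w \near w0, sqnorm2 (rsubmx (w *m insert_mx)) < 4.
  have cN : {for z, continuous (@sqnorm2 R)} := differentiable_continuous (differentiable_sqnorm2 z).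
  have nz : nbhs (sqnorm2 z) [set s : R | s < 4] by exact: lt_nbhsl.
  by have := cN _ nz; rewrite -rw0 => H; exact: (cr _ H).
have Hnear : \forall w \near w0, (coord ga @` (dom ga `&` S)) (w *m insert_mx).
  near=> w.
  have [x' [dx' bx' x'E]] : exists x', [/\ dom d x', bd x' & coord d x' = lsubmx (w *m insert_mx)] by near: w.
  exists (x', rsubmx (w *m insert_mx)).
    by split => //; split => //=; near: w.
  by rewrite /= x'E hsubmxK.
have Hlim : (fun w : 'rV[R]_4 => param ga (w *m insert_mx)) @ w0 --> (x, z).
  move=> N [[A B] [/= nA nB] AB].
  suff H : \forall w \near w0, N (param ga (w *m insert_mx)) by exact: H.
  have nA' : \forall w \near w0, image_of d (lsubmx (w *m insert_mx)) -> A (param d (lsubmx (w *m insert_mx))).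
    have := param_near ad dx nA; rewrite -lw0 => nA'; exact: (cl _ nA').
  have nB' : \forall w \near w0, B (rsubmx (w *m insert_mx)).
    by rewrite -rw0 in nB; exact: (cr _ nB).
  near=> w; apply: AB; split => /=; last by near: w.
  have [x' [dx' _ x'E]] : exists x', [/\ dom d x', bd x' & coord d x' = lsubmx (w *m insert_mx)] by near: w.
  have : image_of d (lsubmx (w *m insert_mx)) -> A (param d (lsubmx (w *m insert_mx))) by near: w.
  by apply; exists x'.
have [U [N [F [G [HC [HS HF HFG HGF]]]]]] := @embedding_local R (V * 'rV[R]_2)%type M (3 + 2) 4
  (prod_atlas (atlas V) (@euclid_atlas R 2)) (atlas M) S (ob_b ob) g ga c (x, z)
  insert_mx delete_mx w0 sb sg gb ap ac od pK
  (fun y => param_coord ac) Sx px cp insert_deleteK w0E Hnear Hlim.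
exists U, N, F, G, w0; split; first exact: HC.
split; [by rewrite normal_mxE|move=> w Uw|exact: HFG|exact: HGF].
have [cw Fw] := HF w Uw; have [[bw zw] _ _] := HS w Uw.
by rewrite Fw (param_coord ac cw) page_dir_b // normal_mxE.
Unshelve. all: by end_near. Qed.

Lemma phase_at_tube c x z : atlas M c -> bd x -> z != 0 -> sqnorm2 z < 4 ->
  dom c (ob_b ob (x, z)) -> phase_at ob c (coord c (ob_b ob (x, z))).
Proof.
move=> ac bx z0 z4 cp.
have [U [N [F [G [w0 [[CF CG Uw0 Nx Fw0] [w0z HF HFG HGF]]]]]]] := tubular_chart ac bx z4 cp.
have CZ := C1on_postcomp normal_mx CG.
pose Z y := G y *m normal_mx.
have oN : open N by case: CG.
have cZ y : N y -> {for y, continuous Z}.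
  by move=> Ny; case: CZ => _ /(_ _ Ny)[/differentiable_continuous].
have oN' : open [set y | N y /\ Z y != 0].
  rewrite openE => y [Ny Zy]; apply: filterI; first exact: open_nbhs_nbhs.
  have e0 : 0 < `|Z y| by rewrite normr_gt0.
  have : \forall y' \near y, ball (Z y) `|Z y| (Z y') by apply: (cZ y Ny); exact: nbhsx_ballx.
  apply: filterS => y'; rewrite -ball_normE /= => H; apply/eqP => E.
  by move: H; rewrite E subr0 ltxx.
have G0 : G (coord c (ob_b ob (x, z))) = w0 by rewrite -Fw0; have [] := HFG w0 Uw0.
exists [set y | N y /\ Z y != 0], Z; split.
- by apply: C1on_subset CZ; [exact: oN'|move=> y []].
- by split; [exact: Nx|rewrite /Z G0 w0z].
- move=> y [Ny Zy]; split; first exact: Zy.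
  by have [Uy yE] := HGF y Ny; rewrite -{1}yE HF.
have oU : open U by case: CF.
have nU : nbhs w0 U by exact: open_nbhs_nbhs.
have [dF _] : differentiable F w0 /\ True by case: CF => _ /(_ _ Uw0)[].
have [dG _] : differentiable G (F w0) /\ True.
  by rewrite Fw0; case: CG => _ /(_ _ Nx)[].
(* The quarter turn of [z] in the disc directions, whose [cross] with [z] is [sqnorm2 z]. *)
pose u : 'rV[R]_4 := (row_mx 0 (row2 (- z 0 1) (z 0 0)) : 'rV[R]_(2 + 2)).
exists ('D_u F w0).
have -> : 'D_('D_u F w0) Z (coord c (ob_b ob (x, z))) = row2 (- z 0 1) (z 0 0).
  rewrite -Fw0 (@derive_comp _ _ _ _ G (mulmxr normal_mx)) //; last exact: differentiable_mulmxr.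
  have -> : 'D_('D_u F w0) G (F w0) = u.
    rewrite -derive_comp // (@near_eq_derive _ _ _ _ id); first exact: derive_id.
    by apply: filterS nU => w Uw; have [] := HFG w Uw.
  rewrite derive_mulmxr /u.
  have := mul_row_col (0 : 'rV[R]_2) (row2 (- z 0 1) (z 0 0)) (0 : 'M[R]_(2, 2)) (1%:M : 'M[R]_2).
  by rewrite mulmx0 mulmx1 add0r.
rewrite /Z G0 w0z /cross !mxE /= mulrN opprK -!expr2.
by have := sqnorm2_gt0 z0; rewrite lt_def => /andP[].
Qed.

Lemma phase_off_binding c y : atlas M c -> image_of c y -> ~ binding ob (param c y) ->
  phase_at ob c y.
Proof.
move=> ac [p cp <-]; rewrite (param_coord ac cp) => /off_binding.
move=> [[x [t [nbx pE]]]|[x [z [bx z0 z4 pE]]]]; rewrite pE in cp *.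
  exact: phase_at_interior.
exact: phase_at_tube.
Qed.

End Tubular.

(** * The co-orientation of the isotropic foliation *)

Section NormalDirections.
Context {R : realType}.

Lemma embed_normal (a b : R) :
  (row_mx 0 (row2 a b) : 'rV[R]_(2 + 2)) *m normal_mx = row2 a b.
Proof.
have := mul_row_col (0 : 'rV[R]_2) (row2 a b) (0 : 'M[R]_(2, 2)) (1%:M : 'M[R]_2).
by rewrite mulmx0 mulmx1 add0r.
Qed.

Lemma norm_embed_normal (a b r : R) : `|a| < r -> `|b| < r ->
  `|row_mx 0 (row2 a b) : 'rV[R]_(2 + 2)| < r.
Proof.
move=> ar br; have r0 : 0 < r := le_lt_trans (normr_ge0 a) ar.
apply: rV_norm_lt => // i; case: (split_ordP i) => j ->.
  by rewrite row_mxEl mxE normr0.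
by rewrite row_mxEr mxE; case: ifP.
Qed.

(* The binding has codimension 2, hence does not separate locally. *)
Lemma punctured_transfer (w0 : 'rV[R]_4) (r : R) (P : 'rV[R]_4 -> Prop) :
  0 < r -> w0 *m normal_mx = 0 ->
  let A := ball w0 r `&` [set w | w *m normal_mx != 0] in
  (forall w, A w -> \forall w' \near w, P w' <-> P w) ->
  forall w w', A w -> A w' -> P w -> P w'.
Proof.
move=> r0 w00 A HP.
(* Four convex half-balls cover the punctured ball, and [P] is constant on each. Half-balls for
   different [j] meet in a corner, which links every one of them to [corner 1 1]. *)
pose half (j : 'I_2) (s : R) : set 'rV[R]_4 := ball w0 r `&` [set w | 0 < s * (w *m normal_mx) 0 j].
have halfA j s w : half j s w -> A w.
  move=> [bw /= sw]; split; first exact: bw.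
  by apply/eqP => w0'; move: sw; rewrite w0' mxE mulr0 ltxx.
have half_convex j s : convex_set (half j s).
  apply: convex_setI; first exact: ball_convex.
  move=> x y t /= x0 y0 /andP[t0 t1].
  have -> : s * ((x + t *: (y - x)) *m normal_mx) 0 j =
      (1 - t) * (s * (x *m normal_mx) 0 j) + t * (s * (y *m normal_mx) 0 j).
    by rewrite mulmxDl -scalemxAl mulmxBl !mxE; ring.
  have [->|tn0] := eqVneq t 0; first by rewrite subr0 mul1r mul0r addr0.
  rewrite ltr_wpDl //; first by rewrite mulr_ge0 ?subr_ge0 // ltW.
  by rewrite mulr_gt0 // lt_def tn0.
have half_transfer j s w w' : half j s w -> half j s w' -> P w <-> P w'.
  have T u u' : half j s u -> half j s u' -> P u -> P u'.
    apply: (connected_transfer (convex_set_connected (half_convex j s))) => v /halfA /HP.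
    by apply: filterS => v' H _.
  by move=> hw hw'; split; apply: T.
pose corner (s s' : R) : 'rV[R]_4 := w0 + (row_mx 0 (row2 (s * (r / 2)) (s' * (r / 2))) : 'rV[R]_(2 + 2)).
have cornerP s s' : `|s| = 1 -> `|s'| = 1 -> half 0 s (corner s s') /\ half 1 s' (corner s s').
  move=> s1 s'1; have na (a : R) : `|a| = 1 -> `|a * (r / 2)| < r.
    by move=> a1; rewrite normrM a1 mul1r ger0_norm ?divr_ge0 ?ltW //; lra.
  have b : ball w0 r (corner s s').
    by rewrite -ball_normE /= opprD addNKr normrN norm_embed_normal ?na.
  have q (a : R) : `|a| = 1 -> 0 < a * (a * (r / 2)).
    by move=> a1; rewrite mulrA -expr2 -real_normK ?num_real // a1 expr1n mul1r divr_gt0.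
  have E : corner s s' *m normal_mx = row2 (s * (r / 2)) (s' * (r / 2)).
    by rewrite mulmxDl w00 add0r embed_normal.
  by split; (split; first exact: b); rewrite /= E mxE /= q.
have sg1 (a : R) : a != 0 -> `|Num.sg a| = 1 by move=> a0; rewrite normr_sg a0.
have sgP (a : R) : a != 0 -> 0 < Num.sg a * a by move=> a0; rewrite -normrEsg normr_gt0.
have n1 : `|1 : R| = 1 by rewrite normr1.
have main w : A w -> P w <-> P (corner 1 1).
  move=> [bw /= wn].
  have [wi0|wi0] := eqVneq ((w *m normal_mx) 0 0) 0.
    have wi1 : (w *m normal_mx) 0 1 != 0.
      apply: contra_neq wn => wi1; rewrite (row2P wi0 wi1).
      by apply/esym/row2P; rewrite mxE.
    have [c0 c1] := cornerP 1 _ n1 (sg1 _ wi1); have [d0 d1] := cornerP 1 1 n1 n1.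
    have h : half 1 (Num.sg ((w *m normal_mx) 0 1)) w by split; [exact: bw|exact: sgP].
    by rewrite (half_transfer _ _ _ _ h c1); exact: half_transfer c0 d0.
  have [c0 c1] := cornerP _ 1 (sg1 _ wi0) n1; have [d0 d1] := cornerP 1 1 n1 n1.
  have h : half 0 (Num.sg ((w *m normal_mx) 0 0)) w by split; [exact: bw|exact: sgP].
  by rewrite (half_transfer _ _ _ _ h c0); exact: half_transfer c1 d1.
by move=> w w' Aw Aw' Pw; apply/(main w' Aw')/(main w Aw).
Qed.

End NormalDirections.

Section NoOpenBook.
Context {R : realType} {n : nat}.
Local Notation M := (orbit_manifold R n).
Local Notation pr := (@orbit_of R n : 'rV[R]_4 -> M).
Variables (n_gt0 : (0 < n)%N) (ob : open_book M).
Implicit Types (x y w : 'rV[R]_4).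

(* The images of all charts cover this half-space, which is a convex substitute for
   the universal cover. *)
Definition cover_side : set 'rV[R]_4 := [set y | 2^-1 < y 0 0].
Local Notation H := cover_side.

Lemma cover_side_open : open H.
Proof.
have : open [set r : R | 2^-1 < r] by exact: open_gt.
by move: (@coord_continuous R 1 4 0 0) => /continuousP; apply.
Qed.

Lemma cover_side_convex : convex_set H.
Proof.
move=> x y t /= x0 y0 /andP[t0 t1]; rewrite /H /= !mxE.
have a : (1 - t) * 2^-1 <= (1 - t) * x 0 0 by rewrite ler_wpM2l ?subr_ge0 // ltW.
have b : t * 2^-1 <= t * y 0 0 by rewrite ler_wpM2l // ltW.
have [->|tn0] := eqVneq t 0; first by rewrite mul0r addr0.
have tp : 0 < t by rewrite lt_def tn0.
have : t * 2^-1 < t * y 0 0 by rewrite ltr_pM2l.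
lra.
Qed.

Lemma cover_chart y : H y ->
  exists c, [/\ atlas M c, image_of c y & param c = pr].
Proof.
(* Centres of charts need a first coordinate at least 1; on [H] it is raised by less than 1/2. *)
move=> y0; pose x : 'rV[R]_4 := \row_i (if i == 0 then Num.max (y 0 0) 1 else y 0 i).
exists (orbit_chart n x); split; [|rewrite image_of_orbit_chart|by []].
  by exists x => //; rewrite /= mxE /= le_max lexx orbT.
rewrite -ball_normE /=; apply: rV_norm_lt; first by rewrite invr_gt0.
move=> i; rewrite !mxE; have [->|_] := eqVneq i 0; last by rewrite subrr normr0 invr_gt0.
move: y0; rewrite /H /= ltr_norml.
by have [a|a] := leP (y 0 0) 1; rewrite ?(max_r a) ?(max_l (ltW a)) => ?; apply/andP; split; lra.
Qed.

Definition engel_field y : 'rV[R]_4 := engel_curve n 0 (y 0 0).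
Definition cover_dir y : 'rV[R]_2 := page_dir ob (pr y).
Definition off y : Prop := ~ binding ob (pr y).
(** Off the binding, twice the angular velocity of the page angle along [f]. *)
Definition turning y : R := cross (cover_dir y) ('D_(engel_field y) cover_dir y).

Local Notation f := engel_field.
Local Notation Th := cover_dir.

Definition phase_on (N : set 'rV[R]_4) (Z : 'rV[R]_4 -> 'rV[R]_2) : Prop :=
  C1on N Z /\ forall w, N w -> Z w != 0 /\ Th w = double_dir (Z w).

Lemma off_phase y : H y -> off y -> exists N Z,
  [/\ phase_on N Z, N y & exists v, cross (Z y) ('D_v Z y) != 0].
Proof.
move=> Hy oy; have [c [ac cy pc]] := cover_chart Hy.
have [] := @phase_off_binding _ _ ob c y ac cy; first by rewrite pc.
by rewrite pc => N [Z [CZ Ny ZE Hv]]; exists N, Z.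
Qed.

Lemma phase_off N Z y : phase_on N Z -> N y -> off y.
Proof.
move=> [_ HZ] /HZ[Z0 ZE] /binding_dir; rewrite -/(Th y) ZE => /eqP.
exact/negP/double_dir_neq0.
Qed.

Lemma phase_derive N Z y v : phase_on N Z -> N y ->
  differentiable Th y /\ 'D_v Th y = 'D_('D_v Z y) double_dir (Z y).
Proof.
move=> [[oN CZ] HZ] Ny; have [Z0 _] := HZ y Ny; have [dZ _] := CZ y Ny.
have nN : nbhs y N by exact: open_nbhs_nbhs.
have E : \forall w \near y, (double_dir \o Z) w = Th w.
  by apply: filterS nN => w /HZ[].
have dd := differentiable_double_dir Z0.
split.
  have dc : differentiable (double_dir \o Z) y by exact: differentiable_comp.
  exact: (near_eq_differentiable E dc).
by rewrite -derive_comp //; apply/esym/near_eq_derive.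
Qed.

Lemma turningE N Z y : phase_on N Z -> N y ->
  turning y = 2 * cross (Z y) ('D_(f y) Z y) / sqnorm2 (Z y).
Proof.
move=> PZ Ny; have [Z0 ZE] := PZ.2 y Ny.
by rewrite /turning (phase_derive (f y) PZ Ny).2 ZE cross_derive_double_dir.
Qed.

(** [C1on] gives continuity of derivatives in a fixed direction, whereas [f] varies; so the
    derivative along [f] is expanded over the coordinate directions. *)
Lemma turning_continuous y : H y -> off y -> {for y, continuous turning}.
Proof.
move=> Hy oy; have [N [Z [PZ Ny _]]] := off_phase Hy oy.
have [[oN CZ] HZ] := PZ; have nN : nbhs y N by exact: open_nbhs_nbhs.
have [Z0 _] := HZ y Ny; have N0 : sqnorm2 (Z y) != 0 by rewrite gt_eqF // sqnorm2_gt0.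
have [dZ cZ] := CZ y Ny.
pose D w := \sum_(i < 4) f w 0 i *: 'D_(delta_mx 0 i) Z w.
have E : \forall w \near y, 2 * cross (Z w) (D w) / sqnorm2 (Z w) = turning w.
  apply: filterS nN => w Nw; rewrite (turningE PZ Nw) derive_sum_coord //.
  by have [] := CZ w Nw.
apply: continuous_near_eq E _.
have cf : {for y, continuous f}.
  apply: (@differentiable_continuous _ _ _ y f); apply: differentiable_coord0.
  by have [] := is_derive_engel_curve n 0 (y 0 0).
have cc m (g : 'rV[R]_4 -> 'rV[R]_m) i : {for y, continuous g} -> {for y, continuous (fun w => g w 0 i)}.
  move=> cg; apply: (@continuous_comp _ _ _ g (fun z : 'rV[R]_m => z 0 i)) => //.
  exact: coord_continuous.
have cD : {for y, continuous D}.
  have := @cvg_sumr R _ (nbhs y) _ _ 4 (fun i w => f w 0 i *: 'D_(delta_mx 0 i) Z w)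
    (fun i => f y 0 i *: 'D_(delta_mx 0 i) Z y).
  apply => i; apply: cvgZ; [exact: cc|exact: cZ].
have cZ0 := differentiable_continuous dZ.
have cM (g h : 'rV[R]_4 -> R) : {for y, continuous g} -> {for y, continuous h} ->
    {for y, continuous (fun w => g w * h w)} by exact: continuousM.
rewrite /cross; apply: (cM (fun w => 2 * _) (fun w => (sqnorm2 (Z w))^-1)).
  apply: (cM (fun=> 2)); first exact: cst_continuous.
  apply: (@continuousB _ _ _ (fun w => Z w 0 0 * D w 0 1) (fun w => Z w 0 1 * D w 0 0)).
    by apply: cM; exact: cc.
  by apply: cM; exact: cc.
apply: (@continuousV _ _ (fun w => sqnorm2 (Z w))) => //.
have := differentiable_continuous (differentiable_sqnorm2 (Z y)).
exact: continuous_comp.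
Qed.

Variables (W : tangent_distribution M).
Hypothesis W_isotropic : isotropic_line_field (engel_dist 1) W.
Hypothesis W_transverse : forall (theta : R) p c, page_interior ob theta p ->
  atlas M c -> dom c p -> forall v, exists w u,
    [/\ W c (coord c p) w, tangent_to (page_interior ob theta) c p u & v = w + u].

(** Along a curve in a page [page_dir] is constant, hence so is the double direction of [Z], and
    [cross_derive_double_dir] shows that [Z] does not rotate. *)
Lemma tangent_page_derive N Z theta y c u : phase_on N Z -> N y -> atlas M c ->
  image_of c y -> param c = pr -> tangent_to (page_interior ob theta) c (pr y) u ->
  cross (Z y) ('D_u Z y) = 0.
Proof.
move=> PZ Ny ac cy pc [e [gamma [e0 [cg sg] gS g0 uE]]].
have [p cp pE] := cy; have yp : pr y = p by rewrite -pE -pc param_coord.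
pose li : chart R R 1 := Chart setT (fun t : R => const_mx t) (fun v : 'rV[R]_1 => v 0 0).
have I0 : [set t : R | - e < t < e] 0 by rewrite /= oppr_lt0 e0.
have oI : open [set t : R | - e < t < e].
  have -> : [set t : R | - e < t < e] = `]- e, e[%classic.
    by apply/seteqP; split => t; rewrite /= in_itv.
  exact: itv_open.
have nI : nbhs (0 : R) [set t : R | - e < t < e] by exact: open_nbhs_nbhs.
have cg0 : {for 0, continuous gamma}.
  by move: cg; rewrite (continuous_open_subspace _ oI) => /(_ 0); apply; rewrite inE.
have [od _ _ _ _] := manifold_chart ac.
have ndom : \forall t \near (0 : R), dom c (gamma t).
  by apply: cg0; rewrite g0 yp; exact: open_nbhs_nbhs.
have [] := sg li c _ ac (const_mx 0).
- by [].
- by exists 0 => //; split; [split|rewrite /preimage /= g0 yp].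
move=> U [G [oU U0 sG GE]].
have dG : differentiable G (const_mx 0) by have [_ /(_ _ U0)[]] := smooth_open_C1 oU sG.
have dK : differentiable (fun t : R => const_mx t : 'rV[R]_1) 0.
  apply: differentiable_rV => i.
  by have -> : (fun t : R => (const_mx t : 'rV[R]_1) 0 i) = id by apply/funext => t; rewrite mxE.
have nU : \forall t \near (0 : R), U (const_mx t).
  by apply: (differentiable_continuous dK); exact: open_nbhs_nbhs.
have gE : \forall t \near (0 : R), (coord c \o gamma) t = (G \o (fun t : R => const_mx t : 'rV[R]_1)) t.
  near=> t.
  have := GE (const_mx t); rewrite /= mxE; apply; last by near: t.
  exists t => //; split; first by split => //; near: t.
  by rewrite /preimage /=; near: t.
have dg : differentiable (coord c \o gamma) 0.
  apply: near_eq_differentiable (differentiable_comp dK dG).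
  by apply: filterS gE => t /esym.
have yE : (coord c \o gamma) 0 = y by rewrite /= g0 yp.
have [dTh DTh] := phase_derive u PZ Ny.
have [Z0 ZE] := PZ.2 y Ny.
have D0 : 'D_u Th y = 0.
  rewrite -uE -yE -derive_comp //; last by rewrite yE.
  rewrite (@near_eq_derive _ _ _ _ (cst (double_dir (circle_point theta)))) ?derive_cst //.
  near=> t.
  rewrite /= /Th -pc param_coord //; last by near: t.
  apply: page_dir_page; apply: gS; near: t; exact: nI.
have := cross_derive_double_dir ('D_u Z y) Z0; rewrite -DTh D0 /cross !mxE !mulr0 subrr.
move=> /esym/eqP; rewrite mulf_eq0 invr_eq0 (gt_eqF (sqnorm2_gt0 Z0)) orbF mulf_eq0 pnatr_eq0 /=.
by move/eqP.
Unshelve. all: by end_near. Qed.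

(** If [f] did not rotate the page angle, no vector would: vectors tangent to pages do not, and by
    transversality every vector is a multiple of [f] plus such a vector. But [off_phase] supplies
    one that does. *)
Lemma turning_neq0 y : H y -> off y -> turning y != 0.
Proof.
move=> Hy oy; have [N [Z [PZ Ny [v]]]] := off_phase Hy oy; apply: contra_neq => s0.
have [c [ac cy pc]] := cover_chart Hy.
have [p cp pE] := cy; have yp : pr y = p by rewrite -pE -pc param_coord.
have [theta pt] := off_binding_page oy.
rewrite yp in pt.
have [w [u [Ww tu ->]]] := W_transverse pt ac cp v.
rewrite pE in Ww; rewrite -yp in tu.
have [a wE] := isotropic_engel_dist n_gt0 W_isotropic ac cy Ww.
have [[_ /(_ _ Ny)[dZ _]] /(_ y Ny)[Z0 _]] := PZ.
rewrite deriveD_dir // crossD (tangent_page_derive PZ Ny ac cy pc tu) addr0.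
rewrite wE deriveZ_dir // crossZ.
have /eqP := s0; rewrite (turningE PZ Ny) mulf_eq0 invr_eq0 (gt_eqF (sqnorm2_gt0 Z0)) orbF.
by rewrite mulf_eq0 pnatr_eq0 /= => /eqP ->; rewrite mulr0.
Qed.

Lemma off_near y : H y -> off y -> \forall w \near y, off w.
Proof.
move=> Hy oy; have [N [Z [PZ Ny _]]] := off_phase Hy oy.
have nN : nbhs y N by apply: open_nbhs_nbhs; split => //; case: PZ => -[].
by apply: filterS nN => w; exact: phase_off PZ.
Qed.

Lemma turning_sign_near y : H y -> off y ->
  \forall w \near y, 0 < turning w <-> 0 < turning y.
Proof.
move=> Hy oy; have cs := turning_continuous Hy oy.
have [s0|s0] := ltP 0 (turning y).
  have K : nbhs (turning y) [set s : R | 0 < s] by exact: lt_nbhsr.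
  near=> w; split=> _; [exact: isT|near: w; exact: (cs _ K)].
have s0' : turning y < 0 by rewrite lt_def s0 andbT eq_sym turning_neq0.
have K : nbhs (turning y) [set s : R | s < 0] by exact: lt_nbhsl.
near=> w; split; last by [].
rewrite ltNge => /negP[]; apply: ltW; near: w; exact: (cs _ K).
Unshelve. all: by end_near. Qed.

(** [cover_dir] is invariant under [tau], while the differential of [tau] takes [f] to [- f]. Since
    [tau] increases t, it preserves the half-space. *)
Lemma turning_deck y : H y -> off y -> let tau := deck_act n (Deck 1 0 0 0) in
  [/\ H (tau y), off (tau y) & turning (tau y) = - turning y].
Proof.
move=> Hy oy tau; have tE z : pr (tau z) = pr z by exact: orbit_of_act.
have t0 : tau y 0 0 = y 0 0 + 1%:~R * pi by rewrite /tau deck_actE mxE /=.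
have Ht : H (tau y) by move: Hy; rewrite /H /= t0 mul1r; have := pi_gt0 R; lra.
have ot : off (tau y) by rewrite /off tE.
split => //; have [N [Z [PZ Ny _]]] := off_phase Ht ot.
have [dT _] := phase_derive 0 PZ Ny.
rewrite /turning.
have -> : Th (tau y) = Th y by rewrite /Th tE.
have fE : f (tau y) = (-1) *: 'D_(f y) tau y.
  rewrite /f t0 (engel_curve_deck n (Deck 1 0 0 0)) /=; congr (_ *: _).
  by rewrite derive_affine.
have TE : Th = Th \o tau by apply/funext => z; rewrite /Th /= tE.
rewrite {1}fE deriveZ_dir // crossZ mulN1r; congr (- cross _ _).
rewrite {2}TE derive_comp //; exact: deck_act_differentiable.
Qed.

(** The last clause, density of the complement of the binding, allows a sign to be assigned to
    points of the binding as well. *)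
Definition sign_nbhd (V : set 'rV[R]_4) : Prop :=
  [/\ open V,
      forall a b, V a -> V b -> off a -> off b -> 0 < turning a -> 0 < turning b &
      forall a B, V a -> nbhs a B -> exists2 b, B b & off b].

Lemma sign_nbhd_off y : H y -> off y -> exists2 V, sign_nbhd V & V y.
Proof.
move=> Hy oy.
pose V0 := [set w | off w /\ (0 < turning w <-> 0 < turning y)].
have nV : nbhs y V0 by apply: filterI; [exact: off_near|exact: turning_sign_near].
have sV : interior V0 `<=` V0 by exact: interior_subset.
exists (interior V0); last exact: nV.
split; first exact: open_interior.
  by move=> a b /sV[_ Ha] /sV[_ Hb] _ _ /Ha /Hb.
by move=> a B /sV[oa _] /nbhs_singleton Ba; exists a.
Qed.

(** In a tubular chart the complement of the binding is a punctured ball, to which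
    [punctured_transfer] applies. *)
Lemma sign_nbhd_binding y : H y -> ~ off y -> exists2 V, sign_nbhd V & V y.
Proof.
move=> Hy /contrapT[x bx xE]; have [c [ac cy pc]] := cover_chart Hy.
have [p cp pE] := cy; have yp : ob_b ob (x, 0) = p by rewrite xE -pE -pc param_coord.
have z4 : sqnorm2 (0 : 'rV[R]_2) < 4 by rewrite /sqnorm2 !mxE expr0n addr0.
have dp : dom c (ob_b ob (x, 0)) by rewrite yp.
have [U [N [F [G [w0 [[CF CG Uw0 Nx Fw0] [w0z HF HFG HGF]]]]]]] := tubular_chart ac bx z4 dp.
rewrite yp pE in Nx Fw0.
have Gy : G y = w0 by rewrite -Fw0; exact: (HFG w0 Uw0).2.
have [oU CF'] := CF; have [oN CG'] := CG.
have cF w : U w -> {for w, continuous F}.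
  by move=> /CF'[/differentiable_continuous].
have cG w : N w -> {for w, continuous G}.
  by move=> /CG'[/differentiable_continuous].
have dirF w : U w -> Th (F w) = double_dir (w *m normal_mx).
  by move=> Uw; rewrite -HF // pc.
have offF w : U w -> off (F w) <-> w *m normal_mx != 0.
  move=> Uw; split=> [oF|wn].
    apply: contra_notN oF => /eqP wn; apply/binding_dir.
    by rewrite -/(Th (F w)) dirF // wn double_dir0.
  by move=> /binding_dir; rewrite -/(Th (F w)) dirF // => /eqP; apply/negP/double_dir_neq0.
have [r r0 rU] : exists2 r : R, 0 < r & ball w0 r `<=` U `&` F @^-1` H.
  apply/nbhs_ballP; apply: filterI; first exact: open_nbhs_nbhs.
  apply: (cF w0 Uw0); rewrite Fw0; apply: open_nbhs_nbhs; split; [exact: cover_side_open|exact: Hy].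
have signF w : U w -> H (F w) -> w *m normal_mx != 0 ->
    \forall w' \near w, 0 < turning (F w') <-> 0 < turning (F w).
  move=> Uw Hw wn; have K := turning_sign_near Hw (iffRL (offF w Uw) wn); exact: (cF w Uw _ K).
exists (N `&` G @^-1` ball w0 r); last first.
  by split; [exact: Nx|rewrite /preimage /= Gy; exact: ballxx].
split.
- rewrite openE => a [Na Ga]; apply: filterI; first exact: open_nbhs_nbhs.
  by apply: (cG a Na); apply: open_nbhs_nbhs; split; [exact: ball_open|exact: Ga].
- move=> a b [Na Ga] [Nb Gb].
  have [UGa FGa] := HGF a Na; have [UGb FGb] := HGF b Nb.
  rewrite -FGa -FGb => /(offF _ UGa) na /(offF _ UGb) nb.
  apply: (punctured_transfer (P := fun w => 0 < turning (F w)) r0 w0z) => //.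
  by move=> w [/rU[Uw Hw] wn]; exact: signF.
- move=> a B [Na Ga] nB; have [oa|/contrapT ba] := pselect (off a).
    by exists a => //; exact: nbhs_singleton.
  have [UGa FGa] := HGF a Na.
  have [e e0 eB] : exists2 e : R, 0 < e & ball (G a) e `<=` U `&` F @^-1` B.
    apply/nbhs_ballP; apply: filterI; first exact: open_nbhs_nbhs.
    by apply: (cF _ UGa); rewrite FGa.
  (* Displacing a point of the binding in a disc direction takes it off the binding. *)
  pose w := G a + (row_mx 0 (row2 (e / 2) 0) : 'rV[R]_(2 + 2)).
  have [Uw Bw] : (U `&` F @^-1` B) w.
    apply: eB; rewrite -ball_normE /= opprD addNKr normrN norm_embed_normal ?normr0 //.
    by rewrite ger0_norm ?divr_ge0 ?ltW //; lra.
  exists (F w); first exact: Bw.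
  apply/(offF _ Uw); rewrite mulmxDl embed_normal.
  have -> : G a *m normal_mx = 0.
    apply/eqP/negPn/negP => na; have := iffRL (offF _ UGa) na; rewrite FGa; exact.
  rewrite add0r; apply/eqP => /rowP/(_ 0); rewrite !mxE /= => /eqP.
  by rewrite mulf_eq0 invr_eq0 (gt_eqF e0) pnatr_eq0.
Qed.

Lemma sign_nbhd_ex y : H y -> exists2 V, sign_nbhd V & V y.
Proof.
move=> Hy; have [oy|oy] := pselect (off y); first exact: sign_nbhd_off.
exact: sign_nbhd_binding.
Qed.

Lemma not_isotropic_transverse : False.
Proof.
(* This property of germs makes sense on the binding too. On a [sign_nbhd] it amounts to the
   existence of one positive point off the binding, so it is locally constant on all of [H]. *)
pose P x := \forall y \near x, off y -> 0 < turning y.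
have PE V x : sign_nbhd V -> V x -> P x <-> exists b, [/\ V b, off b & 0 < turning b].
  move=> [oV sV dV] Vx; have nV : nbhs x V by exact: open_nbhs_nbhs.
  split=> [Px|[b [Vb ob' sb]]].
    by have [b [Vb Pb] ob'] := dV x _ Vx (filterI nV Px); exists b; split => //; exact: Pb.
  by apply: filterS nV => y Vy oy; exact: sV sb.
have step x : H x -> \forall y \near x, H y -> (P y <-> P x).
  move=> Hx; have [V sV Vx] := sign_nbhd_ex Hx.
  have nV : nbhs x V by apply: open_nbhs_nbhs; split => //; case: sV.
  by apply: filterS nV => y Vy _; rewrite (PE V x sV Vx) (PE V y sV Vy).
have transfer := connected_transfer (convex_set_connected cover_side_convex) step.
have offP y : H y -> off y -> P y <-> 0 < turning y.
  move=> Hy oy; split=> [/nbhs_singleton|sy]; first exact.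
  by apply: filterS (turning_sign_near Hy oy) => w wy _; apply/wy.
pose y0 : 'rV[R]_4 := const_mx 1.
have Hy0 : H y0 by rewrite /H /= mxE; lra.
have [V [_ _ dV] Vy0] := sign_nbhd_ex Hy0.
have [b Hb ob'] : exists2 b, H b & off b.
  by apply: (dV y0) => //; apply: open_nbhs_nbhs; split; [exact: cover_side_open|exact: Hy0].
have [Ht ot tE] := turning_deck Hb ob'.
(* [P] records positivity only, so it is carried over from whichever of [b] and its translate has
   positive [turning]. *)
have [s0|s0] := ltP 0 (turning b).
  have : 0 < turning (deck_act n (Deck 1 0 0 0) b).
    by apply/(offP _ Ht ot)/(transfer b) => //; apply/offP.
  by rewrite tE oppr_gt0 ltNge (ltW s0).
have s1 : 0 < turning (deck_act n (Deck 1 0 0 0) b).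
  by rewrite tE oppr_gt0 lt_def s0 andbT eq_sym turning_neq0.
have : 0 < turning b by apply/(offP _ Hb ob')/(transfer _ _ Ht) => //; apply/offP.
by rewrite ltNge s0.
Qed.

End NoOpenBook.

Lemma engel_dist_no_open_book (R : realType) (n : nat) : (0 < n)%N ->
  ~ exists ob : open_book (orbit_manifold R n), supports ob (engel_dist 1).
Proof.
move=> n_gt0 [ob [_ [W [W_isotropic W_transverse _]]]].
exact: (not_isotropic_transverse n_gt0 W_isotropic W_transverse).
Qed.

Theorem corollary1p4 (R : realType) :
  exists (M : nat -> manifold R 4)
         (D : forall i : nat, tangent_distribution (M i)),
    (forall i : nat,
       closed_manifold (M i) /\ connected_manifold (M i) /\
       engel_structure (D i) /\
       ~ (exists ob : open_book (M i), supports ob (D i))) /\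
    (forall i j : nat, i <> j -> ~ diffeomorphic (M i) (M j)).
Proof.
(* The parameters are n = 2 (i + 1): positive, even and pairwise distinct. *)
have gt0 i : (0 < i.+1.*2)%N by rewrite double_gt0.
have even i : ~~ odd i.+1.*2 by rewrite odd_double.
exists (fun i => orbit_manifold R i.+1.*2), (fun i => engel_dist 1); split=> [i|i j ij dij].
  split; first exact: orbit_manifold_closed.
  split; first exact: orbit_manifold_connected.
  split; first exact: (engel_dist_engel R (gt0 i)).
  exact: engel_dist_no_open_book (gt0 i).
apply: ij; have := orbit_manifold_diffeo (gt0 i) (gt0 j) (even i) (even j) dij.
by move=> /double_inj[].
Qed.
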